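(* Let $V$ be a real vector space of finite dimension $n$ and let $A \leq \mathrm{Aff}(V)$ be a Zariski-closed subgroup acting transitively on $V$. Then the deformation space $\mathcal{D}_c(\mathbb{Z}^n, A)$ is homeomorphic to a semi-algebraic set, and in particular $\mathcal{D}_c(\mathbb{Z}^n, A)$ is a Hausdorff space.
   Context: A subgroup of $\mathrm{Aff}(V) = V\rtimes \mathrm{GL}(V)$ is an affine crystallographic group if it acts properly discontinuously on $V$ with compact quotient. For a finitely generated group $\Gamma$, $\mathrm{Hom}_c(\Gamma,A)$ is the set of injective homomorphisms $\rho: \Gamma \to A$ such that $\rho(\Gamma)$ is an affine crystallographic group, with the topology induced from $\mathrm{Hom}(\Gamma,A) \subset A^\Gamma$ (product topology, $A$ carrying its Lie group topology). $A$ acts on $\mathrm{Hom}_c(\Gamma,A)$ by conjugation, and $\mathcal{D}_c(\Gamma,A) = \mathrm{Hom}_c(\Gamma,A)/A$ carries the quotient topology. A semi-algebraic set is a semi-algebraic subset of some $\mathbb{R}^N$ with the Euclidean topology. *)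

(* Defs.v *)
From HB Require Import structures.
From mathcomp Require Import all_boot all_order all_algebra.
From mathcomp Require Import all_classical all_reals all_analysis.
(* [mpoly] is not imported: its notations clash with those of analysis *)
From mathcomp Require mpoly.

Set Implicit Arguments.
Unset Strict Implicit.
Unset Printing Implicit Defensive.

Import Order.TTheory GRing.Theory Num.Theory.
Import numFieldNormedType.Exports.

Local Open Scope classical_set_scope.
Local Open Scope ring_scope.

Definition homeomorphic (X Y : topologicalType) : Prop :=
  exists (f : X -> Y) (g : Y -> X),
    [/\ continuous f, continuous g, cancel f g & cancel g f].

(* [orb x] is meant to be the orbit of [x] under a group action on [X]. The
   orbits partition [X], so lying in the same orbit is having equal orbits; in
   this form the relation is an equivalence with no hypothesis on [orb]. *)
Section OrbitSpace.
Local Open Scope quotient_scope.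
Context {X : topologicalType} (orb : X -> set X).

Definition same_orbit (x y : X) : bool := `[< orb x = orb y >].

Lemma same_orbit_equiv : equiv_class_of same_orbit.
Proof.
split=> [x|x y|y x z].
- exact/asboolP.
- by apply/asboolP/asboolP.
- by move=> /asboolP exy /asboolP eyz; apply/asboolP; rewrite exy.
Qed.

Definition same_orbit_rel := EquivRelPack same_orbit_equiv.

Definition orbit_space : Type :=
  quotient_topology {eq_quot same_orbit_rel}.

HB.instance Definition _ := Topological.copy orbit_space
  (quotient_topology {eq_quot same_orbit_rel}).

End OrbitSpace.

Section SemiAlgebraic.
Context {R : realType} {N : nat}.

(* finite unions of sets given by finitely many conditions p = 0 and q > 0 *)
Definition semi_algebraic (S : set 'rV[R]_N) : Prop :=
  exists F : seq (seq (mpoly.mpoly N R) * seq (mpoly.mpoly N R)),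
    S = [set x : 'rV[R]_N |
          has (fun c => all (fun p => mpoly.meval (x 0) p == 0) c.1
                     && all (fun q => 0 < mpoly.meval (x 0) q) c.2) F].

End SemiAlgebraic.

Section Coordinates.
Context {R : realType} (W : vectType R).

Definition coordinates (w : W) : 'rV[R]_(\dim {:W}) :=
  passmx.rVof (vbasis {:W}) w.

(* The Euclidean topology of a finite-dimensional real vector space; neither
   it nor [zero_locus] depends on the basis used by [coordinates]. *)
Definition euclidean : Type := initial_topology coordinates.

HB.instance Definition _ := Topological.copy euclidean
  (initial_topology coordinates).

Definition zero_locus (I : set (mpoly.mpoly (\dim {:W}) R)) : set W :=
  [set w | forall p, I p -> mpoly.meval (coordinates w 0) p = 0].

End Coordinates.

Section Affine.
Context {R : realType} (V : vectType R).

(* The pair [(b, L)] stands for the map x |-> L x + b; it is an element of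
   Aff(V) = V ><| GL(V) when [L] is invertible, see [Aff]. *)
Definition affine_map : vectType R := (V * 'End(V))%type.

Definition Aff : set affine_map := [set g | lker g.2 == 0%VS].

Definition aff_act (g : affine_map) (x : V) : V := g.2 x + g.1.

Definition aff_one : affine_map := (0, \1%VF).

Definition aff_mul (g h : affine_map) : affine_map :=
  (g.2 h.1 + g.1, (g.2 \o h.2)%VF).

Definition aff_inv (g : affine_map) : affine_map :=
  (- (g.2^-1)%VF g.1, (g.2^-1)%VF).

Definition aff_subgroup (A : set affine_map) : Prop :=
  [/\ A `<=` Aff, A aff_one,
      forall g h, A g -> A h -> A (aff_mul g h) &
      forall g, A g -> A (aff_inv g)].

Definition zariski_closed (A : set affine_map) : Prop :=
  exists I, A = Aff `&` zero_locus I.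

Definition acts_transitively (A : set affine_map) : Prop :=
  forall x y : V, exists2 g, A g & aff_act g x = y.

Definition acts_properly_discontinuously (Gamma : set affine_map) : Prop :=
  forall K : set (euclidean V), compact K ->
    finite_set [set g | Gamma g /\ aff_act g @` K `&` K !=set0].

Definition aff_orbit (Gamma : set affine_map) (x : euclidean V) :
    set (euclidean V) :=
  [set aff_act g x | g in Gamma].

Definition affine_crystallographic (Gamma : set affine_map) : Prop :=
  [/\ aff_subgroup Gamma, acts_properly_discontinuously Gamma &
      compact [set: orbit_space (aff_orbit Gamma)]].

End Affine.

Section Deformation.
Context {R : realType} {V : vectType R} (G : zmodType).

(* As [A] has the topology induced from the vector space [affine_map V], the
   product topology of A^G is induced from this space. *)
Definition affine_maps_pow : topologicalType :=
  prod_topology (fun _ : G => euclidean (affine_map V)).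

Definition homs (A : set (affine_map V)) : set affine_maps_pow :=
  [set rho | (forall x, A (rho x)) /\
             (forall x y, rho (x + y) = aff_mul (rho x) (rho y))].

Definition crystallographic_homs (A : set (affine_map V)) :
    set affine_maps_pow :=
  [set rho | [/\ homs A rho, injective rho &
               affine_crystallographic (range rho)]].

Definition conj_orbit (A : set (affine_map V)) (rho : crystallographic_homs A) :
    set (crystallographic_homs A) :=
  [set sigma : crystallographic_homs A | exists2 a, A a & forall x,
     set_val sigma x = aff_mul (aff_mul a (set_val rho x)) (aff_inv a)].

Definition deformation_space (A : set (affine_map V)) : topologicalType :=
  orbit_space (@conj_orbit A).

End Deformation.

(* Main.v *)
(* An affine crystallographic group isomorphic to Z^n is unipotent: on the
   common generalized 1-eigenspace the action is the exponential of a nilpotent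
   one, and a linear relation between the logarithms at a point would bring
   infinitely many elements back into a compact set; hence the n logarithms at
   the origin form a basis of V, and the eigenspace is everything.

   A homomorphism is thus the same thing as a frame [b] of V (the logarithms at
   the origin) together with normalized commuting nilpotent logarithms [l]
   (their expression in the frame). The exponentials of the real span of the
   logarithms lie in A, commute with the group and move the origin everywhere,
   so the orbits of A are those of the stabilizer H of the origin, which acts
   by [b |-> b h] and fixes [l].

   The coset b H is recovered from the span of [w (b H)], where [w] is a
   polynomial map whose coordinates span a translation-stable space containing
   equations of H. The orthogonal projection onto this span and the least size
   of an element of b H are continuous invariants; the second makes the
   resulting injection of the orbit space into R^N proper onto its image. The
   image is semi-algebraic by quantifier elimination. *)

From mathcomp Require mpoly.
From mathcomp Require ordered_qelim qe_rcf.
From mathcomp Require Import all_boot all_order all_algebra.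
From mathcomp Require boolp.
From mathcomp Require Import ring lra zify.
Set Implicit Arguments.
Unset Strict Implicit.
Unset Printing Implicit Defensive.
Import Order.TTheory GRing.Theory Num.Theory.
Local Open Scope ring_scope.

(** * Finitely many equations define a real algebraic set *)

(** The obstacle is the topology. A continuous injection of the orbit space into R^N need not be a
    homeomorphism onto its image: cosets b H whose spans converge could a priori have all their
    representatives escaping to infinity or degenerating. This is why the size of a coset bounds b h
    and its inverse at the same time. Convergence of the invariants then gives bounded
    representatives, a cluster point of these is again an invertible frame, and polynomial
    identities pass to it. The size is not polynomial in b, but an infimum is described by a
    first-order formula, so quantifier elimination still applies. Everything else is kept
    polynomial. Exponential and logarithm are truncated at the size of the matrices, which is exact
    on nilpotent ones, and inverses are carried along as additional variables. One notion of
    polynomial function then serves continuity, Zariski density and definability. Affine maps become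
    matrices acting on rows (1, x) from the right. This reverses products, which is harmless because
    Z^n is commutative. *)

Module Noetherian.
Import mpoly boolp.

(** Induction on the number of functions. A finite set [s0] that works for the first [n] functions
    also covers every [t] whose last value is at least the maximum [B] over [s0]. What remains has
    last value [v < B], and each of these finitely many slices is covered by the induction
    hypothesis. *)
Lemma dickson (T : eqType) (f : nat -> T -> nat) n (M : T -> Prop) :
  exists s : seq T, (forall t, t \in s -> M t) /\
    forall t, M t -> exists2 t', t' \in s & forall i, (i < n)%N -> (f i t' <= f i t)%N.
Proof.
elim: n M => [|n IHn] M.
  case: (pselect (exists t, M t)) => [[t Mt]|nM].
    exists [:: t]; split=> [u|u _]; first by rewrite inE => /eqP ->.
    by exists t; rewrite ?inE.
  by exists [::]; split=> // t Mt; case: nM; exists t.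
have [s0 [s0M s0P]] := IHn M.
pose B := \max_(t <- s0) f n t.
have /choice[s sP] v := IHn (fun t => M t /\ f n t = v).
exists (s0 ++ flatten [seq s v | v <- iota 0 B]); split=> [t|t Mt].
  rewrite mem_cat => /orP[/s0M//|/flatten_mapP[v _ tv]].
  by have [/(_ t tv)[]] := sP v.
have [t0 t0s t0le] := s0P t Mt.
have [leB|ltB] := leqP B (f n t).
  exists t0; first by rewrite mem_cat t0s.
  move=> i; rewrite ltnS leq_eqVlt => /orP[/eqP->|/t0le//].
  by apply: leq_trans leB; apply: leq_bigmax_seq.
have [sM /(_ t (conj Mt erefl))[t1 t1s t1le]] := sP (f n t).
exists t1.
  rewrite mem_cat; apply/orP; right; apply/flatten_mapP.
  by exists (f n t) => //; rewrite mem_iota.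
move=> i; rewrite ltnS leq_eqVlt => /orP[/eqP->|/t1le//].
by have [_ ->] := sM _ t1s.
Qed.

(* The finite family has leading monomials generating those of the ideal of
   the zero locus (Dickson); division by it shows that it defines the locus. *)
Lemma finite_zero_locus (R : fieldType) N (I : {mpoly R[N]} -> Prop) :
  exists s : seq {mpoly R[N]}, forall x : 'I_N -> R,
    (forall p, I p -> p.@[x] = 0) <-> (forall p, p \in s -> p.@[x] = 0).
Proof.
(* The full vanishing ideal of the locus: unlike [I], it contains the remainders of divisions. *)
pose J (p : {mpoly R[N]}) :=
  forall x : 'I_N -> R, (forall q, I q -> q.@[x] = 0) -> p.@[x] = 0.
pose f i (p : {mpoly R[N]}) := if insub i is Some j then mlead p j else 0%N.
have [s [sJ sP]] := dickson f N (fun p => J p /\ p != 0).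
exists s => x; split=> [Ix p /sJ[Jp _]|sx p Ip]; first exact: Jp.
have: J p by move=> y; apply.
move: p {Ip}; apply: mleadrect => p IH Jp.
have [->|p0] := eqVneq p 0; first by rewrite meval0.
have [q qs qle] := sP p (conj Jp p0); have [Jq q0] := sJ q qs.
have le_qp : (mlead q <= mlead p)%MM.
  apply/mnm_lepP => i; have := qle i (ltn_ord i).
  by rewrite /f insubT //= => ?; rewrite (_ : Sub _ _ = i) //; apply/val_inj.
pose c := mleadc p / mleadc q.
pose r := p - (c *: 'X_[(mlead p - mlead q)%MM]) * q.
have pE : p = r + (c *: 'X_[(mlead p - mlead q)%MM]) * q by rewrite subrK.
have lq0 : mleadc q != 0 by rewrite mleadc_eq0.
have c0 : c != 0 by rewrite mulf_neq0 ?invr_neq0 ?mleadc_eq0.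
have Jr : J r by move=> y Iy; rewrite /r mevalB mevalM Jp // Jq // mulr0 subr0.
suff : r.@[x] = 0 by move=> r0; rewrite pE mevalD mevalM r0 (sx q) // mulr0 addr0.
have [->|r0] := eqVneq r 0; first by rewrite meval0.
apply: IH => //; rewrite lt_neqAle.
pose g := c *: 'X_[(mlead p - mlead q)%MM] : {mpoly R[N]}.
have lg : mlead g = (mlead p - mlead q)%MM by rewrite mleadZ // mleadXm.
have g0 : g != 0 by rewrite -mleadc_eq0 lg mcoeffZ mcoeffX eqxx mulr1.
have ldq : mlead (g * q) = mlead p by rewrite mleadM // lg submK.
have cdq : (g * q)@_(mlead p) = mleadc p.
  rewrite -{1}ldq mleadM // mleadcM lg mcoeffZ mcoeffX eqxx mulr1.
  by rewrite divfK.
apply/andP; split; last first.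
  by have := mleadB_le p (g * q); rewrite ldq joinxx.
apply/eqP => lr; have := mleadc_eq0 r; rewrite (negPf r0) lr.
by rewrite mcoeffB cdq subrr eqxx.
Qed.
End Noetherian.

(** * Exponential and logarithm of nilpotent matrices *)

Section ExpLogPolynomials.
Context {F : numFieldType} (d : nat).

Definition exp_poly : {poly F} := \poly_(k < d.+1) (k`!%:R)^-1.
(* the coefficient at 0 is 0, because 0^-1 = 0 *)
Definition log_poly : {poly F} := \poly_(k < d.+1) ((-1) ^+ k.+1 / k%:R).

Lemma dvdXnP (m : nat) (p : {poly F}) :
  reflect (forall i, (i < m)%N -> p`_i = 0) ('X^m %| p).
Proof.
apply: (iffP idP) => [/dvdpP[q ->] i im|p0]; first by rewrite coefMXn im.
rewrite -(poly_take_drop m p) (_ : take_poly m p = 0) ?add0r ?dvdp_mulIr//.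
by apply/polyP => i; rewrite coef_take_poly coef0; case: ifP => // /p0.
Qed.

Lemma deriv_exp_poly : exp_poly^`() = exp_poly - (d`!%:R)^-1 *: 'X^d.
Proof.
apply/polyP => i; rewrite coef_deriv coefB coefZ coefXn !coef_poly !ltnS.
have [id|di|->] := ltngtP i d; rewrite ?mulr0 ?subr0 ?mul0rn ?mulr1 ?subrr//.
rewrite -[LHS]mulr_natr factS natrM invfM mulrAC mulVf ?mul1r ?pnatr_eq0//.
Qed.

Lemma deriv_log_poly : (1 + 'X) * log_poly^`() = 1 - (- 'X) ^+ d.
Proof.
have -> : log_poly^`() = \sum_(k < d) (- 'X) ^+ k.
  apply/polyP => i; rewrite coef_deriv coef_poly ltnS coef_sum.
  under eq_bigr => k _ do
    rewrite exprNn -(rmorphN1 (@polyC F)) -rmorphXn /= coefCM coefXn.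
  have [id|di] := ltnP i d; last first.
    by rewrite mul0rn big1// => k _; rewrite (gtn_eqF (leq_trans (ltn_ord k) di)) mulr0.
  rewrite (bigD1 (Ordinal id))//= eqxx mulr1 big1 ?addr0 => [|k].
    by rewrite -[LHS]mulr_natr -mulrA mulVf ?mulr1 ?pnatr_eq0// !exprS !mulN1r opprK.
  by rewrite -val_eqE /= eq_sym => /negPf ->; rewrite mulr0.
by rewrite -[RHS]opprB subrX1 -mulNr opprB opprK.
Qed.

Lemma exp_poly0 : exp_poly.[0] = 1.
Proof. by rewrite horner_coef0 coef_poly fact0 invr1. Qed.

Lemma log_poly0 : log_poly.[0] = 0.
Proof. by rewrite horner_coef0 coef_poly invr0 mulr0. Qed.

Lemma dvdX_root0 (p : {poly F}) : p.[0] = 0 -> 'X %| p.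
Proof. by rewrite -['X]expr1 => p0; apply/dvdXnP => -[]// _; rewrite -horner_coef0. Qed.

Lemma exp_log_poly : 'X^(d.+1) %| exp_poly \Po log_poly - (1 + 'X).
Proof.
set G := exp_poly \Po log_poly.
have G0 : G`_0 = 1 by rewrite -horner_coef0 horner_comp log_poly0 exp_poly0.
have dG : 'X^d %| (1 + 'X) * G^`() - G.
  have -> : (1 + 'X) * G^`() - G =
      - ((d`!%:R)^-1 *: log_poly ^+ d * (1 - (- 'X) ^+ d)) - G * (- 'X) ^+ d.
    rewrite /G deriv_comp mulrCA deriv_log_poly deriv_exp_poly.
    by rewrite comp_polyB comp_polyZ comp_Xn_poly; ring.
  apply: dvdp_sub; last by rewrite dvdp_mull// exprNn dvdp_mull.
  rewrite dvdpNr dvdp_mulr// dvdpZr ?invr_eq0 ?pnatr_eq0 -?lt0n ?fact_gt0//.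
  by rewrite dvdp_exp2r// dvdX_root0 ?log_poly0.
have rec i : (i < d)%N -> G`_i.+1 *+ i.+1 = G`_i - G`_i *+ i.
  move=> id; have /dvdXnP/(_ i id)/eqP := dG.
  rewrite coefB mulrDl mul1r coefD coefXM !coef_deriv.
  rewrite subr_eq0 => /eqP e; rewrite -[X in _ = X - _]e.
  by case: i id {e} => [|i] _ /=; rewrite ?mulr0n ?subr0 ?addr0 ?addrK.
apply/dvdXnP => i; rewrite coefB coefD coef1 coefX.
elim: i => [_|[_ d0|i IH id]]; first by rewrite G0 addr0 subrr.
  by have := rec 0%N d0; rewrite G0 mulr1n mulr0n subr0 => ->; rewrite add0r subrr.
have := rec i.+1 id.
have := IH (ltnW id); rewrite !addr0 /= => /eqP; rewrite subr_eq0 add0r => /eqP ->.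
case: i {IH id} => [|i] /=; rewrite ?mulr1n ?subrr ?mul0rn ?subr0 => /eqP;
  by rewrite mulrn_eq0 /= => /eqP ->; rewrite ?addr0 ?subrr ?subr0.
Qed.

(** By the chain rule the derivative of the composite is 1 modulo X^d; as its constant term is 0,
    integration gives X modulo X^(d+1). *)
Lemma log_exp_poly : 'X^(d.+1) %| log_poly \Po (exp_poly - 1) - 'X.
Proof.
set G := log_poly \Po _.
have E1 : (exp_poly - 1).[0] = 0 by rewrite hornerD hornerN hornerC exp_poly0 subrr.
have G0 : G`_0 = 0 by rewrite -horner_coef0 horner_comp E1 log_poly0.
have dG : 'X^d %| G^`() - 1.
  have -> : G^`() - 1 = - (- (exp_poly - 1)) ^+ d
      - (log_poly^`() \Po (exp_poly - 1)) * ((d`!%:R)^-1 *: 'X^d).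
    have := congr1 (fun p => p \Po (exp_poly - 1)) deriv_log_poly.
    rewrite comp_polyM comp_polyD comp_polyX comp_polyB -polyC1 comp_polyC rmorphXn /=.
    rewrite (raddfN (comp_poly _)) /= comp_polyX => e.
    rewrite /G deriv_comp derivB derivC subr0 deriv_exp_poly mulrBr.
    by rewrite polyC1 addrC subrK in e; rewrite polyC1 [_ * exp_poly]mulrC e; ring.
  apply: dvdp_sub; first by rewrite dvdpNr dvdp_exp2r// dvdpNr dvdX_root0.
  by rewrite dvdp_mull// dvdpZr ?invr_eq0 ?pnatr_eq0 -?lt0n ?fact_gt0.
apply/dvdXnP => -[_|i id]; first by rewrite coefB coefX G0 subrr.
have /dvdXnP/(_ i id)/eqP := dG; rewrite !coefB coef_deriv coef1 coefX eqSS.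
case: i id => [|i] id; first by rewrite mulr1n => /eqP.
by rewrite !subr0 mulrn_eq0 /= => /eqP.
Qed.

End ExpLogPolynomials.

Section MatrixExpLog.
Context {F : numFieldType} {n : nat}.
Implicit Types (M N X Y : 'M[F]_n.+1).

Definition mexp M := horner_mx M (exp_poly n).
(* logarithm of [1 + M] *)
Definition mlog1p M := horner_mx M (log_poly n).
(** The exponent is the size of the matrix. No generality is lost (see [nilpotent_mxP]), and the
    condition is a system of polynomial equations. *)
Definition nilpotent_mx M := M ^+ n.+1 = 0.

Lemma horner_mx_comp M (p q : {poly F}) :
  horner_mx M (p \Po q) = horner_mx (horner_mx M q) p.
Proof.
elim/poly_ind: p => [|p c IH]; first by rewrite comp_poly0 !rmorph0.
by rewrite comp_poly_MXaddC !rmorphD !rmorphM /= IH horner_mx_X !horner_mx_C.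
Qed.

(** This turns congruences between truncated series into exact identities of matrices. *)
Lemma horner_mx_nilp M (p q : {poly F}) :
  nilpotent_mx M -> 'X^(n.+1) %| p - q -> horner_mx M p = horner_mx M q.
Proof.
move=> nM /dvdpP[r e]; apply/eqP; rewrite -subr_eq0 -rmorphB e.
by rewrite rmorphM rmorphXn /= horner_mx_X nM mulr0.
Qed.

Lemma expr_eq0_leq M j k : M ^+ j = 0 -> (j <= k)%N -> M ^+ k = 0.
Proof. by move=> Mj jk; rewrite -(subnK jk) exprD Mj mulr0. Qed.

(** The minimal polynomial divides X^k, hence is X^j up to a unit; it also divides the
    characteristic polynomial, so j is at most the size of the matrix. *)
Lemma nilpotent_mxP M k : M ^+ k = 0 -> nilpotent_mx M.
Proof.
move=> Mk.
have : mxminpoly M %| ('X - 0%:P) ^+ k.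
  by rewrite subr0 mxminpoly_min// rmorphXn /= horner_mx_X.
move=> /dvdp_exp_XsubCP[j _]; rewrite subr0 => ej.
have jn : (j <= n.+1)%N.
  have := eqp_size ej; rewrite size_polyXn size_mxminpoly => -[<-].
  have := dvdp_leq (monic_neq0 (char_poly_monic M)) (mxminpoly_dvd_char M).
  by rewrite size_mxminpoly size_char_poly ltnS.
suff Mj : M ^+ j = 0 by exact: expr_eq0_leq Mj jn.
have /dvdpP[q e] : mxminpoly M %| 'X^j by rewrite (eqp_dvdl _ ej).
have := congr1 (horner_mx M) e; rewrite rmorphXn rmorphM /= horner_mx_X => ->.
by rewrite mx_root_minpoly mulr0.
Qed.

Lemma nilpotent_mx0 : nilpotent_mx (0 : 'M[F]_n.+1). Proof. by rewrite /nilpotent_mx expr0n. Qed.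

Lemma nilpotent_mxM X Y : GRing.comm X Y -> nilpotent_mx X -> nilpotent_mx (X * Y).
Proof. by move=> cXY nX; rewrite /nilpotent_mx exprMn_comm// nX mul0r. Qed.

Lemma nilpotent_mxZ a X : nilpotent_mx X -> nilpotent_mx (a *: X).
Proof. by move=> nX; rewrite /nilpotent_mx exprZn nX scaler0. Qed.

Lemma nilpotent_mxD X Y : GRing.comm X Y -> nilpotent_mx X -> nilpotent_mx Y -> nilpotent_mx (X + Y).
Proof.
move=> cXY nX nY; apply: (@nilpotent_mxP _ (n.+1 + n.+1)).
rewrite exprDn_comm// big1// => i _.
have [ni|ni] := leqP n.+1 i.
  by rewrite (expr_eq0_leq nY ni) mulr0 mul0rn.
by rewrite (expr_eq0_leq nX) ?mul0r ?mul0rn//; lia.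
Qed.

Lemma nilpotent_mx_sum (I : finType) (f : I -> 'M[F]_n.+1) :
  (forall i j, GRing.comm (f i) (f j)) -> (forall i, nilpotent_mx (f i)) ->
  nilpotent_mx (\sum_i f i).
Proof.
move=> cf nf.
suff [] : nilpotent_mx (\sum_i f i) /\ forall j, GRing.comm (\sum_i f i) (f j) by [].
elim/big_rec: _ => [|i M _ [nM cM]].
  by split=> [|j]; [exact: nilpotent_mx0|rewrite /GRing.comm mulr0 mul0r].
split=> [|j]; first by apply: nilpotent_mxD => //; apply/commr_sym/cM.
by apply/commr_sym/commrD; apply/commr_sym.
Qed.

Lemma comm_horner_mxr X M (p : {poly F}) :
  GRing.comm X M -> GRing.comm X (horner_mx M p).
Proof. by move=> c; apply/commr_sym; exact: comm_horner_mx. Qed.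

Lemma nilpotent_mx_log M : nilpotent_mx M -> nilpotent_mx (mlog1p M).
Proof.
move=> nM; have /dvdpP[q e] := dvdX_root0 (log_poly0 (F := F) n).
rewrite /mlog1p e mulrC rmorphM /= horner_mx_X; apply: nilpotent_mxM => //.
exact: comm_horner_mxr.
Qed.

Lemma mexpE M : mexp M = \sum_(k < n.+1) (k`!%:R)^-1 *: M ^+ k.
Proof.
rewrite /mexp /exp_poly poly_def rmorph_sum; apply: eq_bigr => k _.
by rewrite /= horner_mxZ rmorphXn /= horner_mx_X.
Qed.

Lemma mexp_log M : nilpotent_mx M -> mexp (mlog1p M) = 1 + M.
Proof.
move=> nM; rewrite /mexp /mlog1p -horner_mx_comp.
by rewrite (horner_mx_nilp nM (exp_log_poly n)) rmorphD rmorph1 /= horner_mx_X.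
Qed.

Lemma mlog_exp M : nilpotent_mx M -> mlog1p (mexp M - 1) = M.
Proof.
move=> nM; rewrite /mexp /mlog1p.
have -> : horner_mx M (exp_poly n) - 1 = horner_mx M (exp_poly n - 1).
  by rewrite rmorphB rmorph1.
by rewrite -horner_mx_comp (horner_mx_nilp nM (log_exp_poly n)) horner_mx_X.
Qed.

Lemma mexp0 : mexp 0 = 1.
Proof.
rewrite mexpE big_ord_recl expr0 invr1 scale1r big1 ?addr0// => i _.
by rewrite expr0n scaler0.
Qed.

Lemma comm_mexp X M : GRing.comm X M -> GRing.comm X (mexp M).
Proof. exact: comm_horner_mxr. Qed.

(** [P Z] is the exponential of t Z as a polynomial in t with matrix coefficients. By the binomial
    formula the coefficient of t^k in [P X * P Y] is that of exp(t (X + Y)), for every k because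
    high powers vanish by nilpotency. The identity is then evaluated at t = 1. *)
Lemma mexpD X Y : GRing.comm X Y -> nilpotent_mx X -> nilpotent_mx Y -> mexp (X + Y) = mexp X * mexp Y.
Proof.
move=> cXY nX nY; have nXY := nilpotent_mxD cXY nX nY.
pose P Z : {poly 'M[F]_n.+1} := \poly_(k < n.+1) ((k`!%:R)^-1 *: Z ^+ k).
have PE Z : nilpotent_mx Z -> forall k, (P Z)`_k = (k`!%:R)^-1 *: Z ^+ k.
  move=> nZ k; rewrite coef_poly; case: ltnP => // nk.
  by rewrite (expr_eq0_leq nZ nk) scaler0.
have P1 Z : (P Z).[1] = mexp Z.
  rewrite (horner_coef_wide _ (size_poly _ _)) mexpE.
  by apply: eq_bigr => k _; rewrite coef_poly ltn_ord expr1n mulr1.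
rewrite -(P1 X) -(P1 Y) -hornerM_comm; last by rewrite /comm_poly mul1r mulr1.
have sPQ : (size (P X * P Y)%R <= n.+1 + n.+1)%N.
  apply: leq_trans (size_polyMleq _ _) _.
  have sP Z : (size (P Z) <= n.+1)%N by exact: size_poly.
  by have := sP X; have := sP Y; lia.
have cPQ k : (P X * P Y)`_k = (k`!%:R)^-1 *: (X + Y) ^+ k.
  rewrite coefMr exprDn_comm// scaler_sumr; apply: eq_bigr => i _.
  rewrite !PE// -scalerAl -scalerAr scalerA -scaler_nat scalerA.
  congr (_ *: _).
  have ik : (i <= k)%N by rewrite -ltnS.
  rewrite -(bin_fact ik) !natrM !invfM mulrAC mulVf ?mul1r 1?mulrC//.
  by rewrite pnatr_eq0 -lt0n bin_gt0.
rewrite (horner_coef_wide _ sPQ) big_split_ord /= [X in _ = _ + X]big1 ?addr0 => [|k _].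
  by rewrite mexpE; apply: eq_bigr => k _; rewrite expr1n mulr1 cPQ.
by rewrite cPQ (expr_eq0_leq nXY) ?scaler0 ?mul0r ?leq_addr.
Qed.

End MatrixExpLog.

Require Import Defs.
From mathcomp Require Import all_boot all_order all_algebra.
From mathcomp Require Import all_classical all_reals all_analysis.
From mathcomp Require Import mxtens.
Import -(notations) mpoly.
Import Order.TTheory GRing.Theory Num.Theory.
Import numFieldNormedType.Exports.
Import passmx.
Local Open Scope classical_set_scope.
Local Open Scope ring_scope.

(** * Polynomial functions and Tarski-Seidenberg *)

Section PolynomialFunctions.
Context {R : realType}.

(** Polynomial functions instead of polynomials, in coordinates indexed by any type: matrices and
    families of matrices are substituted without renumbering variables. Induction on this predicate
    gives continuity, definability and translation-stable maps. *)
Inductive polyfun {I : Type} : ((I -> R) -> R) -> Prop :=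
| polyfun_cst c : polyfun (fun=> c)
| polyfun_var i : polyfun (fun x => x i)
| polyfunD f g : polyfun f -> polyfun g -> polyfun (fun x => f x + g x)
| polyfunM f g : polyfun f -> polyfun g -> polyfun (fun x => f x * g x).

Lemma polyfun_comp I J (f : (J -> R) -> R) (h : (I -> R) -> J -> R) :
  polyfun f -> (forall j, polyfun (h^~ j)) -> polyfun (f \o h).
Proof.
move=> pf ph; elim: pf => [c|j|f1 f2 _ p1 _ p2|f1 f2 _ p1 _ p2].
- exact: polyfun_cst.
- exact: ph.
- exact: (polyfunD p1 p2).
- exact: (polyfunM p1 p2).
Qed.

Lemma polyfunN I (f : (I -> R) -> R) : polyfun f -> polyfun (fun x => - f x).
Proof.
move=> pf; rewrite (_ : (fun _ => _) = fun x => -1 * f x).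
  by apply: polyfunM => //; apply: polyfun_cst.
by apply/funext => x; rewrite mulN1r.
Qed.

Lemma polyfunB I (f g : (I -> R) -> R) :
  polyfun f -> polyfun g -> polyfun (fun x => f x - g x).
Proof. by move=> pf pg; apply: polyfunD => //; apply: polyfunN. Qed.

Lemma polyfun_sum I T (r : seq T) (P : pred T) (f : T -> (I -> R) -> R) :
  (forall i, polyfun (f i)) -> polyfun (fun x => \sum_(i <- r | P i) f i x).
Proof.
move=> pf; elim: r => [|i r IH].
  by under eq_fun do rewrite big_nil; exact: polyfun_cst.
under eq_fun do rewrite big_cons.
by case: (P i) => //; apply: polyfunD.
Qed.

Lemma polyfun_prod I T (r : seq T) (P : pred T) (f : T -> (I -> R) -> R) :
  (forall i, polyfun (f i)) -> polyfun (fun x => \prod_(i <- r | P i) f i x).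
Proof.
move=> pf; elim: r => [|i r IH].
  by under eq_fun do rewrite big_nil; exact: polyfun_cst.
under eq_fun do rewrite big_cons.
by case: (P i) => //; apply: polyfunM.
Qed.

Lemma polyfunX I (f : (I -> R) -> R) k : polyfun f -> polyfun (fun x => (f x) ^+ k).
Proof.
move=> pf; elim: k => [|k IH].
  by under eq_fun do rewrite expr0; exact: polyfun_cst.
by under eq_fun do rewrite exprS; exact: polyfunM.
Qed.

Lemma polyfun_meval I N (p : mpoly.mpoly N R) (h : (I -> R) -> 'I_N -> R) :
  (forall j, polyfun (h^~ j)) -> polyfun (fun x => mpoly.meval (h x) p).
Proof.
move=> ph; under eq_fun do rewrite mpoly.mevalE.
apply: polyfun_sum => m; apply: polyfunM; first exact: polyfun_cst.
by apply: polyfun_prod => i; apply: polyfunX.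
Qed.

Definition polymx {I : Type} m n (F : (I -> R) -> 'M[R]_(m, n)) : Prop :=
  forall i j, polyfun (fun x => F x i j).

Lemma polymx_cst I m n (A : 'M[R]_(m, n)) : polymx (fun _ : I -> R => A).
Proof. by move=> i j; exact: polyfun_cst. Qed.

Lemma polymx_comp I J m n (F : (J -> R) -> 'M[R]_(m, n)) (h : (I -> R) -> J -> R) :
  polymx F -> (forall j, polyfun (h^~ j)) -> polymx (fun x => F (h x)).
Proof. by move=> pF ph i j; exact: (polyfun_comp (pF i j) ph). Qed.

Lemma polymx_mx I m n (f : 'I_m -> 'I_n -> (I -> R) -> R) :
  (forall i j, polyfun (f i j)) -> polymx (fun x => \matrix_(i, j) f i j x).
Proof. by move=> pf i j; under eq_fun do rewrite mxE; exact: pf. Qed.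

Lemma polymxD I m n (F G : (I -> R) -> 'M[R]_(m, n)) :
  polymx F -> polymx G -> polymx (fun x => F x + G x).
Proof. by move=> pF pG i j; under eq_fun do rewrite mxE; exact: polyfunD. Qed.

Lemma polymxN I m n (F : (I -> R) -> 'M[R]_(m, n)) :
  polymx F -> polymx (fun x => - F x).
Proof. by move=> pF i j; under eq_fun do rewrite mxE; exact: polyfunN. Qed.

Lemma polymxB I m n (F G : (I -> R) -> 'M[R]_(m, n)) :
  polymx F -> polymx G -> polymx (fun x => F x - G x).
Proof. by move=> pF pG; apply: polymxD => //; apply: polymxN. Qed.

Lemma polymxZ I m n (f : (I -> R) -> R) (F : (I -> R) -> 'M[R]_(m, n)) :
  polyfun f -> polymx F -> polymx (fun x => f x *: F x).
Proof. by move=> pf pF i j; under eq_fun do rewrite mxE; exact: polyfunM. Qed.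

Lemma polymx_sum I T m n (r : seq T) (P : pred T) (F : T -> (I -> R) -> 'M[R]_(m, n)) :
  (forall i, polymx (F i)) -> polymx (fun x => \sum_(i <- r | P i) F i x).
Proof.
move=> pF i j; under eq_fun do rewrite summxE.
by apply: polyfun_sum => k; exact: pF.
Qed.

Lemma polymxM I m n p (F : (I -> R) -> 'M[R]_(m, n)) (G : (I -> R) -> 'M[R]_(n, p)) :
  polymx F -> polymx G -> polymx (fun x => F x *m G x).
Proof.
move=> pF pG i j; under eq_fun do rewrite mxE.
by apply: polyfun_sum => k; exact: polyfunM.
Qed.

Lemma polymx_tr I m n (F : (I -> R) -> 'M[R]_(m, n)) :
  polymx F -> polymx (fun x => (F x)^T).
Proof. by move=> pF i j; under eq_fun do rewrite mxE; exact: pF. Qed.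

Lemma polymxX I n (F : (I -> R) -> 'M[R]_n.+1) k :
  polymx F -> polymx (fun x => F (x) ^+ k).
Proof.
move=> pF; elim: k => [|k IH].
  by under eq_fun do rewrite expr0; exact: polymx_cst.
by under eq_fun do rewrite exprS; exact: polymxM.
Qed.

Lemma polyfun_det I n (F : (I -> R) -> 'M[R]_n) :
  polymx F -> polyfun (fun x => \det (F x)).
Proof.
move=> pF; apply: polyfun_sum => s; apply: polyfunM; first exact: polyfun_cst.
by apply: polyfun_prod => i; exact: pF.
Qed.

Lemma polymx_adj I n (F : (I -> R) -> 'M[R]_n) :
  polymx F -> polymx (fun x => \adj (F x)).
Proof.
move=> pF i j; under eq_fun do rewrite mxE /cofactor.
apply: polyfunM; first exact: polyfun_cst.
by apply: polyfun_det => k l; under eq_fun do rewrite !mxE; exact: pF.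
Qed.

Lemma polymx_block I m1 m2 n1 n2 (A : (I -> R) -> 'M[R]_(m1, n1))
    (B : (I -> R) -> 'M[R]_(m1, n2)) (C : (I -> R) -> 'M[R]_(m2, n1))
    (D : (I -> R) -> 'M[R]_(m2, n2)) :
  polymx A -> polymx B -> polymx C -> polymx D ->
  polymx (fun x => block_mx (A x) (B x) (C x) (D x)).
Proof.
move=> pA pB pC pD i j; rewrite -(fintype.splitK i) -(fintype.splitK j).
case: (fintype.split i) => i'; case: (fintype.split j) => j' /=; under eq_fun do
  rewrite ?(block_mxEul, block_mxEur, block_mxEdl, block_mxEdr);
  [exact: pA|exact: pB|exact: pC|exact: pD].
Qed.

End PolynomialFunctions.

(** * First-order definability and quantifier elimination *)

Section Definable.
Import ordered_qelim.ord.
Local Open Scope pair_scope.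
Context {R : realType}.

Definition valuation (I : finType) (x : I -> R) : seq R := map x (enum I).

Lemma size_valuation (I : finType) (x : I -> R) : size (valuation x) = #|I|.
Proof. by rewrite size_map -cardE. Qed.

Lemma nth_valuation (I : finType) (x : I -> R) i :
  nth 0 (valuation x) (enum_rank i) = x i.
Proof. by rewrite (nth_map i) ?nth_enum_rank // -cardE. Qed.

(** Real parameters are allowed, since terms contain constants; the coefficients of the equations of
    the group enter in this way. *)
Definition definable (I : finType) (P : (I -> R) -> Prop) : Prop :=
  exists f : formula R, forall x, P x <-> holds (valuation x) f.

Lemma definable_ext (I : finType) (P Q : (I -> R) -> Prop) :
  (forall x, P x <-> Q x) -> definable P -> definable Q.
Proof. by move=> PQ [f Pf]; exists f => x; rewrite -PQ. Qed.

Lemma polyfun_term (I : finType) (f : (I -> R) -> R) : polyfun f ->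
  exists t : GRing.term R, forall x, f x = GRing.eval (valuation x) t.
Proof.
elim=> [c|i|g h _ [t gt] _ [u hu]|g h _ [t gt] _ [u hu]].
- by exists (GRing.Const c).
- by exists (GRing.Var _ (enum_rank i)) => x /=; rewrite nth_valuation.
- by exists (GRing.Add t u) => x /=; rewrite gt hu.
- by exists (GRing.Mul t u) => x /=; rewrite gt hu.
Qed.

Lemma definable_le (I : finType) (f g : (I -> R) -> R) :
  polyfun f -> polyfun g -> definable (fun x => f x <= g x).
Proof.
by move=> /polyfun_term[t ft] /polyfun_term[u gu]; exists (Le t u) => x; rewrite ft gu.
Qed.

Lemma definable_lt (I : finType) (f g : (I -> R) -> R) :
  polyfun f -> polyfun g -> definable (fun x => f x < g x).
Proof.
by move=> /polyfun_term[t ft] /polyfun_term[u gu]; exists (Lt t u) => x; rewrite ft gu.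
Qed.

Lemma definable_eq (I : finType) (f g : (I -> R) -> R) :
  polyfun f -> polyfun g -> definable (fun x => f x = g x).
Proof.
by move=> /polyfun_term[t ft] /polyfun_term[u gu]; exists (Equal t u) => x; rewrite ft gu.
Qed.

Lemma definable_and (I : finType) (P Q : (I -> R) -> Prop) :
  definable P -> definable Q -> definable (fun x => P x /\ Q x).
Proof. by move=> [f Pf] [g Qg]; exists (And f g) => x /=; rewrite Pf Qg. Qed.

Lemma definable_not (I : finType) (P : (I -> R) -> Prop) :
  definable P -> definable (fun x => ~ P x).
Proof. by move=> [f Pf]; exists (Not f) => x /=; rewrite Pf. Qed.

Lemma definable_imp (I : finType) (P Q : (I -> R) -> Prop) :
  definable P -> definable Q -> definable (fun x => P x -> Q x).
Proof. by move=> [f Pf] [g Qg]; exists (Implies f g) => x /=; rewrite Pf Qg. Qed.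

Lemma definable_all (I : finType) (T : eqType) (r : seq T) (P : T -> (I -> R) -> Prop) :
  (forall t, definable (P t)) -> definable (fun x => forall t, t \in r -> P t x).
Proof.
move=> dP; elim: r => [|t r IH].
  by exists (Bool true) => x; split=> // _ t; rewrite in_nil.
apply: definable_ext (definable_and (dP t) IH) => x; split=> [[Pt Pr] u|H].
  by rewrite inE => /orP[/eqP->|/Pr].
by split=> [|u ur]; apply: H; rewrite inE ?eqxx ?ur ?orbT.
Qed.

Lemma definable_forall (I T : finType) (P : T -> (I -> R) -> Prop) :
  (forall t, definable (P t)) -> definable (fun x => forall t, P t x).
Proof.
move=> /(definable_all (enum T)); apply: definable_ext => x.
by split=> [H t|H t _]; apply: H; rewrite ?mem_enum.
Qed.

Definition sumf {I J : Type} (x : I -> R) (y : J -> R) (s : I + J) : R :=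
  match s with inl i => x i | inr j => y j end.

Lemma valuation_sumf (I J : finType) (x : I -> R) (y : J -> R) :
  valuation (sumf x y) = valuation x ++ valuation y.
Proof.
by rewrite /valuation !enumT {1}unlock /= /sum_enum map_cat -!map_comp.
Qed.

(** The bound variables are numbered from the length [m] of the valuation on, so binding one of them
    appends its value. This fits [valuation_sumf], where the coordinates in [J] follow those in
    [I]. *)
Lemma holds_exists_iter k m f (e : seq R) : size e = m ->
  holds e (foldr Exists f (iota m k)) <->
  exists2 ys, size ys = k & holds (e ++ ys) f.
Proof.
elim: k m e => [|k IH] m e se /=.
  by split=> [H|[[|y ys] //= _]]; [exists [::]|]; rewrite ?cats0.
have sete x : set_nth 0 e m x = rcons e x.
  by rewrite -se -cats1; elim: (e) => //= a s ->.
split=> [[x]|[[|x ys] //= [sys] H]].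
  rewrite sete => /IH; rewrite size_rcons se => /(_ erefl)[ys sys].
  by rewrite cat_rcons => H; exists (x :: ys); rewrite //= sys.
exists x; rewrite sete; apply/IH; rewrite ?size_rcons ?se//.
by exists ys => //; rewrite cat_rcons.
Qed.

Lemma definable_exists (I J : finType) (P : (I + J -> R) -> Prop) :
  definable P -> definable (fun x : I -> R => exists y : J -> R, P (sumf x y)).
Proof.
move=> [f Pf]; exists (foldr Exists f (iota #|I| #|J|)) => x.
rewrite holds_exists_iter ?size_valuation//; split=> [[y /Pf]|[ys sys H]].
  by rewrite valuation_sumf => H; exists (valuation y); rewrite ?size_valuation.
exists (fun j => nth 0 ys (enum_rank j)); apply/Pf; rewrite valuation_sumf.
suff -> : valuation (fun j : J => nth 0 ys (enum_rank j)) = ys by [].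
apply: (@eq_from_nth _ (0 : R)); rewrite size_valuation ?sys// => i ilt.
by rewrite -[i]/(nat_of_ord (Ordinal ilt)) -[Ordinal ilt]enum_valK nth_valuation.
Qed.

Lemma definable_existsmx (I : finType) m n (P : (I -> R) -> 'M[R]_(m, n) -> Prop) :
  definable (fun z : I + 'I_m * 'I_n -> R =>
    P (z \o inl) (\matrix_(i, j) z (inr (i, j)))) ->
  definable (fun x => exists M, P x M).
Proof.
move=> /definable_exists; apply: definable_ext => x; split=> [[y Py]|[M PM]].
  by exists (\matrix_(i, j) y (i, j)).
exists (fun ij => M ij.1 ij.2).
suff -> : \matrix_(i, j) sumf x (fun ij => M ij.1 ij.2) (inr (i, j)) = M by [].
by apply/matrixP => i j; rewrite mxE.
Qed.

Lemma definable_existsr (I : finType) (P : (I -> R) -> R -> Prop) :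
  definable (fun z : I + unit -> R => P (z \o inl) (z (inr tt))) ->
  definable (fun x => exists t, P x t).
Proof.
move=> /definable_exists; apply: definable_ext => x; split=> [[y Py]|[t Pt]].
  by exists (y tt).
by exists (fun=> t).
Qed.

Lemma definable_forallr (I : finType) (P : (I -> R) -> R -> Prop) :
  definable (fun z : I + unit -> R => P (z \o inl) (z (inr tt))) ->
  definable (fun x => forall t, P x t).
Proof.
move=> /definable_not /(@definable_existsr I (fun x t => ~ P x t)) /definable_not.
apply: definable_ext => x; split=> [H t|H [t]]; last exact.
by apply: contrapT => nP; apply: H; exists t.
Qed.

Definition basic_clause N := (seq (mpoly.mpoly N R) * seq (mpoly.mpoly N R))%type.

Definition clause_holds N (x : 'rV[R]_N) (c : basic_clause N) : bool :=
  all (fun p => mpoly.meval (x 0) p == 0) c.1 &&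
  all (fun q => 0 < mpoly.meval (x 0) q) c.2.

Definition semialg N (P : 'rV[R]_N -> Prop) : Prop :=
  exists F : seq (basic_clause N), forall x, P x <-> has (clause_holds x) F.

Lemma semialg_or N (P Q : 'rV[R]_N -> Prop) :
  semialg P -> semialg Q -> semialg (fun x => P x \/ Q x).
Proof.
move=> [F PF] [G QG]; exists (F ++ G) => x; rewrite has_cat PF QG.
by split=> [[->|->]|/orP]//; rewrite orbT.
Qed.

Lemma semialg_and N (P Q : 'rV[R]_N -> Prop) :
  semialg P -> semialg Q -> semialg (fun x => P x /\ Q x).
Proof.
move=> [F PF] [G QG].
exists [seq (c.1 ++ d.1, c.2 ++ d.2) | c <- F, d <- G] => x; rewrite PF QG.
split=> [[/hasP [c cF cx] /hasP [d dG dx]]|/hasP [_ /allpairsP[[c d] [/= cF dG ->]]]].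
  apply/hasP; exists (c.1 ++ d.1, c.2 ++ d.2); first exact: allpairs_f.
  rewrite /clause_holds !all_cat.
  by move/andP: cx => [-> ->]; move/andP: dx => [-> ->].
rewrite /clause_holds !all_cat => /andP[/andP[c1 d1] /andP[c2 d2]].
by split; apply/hasP; [exists c|exists d]; rewrite // /clause_holds ?c1 ?c2 ?d1 ?d2.
Qed.

Lemma semialg_ext N (P Q : 'rV[R]_N -> Prop) :
  (forall x, P x <-> Q x) -> semialg P -> semialg Q.
Proof. by move=> PQ [F PF]; exists F => x; rewrite -PQ. Qed.

Lemma semialg_bool N (b : bool) : semialg (fun _ : 'rV[R]_N => b).
Proof. by exists (if b then [:: ([::], [::])] else [::]) => x; case: b. Qed.

Lemma semialg_gt0 N (p : mpoly.mpoly N R) : semialg (fun x => 0 < mpoly.meval (x 0) p).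
Proof. by exists [:: ([::], [:: p])] => x; rewrite /= /clause_holds /= andbT orbF. Qed.

Lemma semialg_eq0 N (p : mpoly.mpoly N R) : semialg (fun x => mpoly.meval (x 0) p = 0).
Proof.
exists [:: ([:: p], [::])] => x; rewrite /= /clause_holds /= !andbT orbF.
by split=> /eqP.
Qed.

Lemma rterm_mpoly N (e : 'rV[R]_N -> seq R) :
  (forall i, exists p : mpoly.mpoly N R, forall x, nth 0 (e x) i = mpoly.meval (x 0) p) ->
  forall t, GRing.rterm t ->
  exists p : mpoly.mpoly N R, forall x, GRing.eval (e x) t = mpoly.meval (x 0) p.
Proof.
move=> ep; elim=> //=.
- by move=> r _; exists (mpoly.mpolyC N r) => x; rewrite mpoly.mevalC.
- by move=> k _; exists (k%:R) => x; rewrite rmorph_nat.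
- move=> t IHt u IHu /andP[/IHt[p tp] /IHu[q uq]].
  by exists (p + q) => x; rewrite mpoly.mevalD tp uq.
- by move=> t IHt /IHt[p tp]; exists (- p) => x; rewrite mpoly.mevalN tp.
- by move=> t IHt k /IHt[p tp]; exists (p *+ k) => x; rewrite mpoly.mevalMn tp.
- move=> t IHt u IHu /andP[/IHt[p tp] /IHu[q uq]].
  by exists (p * q) => x; rewrite mpoly.mevalM tp uq.
- by move=> t IHt k /IHt[p tp]; exists (p ^+ k) => x; rewrite rmorphXn tp.
Qed.

(** The claim for the complement is carried through the induction so that negations and implications
    need no separate complementation of a union of clauses. *)
Lemma semialg_qf N (e : 'rV[R]_N -> seq R) :
  (forall i, exists p : mpoly.mpoly N R, forall x, nth 0 (e x) i = mpoly.meval (x 0) p) ->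
  forall f, qf_form f && rformula f ->
  semialg (fun x => holds (e x) f) /\ semialg (fun x => ~ holds (e x) f).
Proof.
move=> /rterm_mpoly ep; elim=> //=.
- move=> b _; split; first exact: semialg_bool.
  by apply: semialg_ext (semialg_bool N (~~ b)) => x; split=> /negP.
- move=> t u /andP[/ep[p tp] /ep[q uq]]; split.
    by apply: semialg_ext (semialg_eq0 (p - q)) => x;
      rewrite mpoly.mevalB tp uq; split=> [/eqP|->]; rewrite ?subrr// subr_eq0 => /eqP.
  apply: semialg_ext (semialg_or (semialg_gt0 (p - q)) (semialg_gt0 (q - p))) => x.
  rewrite !mpoly.mevalB tp uq !subr_gt0; split.
    by case=> /[swap] ->; rewrite ltxx.
  by move=> /eqP; rewrite neq_lt => /orP[]; [right|left].
- move=> t u /andP[/ep[p tp] /ep[q uq]]; split.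
    by apply: semialg_ext (semialg_gt0 (q - p)) => x; rewrite mpoly.mevalB subr_gt0 tp uq.
  apply: semialg_ext (semialg_or (semialg_gt0 (p - q)) (semialg_eq0 (p - q))) => x.
  rewrite !mpoly.mevalB tp uq subr_gt0; split=> [[h|/eqP]|/negP].
  + by apply/negP; rewrite -leNgt ltW.
  + by rewrite subr_eq0 => /eqP ->; rewrite ltxx.
  + rewrite -leNgt le_eqVlt => /orP[/eqP->|]; [by right; rewrite subrr|by left].
- move=> t u /andP[/ep[p tp] /ep[q uq]]; split.
    apply: semialg_ext (semialg_or (semialg_gt0 (q - p)) (semialg_eq0 (q - p))) => x.
    rewrite !mpoly.mevalB tp uq subr_gt0; split=> [[/ltW//|/eqP]|].
      by rewrite subr_eq0 => /eqP ->.
    by rewrite le_eqVlt => /orP[/eqP->|]; [right; rewrite subrr|left].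
  apply: semialg_ext (semialg_gt0 (p - q)) => x.
  rewrite !mpoly.mevalB tp uq subr_gt0 ltNge.
  by split=> /negP.
- move=> f IHf g IHg /andP[/andP[qf qg] /andP[rf rg]].
  have [|f1 f2] := IHf; first by rewrite qf rf.
  have [|g1 g2] := IHg; first by rewrite qg rg.
  split; first exact: semialg_and.
  apply: semialg_ext (semialg_or f2 g2) => x.
  by have := pselect (holds (e x) f); have := pselect (holds (e x) g); tauto.
- move=> f IHf g IHg /andP[/andP[qf qg] /andP[rf rg]].
  have [|f1 f2] := IHf; first by rewrite qf rf.
  have [|g1 g2] := IHg; first by rewrite qg rg.
  split; first exact: semialg_or.
  by apply: semialg_ext (semialg_and f2 g2) => x; tauto.
- move=> f IHf g IHg /andP[/andP[qf qg] /andP[rf rg]].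
  have [|f1 f2] := IHf; first by rewrite qf rf.
  have [|g1 g2] := IHg; first by rewrite qg rg.
  split.
    apply: semialg_ext (semialg_or f2 g1) => x.
    by have := pselect (holds (e x) f); tauto.
  apply: semialg_ext (semialg_and f1 g2) => x.
  by have := pselect (holds (e x) f); tauto.
- move=> f IHf /IHf[f1 f2]; split=> //.
  by apply: semialg_ext f1 => x; have := pselect (holds (e x) f); tauto.
Qed.

Lemma definable_semi_algebraic (I : finType) (P : (I -> R) -> Prop) : definable P ->
  semi_algebraic [set x : 'rV[R]_#|I| | P (fun i => x 0 (enum_rank i))].
Proof.
move=> [f Pf].
pose e (x : 'rV[R]_#|I|) := valuation (fun i => x 0 (enum_rank i)).
have ep i : exists p : mpoly.mpoly #|I| R,
    forall x, nth 0 (e x) i = mpoly.meval (x 0) p.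
  have [ilt|ige] := ltnP i #|I|; last first.
    by exists 0 => x; rewrite nth_default ?size_valuation// mpoly.meval0.
  exists (mpoly.mpolyX R (mpoly.mnm1 (Ordinal ilt))) => x; rewrite mpoly.mevalXU.
  rewrite -[i in LHS]/(nat_of_ord (Ordinal ilt)) -{1}[Ordinal ilt]enum_valK.
  by rewrite nth_valuation enum_valK.
(* [to_rform] removes inverses from the terms; the projection of real closed fields then eliminates
   the quantifiers one after the other. *)
pose g := quantifier_elim (fun i bc => qe_rcf.qfr_to_formula (qe_rcf.wproj i bc)) (to_rform f).
have /andP[qg rg] : qf_form g && rformula g.
  by apply: quantifier_elim_wf; [exact: qe_rcf.wf_QE_wproj|exact: to_rform_rformula].
have [|[F gF] _] := semialg_qf ep (f := g); first by rewrite qg rg.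
exists F; rewrite predeqE => x /=.
rewrite Pf -gF (rwP (qf_evalP (e x) qg)).
exact: (rwP (qe_rcf.rcf_satP (e x) f)).
Qed.

End Definable.

(** * Translation-stable polynomial maps *)

Section Translations.
Context {R : realType} {n : nat}.
Implicit Types (x g : 'M[R]_n) (F : ('I_n * 'I_n -> R) -> R).

Definition entries m p (x : 'M[R]_(m, p)) (ij : 'I_m * 'I_p) : R := x ij.1 ij.2.
Definition of_entries m p (y : 'I_m * 'I_p -> R) : 'M[R]_(m, p) := \matrix_(i, j) y (i, j).

Lemma entriesK m p : cancel (@entries m p) (@of_entries m p).
Proof. by move=> x; apply/matrixP => i j; rewrite mxE. Qed.

Lemma polymx_of_entries m p : polymx (@of_entries m p).
Proof. by move=> i j; under eq_fun do rewrite mxE; exact: polyfun_var. Qed.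

(** The functions x |-> w x *m c, for constant columns c, form a finite-dimensional space of
    polynomial functions, stable under x |-> g x. *)
Definition translation_stable D (w : 'M[R]_n -> 'rV[R]_D) : Prop :=
  polymx (w \o @of_entries n n) /\
  forall g, exists M : 'M[R]_D, forall x, w (g *m x) = w x *m M.

(** A matrix entry lies in the span of the entries of its column, on which g acts linearly. Sums are
    obtained by juxtaposing two such maps and products by tensoring them. *)
Lemma polyfun_translation_stable F : polyfun F ->
  exists D (w : 'M[R]_n -> 'rV[R]_D), translation_stable w /\
    exists c : 'cV[R]_D, forall x, F (entries x) = (w x *m c) 0 0.
Proof.
elim=> [c|[i j]|F1 F2 _ [D1 [w1 [[p1 t1] [c1 e1]]]] _ [D2 [w2 [[p2 t2] [c2 e2]]]]
       |F1 F2 _ [D1 [w1 [[p1 t1] [c1 e1]]]] _ [D2 [w2 [[p2 t2] [c2 e2]]]]].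
- exists 1%N, (fun=> 1%:M); split.
    by split=> [|g]; [exact: polymx_cst|exists 1%:M => x; rewrite mulmx1].
  by exists c%:M => x; rewrite mul1mx mxE.
- exists n, (fun x => (col j x)^T); split.
    split=> [k l|g]; last first.
      by exists g^T => x; rewrite -trmx_mul; congr trmx; rewrite !colE mulmxA.
    by under eq_fun do rewrite /= !mxE; exact: polyfun_var.
  exists (delta_mx i 0) => x; rewrite -colE !mxE.
  by [].
- exists (D1 + D2)%N, (fun x => row_mx (w1 x) (w2 x)); split.
    split=> [k l|g].
      rewrite -(fintype.splitK l); case: (fintype.split l) => l' /=.
      by under eq_fun do rewrite row_mxEl; exact: p1.
    by under eq_fun do rewrite row_mxEr; exact: p2.
    have [M1 M1P] := t1 g; have [M2 M2P] := t2 g.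
    exists (block_mx M1 0 0 M2) => x.
    by rewrite mul_row_block !mulmx0 addr0 add0r M1P M2P.
  by exists (col_mx c1 c2) => x; rewrite mul_row_col mxE e1 e2.
- exists (D1 * D2)%N, (fun x => (w1 x *t w2 x : 'M[R]_(1, D1 * D2))); split.
    split=> [k l|g].
      under eq_fun do rewrite /= mxE.
      by apply: polyfunM; [exact: p1|exact: p2].
    have [M1 M1P] := t1 g; have [M2 M2P] := t2 g.
    exists (M1 *t M2) => x.
    by rewrite [RHS](tensmx_mul (w1 x) (w2 x)) M1P M2P.
  exists (c1 *t c2) => x.
  rewrite e1 e2; have /matrixP/(_ (@ord0 0) (@ord0 0)) := tensmx_mul (w1 x) (w2 x) c1 c2.
  by rewrite [X in _ = X -> _]mxE !(ord1 (mxtens_unindex _).1) !(ord1 (mxtens_unindex _).2).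
Qed.

Lemma translation_stable_all (s : seq (('I_n * 'I_n -> R) -> R)) :
  (forall i, (i < size s)%N -> polyfun (nth (fun=> 0) s i)) ->
  exists D (w : 'M[R]_n -> 'rV[R]_D), translation_stable w /\
    forall i, (i < size s)%N -> exists c : 'cV[R]_D, forall x, nth (fun=> 0) s i (entries x) = (w x *m c) 0 0.
Proof.
elim: s => [|F s IH] ps.
  exists 0%N, (fun=> 0); split=> //.
  by split=> [|g]; [exact: polymx_cst|exists 0 => x; rewrite mulmx0].
have [D1 [w1 [[p1 t1] [c1 e1]]]] := polyfun_translation_stable (ps 0%N isT).
have [D2 [w2 [[p2 t2] cs]]] := IH (fun i => ps i.+1).
exists (D1 + D2)%N, (fun x => row_mx (w1 x) (w2 x)); split.
  split=> [k l|g].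
    rewrite -(fintype.splitK l); case: (fintype.split l) => l' /=.
      by under eq_fun do rewrite row_mxEl; exact: p1.
    by under eq_fun do rewrite row_mxEr; exact: p2.
  have [M1 M1P] := t1 g; have [M2 M2P] := t2 g.
  exists (block_mx M1 0 0 M2) => x.
  by rewrite mul_row_block !mulmx0 addr0 add0r M1P M2P.
move=> [_|i /cs[c2 e2]].
  by exists (col_mx c1 0) => x; rewrite mul_row_col mulmx0 addr0 e1.
by exists (col_mx 0 c2) => x; rewrite mul_row_col mulmx0 add0r /= e2.
Qed.

(** If no free family taken from [T] spanned it, each could be lengthened, and one of them would
    reach rank D + 1. *)
Lemma spanning_rows D (T : set 'rV[R]_D) :
  exists k (B : 'M[R]_(k, D)),
    [/\ row_free B, forall i, T (row i B) & forall v, T v -> (v <= B)%MS].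
Proof.
apply: contrapT => H.
suff all_k k : exists B : 'M[R]_(k, D), row_free B /\ forall i, T (row i B).
  have [B [/eqP rB _]] := all_k D.+1.
  by have := rank_leq_col B; rewrite rB ltnn.
elim: k => [|k [B [fB TB]]].
  by exists 0; split=> [|[]//]; rewrite /row_free mxrank0.
have [v [Tv nv]] : exists v, T v /\ ~~ (v <= B)%MS.
  apply: contrapT => nv; apply: H; exists k, B; split=> // v Tv.
  by apply: contrapT => /negP nvB; apply: nv; exists v.
exists (col_mx v B : 'M[R]_(1 + k, D)); split=> [|i].
  rewrite /row_free eqn_leq rank_leq_row /=.
  suff : (\rank B < \rank (col_mx v B))%N by rewrite (eqP fB).
  apply: rank_ltmx; rewrite /ltmx.
  rewrite -!addsmxE addsmxSr /=; apply: contra nv.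
  by apply: submx_trans; exact: addsmxSl.
rewrite -(@fintype.splitK 1 k i); case: (fintype.split _) => j /=.
  rewrite (_ : lshift k j = lshift k ord0); last by rewrite ord1.
  have e : row (lshift k ord0) (col_mx v B) = v by rewrite rowKu row_id.
  by move: Tv; rewrite -{1}e.
have e : row (rshift 1 j) (col_mx v B) = row j B by rewrite rowKd.
by have := TB j; rewrite -e.
Qed.

(* Chevalley: [w] spans a finite-dimensional space of functions that contains
   equations of [H] and is stable under translations, and the row space of
   [C g] is the span of [w (g H)]. *)
Lemma coset_row_space (s : seq (('I_n * 'I_n -> R) -> R)) (H : set 'M[R]_n) :
  (forall i, (i < size s)%N -> polyfun (nth (fun=> 0) s i)) ->
  H 1%:M -> (forall x g, H x -> H g -> H (x *m g)) ->
  (forall x, H x -> x \in unitmx /\ H (invmx x)) ->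
  (forall x, x \in unitmx ->
    (forall i, (i < size s)%N -> nth (fun=> 0) s i (entries x) = 0) -> H x) ->
  (forall x, H x -> forall i, (i < size s)%N -> nth (fun=> 0) s i (entries x) = 0) ->
  exists k D (C : 'M[R]_n -> 'M[R]_(k, D)),
    [/\ polymx (C \o @of_entries n n),
        forall g, g \in unitmx -> row_free (C g) &
        forall g x, g \in unitmx -> x \in unitmx ->
          (C x <= C g)%MS <-> H (invmx g *m x)].
Proof.
move=> ps H1 HM HV HP PH.
have [D [w [[pw tw] cs]]] := translation_stable_all ps.
have [k [B [fB HB BT]]] := spanning_rows (w @` H).
have /choice[h hP] i : exists x, H x /\ w x = row i B.
  by have [x Hx e] := HB i; exists x.
(* The rows of [B] are the values of [w] at the elements [h i] of [H] and span w(H). Translating by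
   [g] multiplies [B] by a matrix, so [C g] spans w(g H), while each of its entries is visibly
   polynomial in [g]. *)
pose C g := \matrix_i w (g *m h i).
have CE g M : (forall x, w (g *m x) = w x *m M) -> C g = B *m M.
  move=> gM; apply/row_matrixP => i; rewrite rowK gM row_mul.
  by have [_ ->] := hP i.
have CB M g : g \in unitmx -> (forall x, w (invmx g *m x) = w x *m M) ->
    C g *m M = B.
  move=> ug gM; apply/row_matrixP => i; rewrite row_mul rowK -gM mulKmx//.
  by have [_ ->] := hP i.
have wC g x : g \in unitmx -> x \in unitmx -> H (invmx g *m x) -> (w x <= C g)%MS.
  move=> ug ux Hgx; have [M gM] := tw g.
  rewrite (CE _ _ gM) -{1}[x](mulKVmx ug) gM submxMr//.
  by apply: BT; exists (invmx g *m x).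
exists k, D, C; split=> [i j|g ug|g x ug ux].
- under eq_fun do rewrite /= mxE.
  rewrite (_ : (fun _ => _) = (fun y => (w \o @of_entries n n) y 0 j) \o
    (fun y => entries (of_entries y *m h i))).
    by apply: polyfun_comp => // kl; apply: polymxM;
      [exact: polymx_of_entries|exact: polymx_cst].
  by apply/funext => y /=; rewrite entriesK.
- have [M gM] := tw (invmx g).
  rewrite /row_free eqn_leq rank_leq_row /=.
  have /eqP rB := fB; apply: leq_trans (mxrankM_maxl (C g) M).
  by rewrite (CB _ _ ug gM) rB.
- split=> [Cxg|Hgx].
    have ugx : invmx g *m x \in unitmx by rewrite unitmx_mul unitmx_inv ug.
    apply: HP => // i ilt; have [c cE] := cs i ilt; rewrite cE.
    have [M gM] := tw (invmx g).
    have wx : (w x <= C g)%MS.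
      apply: submx_trans Cxg; apply: wC => //; by rewrite mulVmx.
    have : (w (invmx g *m x) <= B)%MS.
      by rewrite gM -(CB _ _ ug gM) submxMr.
    (* An equation of [H] is a linear form [c] composed with [w]; it vanishes on the rows of [B],
       which are values of [w] on [H], hence on their whole span. *)
    move=> /submxP[a ->]; rewrite -mulmxA (_ : B *m c = 0) ?mulmx0 ?mxE//.
    apply/row_matrixP => l; rewrite row_mul row0; have [Hl <-] := hP l.
    by apply/matrixP => p q; rewrite !ord1 -cE PH// mxE.
  apply/row_subP => i; rewrite rowK; apply: wC => //.
    by rewrite unitmx_mul ux; have [] := HV _ (hP i).1.
  by rewrite mulmxA; apply: HM => //; have [] := hP i.
Qed.

End Translations.

(** * Commuting nilpotent matrices *)

Section AffineMatrices.
Context {R : realType} {n : nat}.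
Implicit Types (M T : 'M[R]_n.+1).

(** [e0r] is the row of the origin. A matrix acting on rows (1, x) from the right is affine when it
    fixes [e0c], and is the logarithm of a unipotent affine map when it is nilpotent and kills
    [e0c]. *)
Definition e0c : 'cV[R]_n.+1 := delta_mx 0 0.
Definition e0r : 'rV[R]_n.+1 := delta_mx 0 0.

Lemma e0r_e0c : e0r *m e0c = 1.
Proof. by rewrite mul_delta_mx; apply/matrixP => i j; rewrite !ord1 !mxE. Qed.

Lemma horner_mx_ker M (p : {poly R}) :
  M *m e0c = 0 -> horner_mx M p *m e0c = p.[0] *: e0c.
Proof.
move=> M0; elim/poly_ind: p => [|p c _]; first by rewrite rmorph0 mul0mx horner0 scale0r.
rewrite rmorphD rmorphM /= horner_mx_X horner_mx_C mulmxDl.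
by rewrite -mulmxA M0 mulmx0 add0r !hornerE mul_scalar_mx.
Qed.

Lemma mexp_ker M : M *m e0c = 0 -> mexp M *m e0c = e0c.
Proof. by move=> M0; rewrite horner_mx_ker// exp_poly0 scale1r. Qed.

Lemma mlog_ker M : M *m e0c = 0 -> mlog1p M *m e0c = 0.
Proof. by move=> M0; rewrite horner_mx_ker// log_poly0 scale0r. Qed.

(* The projection onto the generalized kernel along the other generalized
   eigenspaces is a polynomial with constant term 1. *)
Lemma fitting_idempotent M : exists p : {poly R},
  [/\ p.[0] = 1, M ^+ n.+1 * horner_mx M p = 0 &
      horner_mx M p * horner_mx M p = horner_mx M p].
Proof.
have [k [r r0 e]] := multiplicity_XsubC (char_poly M) 0.
have cM0 := monic_neq0 (char_poly_monic M).
rewrite cM0 /= in r0; rewrite subr0 in e.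
have kn : (k <= n.+1)%N.
  have := dvdp_leq cM0 (_ : 'X^k %| char_poly M).
  by rewrite e dvdp_mulIr -e size_polyXn size_char_poly ltnS => ->.
have /Bezout_eq1_coprimepP[[u v] /= uv] : coprimep ('X^(n.+1)) r.
  by rewrite coprimep_expl// -['X]subr0 -[0]polyC0 coprimep_sym coprimep_XsubC.
have kill q : horner_mx M (q * ('X^(n.+1) * r)) = 0.
  rewrite (_ : q * _ = q * 'X^(n.+1 - k) * char_poly M).
    by rewrite rmorphM /= Cayley_Hamilton mulr0.
  by rewrite e -!mulrA; congr (_ * _); rewrite mulrCA -exprD subnK// mulrC.
(* [r] is the cofactor of X^k in the characteristic polynomial and u X^(n+1) + v r = 1, so [v * r]
   is 1 modulo X^(n+1) and 0 modulo [r]. *)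
exists (v * r); split.
- have := congr1 (horner^~ 0) uv.
  by rewrite hornerD hornerC hornerM hornerXn expr0n mulr0 add0r.
- have -> : M ^+ n.+1 = horner_mx M 'X^(n.+1) by rewrite rmorphXn /= horner_mx_X.
  by rewrite -rmorphM -(kill v); congr (horner_mx _ _); ring.
- apply/eqP; rewrite -subr_eq0 -rmorphM -rmorphB /= -(kill (- v * u)); apply/eqP.
  congr (horner_mx _ _).
  have -> : v * r * (v * r) - v * r = v * r * (v * r - 1) by ring.
  have -> : v * r - 1 = - (u * 'X^(n.+1)) by rewrite -uv; ring.
  by ring.
Qed.

(** The product of the individual projections. They are polynomials in the [T i], hence commute with
    each other and with whatever commutes with all [T i]; their constant terms are 1, so [e0c] is
    fixed. *)
Lemma common_fitting_idempotent (I : eqType) (T : I -> 'M[R]_n.+1) (s : seq I) :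
  (forall i j, GRing.comm (T i) (T j)) -> (forall i, T i *m e0c = 0) ->
  exists e : 'M[R]_n.+1,
    [/\ e * e = e, forall M, (forall i, GRing.comm M (T i)) -> GRing.comm M e,
        forall i, i \in s -> T i ^+ n.+1 * e = 0 & e *m e0c = e0c].
Proof.
move=> cT kT; elim: s => [|i s [e [ee ce Te ke]]].
  exists 1; split=> //; rewrite ?mulr1// ?mul1mx// => M _.
  exact: commr1.
have [p [p0 Tp pp]] := fitting_idempotent (T i).
have cp M : GRing.comm M (T i) -> GRing.comm M (horner_mx (T i) p).
  exact: comm_horner_mxr.
have cpe : GRing.comm (horner_mx (T i) p) e.
  by apply: ce => j; apply/commr_sym/cp.
exists (horner_mx (T i) p * e); split.
- by rewrite mulrA -(mulrA _ e) -cpe mulrA pp -mulrA ee.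
- by move=> M cM; apply: commrM; [exact: cp|exact: ce].
- move=> j; rewrite inE => /orP[/eqP->|js]; first by rewrite mulrA Tp mul0r.
  by rewrite cpe mulrA Te// mul0r.
- by rewrite -mulmxE -mulmxA ke horner_mx_ker// p0 scale1r.
Qed.

End AffineMatrices.

Section CommutingNilpotents.
Context {R : realType} {n : nat} (l : 'I_n -> 'M[R]_n.+1).
Hypothesis cl : forall i j, GRing.comm (l i) (l j).
Hypothesis nl : forall i, nilpotent_mx (l i).
Hypothesis kl : forall i, l i *m e0c = 0.

Definition lincomb (s : 'I_n -> R) : 'M[R]_n.+1 := \sum_i s i *: l i.

Lemma comm_lincomb M s : (forall i, GRing.comm M (l i)) -> GRing.comm M (lincomb s).
Proof.
move=> cM; rewrite /GRing.comm /lincomb mulr_sumr mulr_suml; apply: eq_bigr => i _.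
by rewrite -scalerAl -scalerAr cM.
Qed.

Lemma comm_lincombs s t : GRing.comm (lincomb s) (lincomb t).
Proof. by apply: comm_lincomb => i; apply/commr_sym/comm_lincomb. Qed.

Lemma nilpotent_mx_lincomb s : nilpotent_mx (lincomb s).
Proof.
apply: nilpotent_mx_sum => [i j|i]; last exact: nilpotent_mxZ.
by rewrite /GRing.comm -!scalerAl -!scalerAr cl !scalerA mulrC.
Qed.

Lemma lincomb_ker s : lincomb s *m e0c = 0.
Proof.
by rewrite mulmx_suml big1// => i _; rewrite -scalemxAl kl scaler0.
Qed.

Lemma lincombD s t : lincomb (fun i => s i + t i) = lincomb s + lincomb t.
Proof. by rewrite -big_split; apply: eq_bigr => i _; rewrite scalerDl. Qed.

Lemma lincombZ a s : lincomb (fun i => a * s i) = a *: lincomb s.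
Proof. by rewrite scaler_sumr; apply: eq_bigr => i _; rewrite scalerA. Qed.

Lemma lincomb0 : lincomb (fun=> 0) = 0.
Proof. by rewrite /lincomb big1// => i _; rewrite scale0r. Qed.

Lemma lincomb_delta i : lincomb (fun j => (i == j)%:R) = l i.
Proof.
rewrite /lincomb (bigD1 i)//= eqxx scale1r big1 ?addr0// => j /negPf ji.
by rewrite eq_sym ji scale0r.
Qed.

Lemma mexp_lincombD s t :
  mexp (lincomb (fun i => s i + t i)) = mexp (lincomb s) * mexp (lincomb t).
Proof.
by rewrite lincombD mexpD//; [exact: comm_lincombs|exact: nilpotent_mx_lincomb|exact: nilpotent_mx_lincomb].
Qed.

Lemma mexp_lincombN s : mexp (lincomb (fun i => - s i)) * mexp (lincomb s) = 1.
Proof.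
rewrite -mexp_lincombD (_ : (fun _ => _) = fun=> 0) ?lincomb0 ?mexp0//.
by apply/funext => i; rewrite addNr.
Qed.

Lemma mexp_lincomb_unit s : mexp (lincomb s) \is a GRing.unit.
Proof.
apply/unitrP; exists (mexp (lincomb (fun i => - s i))).
split; first exact: mexp_lincombN.
by rewrite -[X in X * _](_ : mexp (lincomb (fun i => - - s i)) = _) ?mexp_lincombN//;
  under [in LHS]eq_fun do rewrite opprK.
Qed.

Lemma comm_mexp_lincombs s t : GRing.comm (mexp (lincomb s)) (mexp (lincomb t)).
Proof. by apply/comm_mexp/commr_sym/comm_mexp/comm_lincombs. Qed.

Lemma mexp_lincomb_ker s : mexp (lincomb s) *m e0c = e0c.
Proof. exact/mexp_ker/lincomb_ker. Qed.

End CommutingNilpotents.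

Lemma polymx_lincomb {R : realType} I n (l : (I -> R) -> 'I_n -> 'M[R]_n.+1) (s : (I -> R) -> 'I_n -> R) :
  (forall i, polymx (fun x => l x i)) -> (forall i, polyfun (fun x => s x i)) ->
  polymx (fun x => lincomb (l x) (s x)).
Proof. by move=> pl ps; apply: polymx_sum => i; apply: polymxZ. Qed.

Lemma polymx_mexp {R : realType} I n (M : (I -> R) -> 'M[R]_n.+1) :
  polymx M -> polymx (fun x => mexp (M x)).
Proof.
move=> pM; under eq_fun do rewrite mexpE.
apply: polymx_sum => k; apply: polymxZ; first exact: polyfun_cst.
exact: polymxX.
Qed.

Lemma polymx_mlog {R : realType} I n (M : (I -> R) -> 'M[R]_n.+1) :
  polymx M -> polymx (fun x => mlog1p (M x)).
Proof.
move=> pM; rewrite /mlog1p; under eq_fun do rewrite /log_poly poly_def rmorph_sum /=.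
apply: polymx_sum => k; under eq_fun do rewrite horner_mxZ rmorphXn /= horner_mx_X.
by apply: polymxZ; [exact: polyfun_cst|exact: polymxX].
Qed.

Lemma int_row_ind n (P : 'rV[int]_n -> Prop) :
  P 0 -> (forall x y, P x -> P y -> P (x + y)) -> (forall x, P x -> P (- x)) ->
  (forall i, P (delta_mx 0 i)) -> forall x, P x.
Proof.
move=> P0 PD PN Pe x.
have PMn (y : 'rV[int]_n) k : P y -> P (y *+ k).
  move=> Py; elim: k => [|k IH]; first by rewrite mulr0n.
  by rewrite mulrS; apply: PD.
have PZ i (k : int) : P (k *: delta_mx 0 i).
  have e : k *: delta_mx 0 i = (delta_mx 0 i : 'rV[int]_n) *~ k.
    by apply/matrixP => a b; rewrite -scaler_int intz.
  by rewrite e; case: k {e} => k; rewrite ?NegzE ?mulrNz -?pmulrn; [|apply: PN]; apply: PMn.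
rewrite (row_sum_delta x); elim/big_rec: _ => // i y _; exact: PD.
Qed.

(** * Properly discontinuous actions are unipotent *)

Section UnipotentFrame.
Context {R : realType} {n : nat} (g : 'rV[int]_n -> 'M[R]_n.+1).
Hypothesis gD : forall k k', g (k + k') = g k * g k'.
Hypothesis g0 : g 0 = 1.
Hypothesis gk : forall k, g k *m e0c = e0c.

Definition cube (s : 'I_n -> R) : Prop := forall i, 0 <= s i <= 1.

(** Proper discontinuity for the compact sets that are polynomial images of the cube. The condition
    on [f s *m e0c] makes [f s] the row of a point. *)
Hypothesis g_discontinuous : forall f : ('I_n -> R) -> 'rV[R]_n.+1,
  polymx f -> (forall s, f s *m e0c = 1) ->
  finite_set [set k | exists s s', [/\ cube s, cube s' & f s *m g k = f s']].

Let T i := g (delta_mx 0 i) - 1.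

Definition generator_log i := mlog1p (T i).

Definition frame : 'M[R]_n := \matrix_(i, j) generator_log i 0 (lift 0 j).

Lemma comm_g k k' : GRing.comm (g k) (g k').
Proof. by rewrite /GRing.comm -!gD addrC. Qed.

Lemma comm_gT k i : GRing.comm (g k) (T i).
Proof. by apply: commrB; [exact: comm_g|exact: commr1]. Qed.

Lemma comm_TT i j : GRing.comm (T i) (T j).
Proof. by apply/commr_sym/commrB; [exact/commr_sym/comm_gT|exact: commr1]. Qed.

Lemma T_ker i : T i *m e0c = 0.
Proof. by rewrite mulmxBl gk mul1mx subrr. Qed.

Lemma gN k : g k * g (- k) = 1.
Proof. by rewrite -gD subrr. Qed.

Lemma floor_multiples_unbounded (c : R) (K : nat) : c != 0 ->
  exists t : nat, (K < `|Num.floor (t%:R * c)|)%N.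
Proof.
move=> c0; have cp : 0 < `|c| by rewrite normr_gt0.
pose t := Num.truncn ((K.+2)%:R / `|c|).
exists t.+1; rewrite -(ltr_nat R) natr_absz intr_norm.
have : (K.+2)%:R < `|t.+1%:R * c|.
  by rewrite normrM ger0_norm// -ltr_pdivrMr// truncnS_gt.
have := floor_itv (t.+1%:R * c); rewrite intrD.
move: (t.+1%:R * c) => x; set z := (Num.floor _)%:~R => /andP[z1 z2].
rewrite -[K.+2]addn2 natrD => h.
have [x0|x0] := ler0P x.
  by rewrite ler0_norm// in h; rewrite -normrN; apply: lt_le_trans (ler_norm (- z)); lra.
rewrite gtr0_norm// in h; apply: lt_le_trans (ler_norm z); lra.
Qed.

Lemma unbounded_not_finite (k : nat -> 'rV[int]_n) i :
  (forall K, exists t, (K < `|k t 0%R i|)%N) -> ~ finite_set (range k).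
Proof.
move=> ku /finite_seqP[s e].
have [t] := ku (\max_(x <- s) `|x 0%R i|%N).
suff : (`|k t 0%R i| <= \max_(x <- s) `|x 0%R i|)%N by rewrite leqNgt => /negP.
have : range k (k t) by exists t.
rewrite e /= => kts.
exact: (@leq_bigmax_seq _ s xpredT (fun x : 'rV[int]_n => `|x 0%R i|%N) (k t) kts isT).
Qed.

Lemma unipotent_frame : (forall i, nilpotent_mx (T i)) /\ frame \in unitmx.
Proof.
have [e [ee ce Te ke]] :=
  common_fitting_idempotent (enum 'I_n) comm_TT T_ker.
have cge k : GRing.comm (g k) e by apply: ce => i; exact: comm_gT.
have cTe i : GRing.comm (T i) e by apply: ce => j; exact: comm_TT.
(* At this stage only [T i * e] is known to be nilpotent, not [T i]. *)
pose l i := mlog1p (T i * e).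
have nTe i : nilpotent_mx (T i * e).
  rewrite /nilpotent_mx exprMn_comm// (exprS e n) mulrA Te ?mul0r// mem_enum.
  by [].
have cgl k i : GRing.comm (g k) (l i).
  by apply: comm_horner_mxr; apply: commrM; [exact: comm_gT|exact: cge].
have cTl i j : GRing.comm (T i) (l j).
  by apply: comm_horner_mxr; apply: commrM; [exact: comm_TT|exact: cTe].
have cle i : GRing.comm (l i) e.
  by apply: ce => j; apply/commr_sym/cTl.
have cl i j : GRing.comm (l i) (l j).
  apply: comm_horner_mxr; apply: commrM; last exact: cle.
  exact/commr_sym/cTl.
have nl i : nilpotent_mx (l i) by exact: nilpotent_mx_log.
have kTe i : (T i * e) *m e0c = 0 by rewrite -mulmxE -mulmxA ke T_ker.
have kl i : l i *m e0c = 0 by exact: mlog_ker.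
pose L (k : 'rV[int]_n) := lincomb l (fun i => (k 0 i)%:~R).
have cgL k s : GRing.comm (g k) (mexp (lincomb l s)).
  by apply/comm_mexp/comm_lincomb.
have eg k : e * g k = e * mexp (L k).
  elim/int_row_ind: k => [|k k' IH IH'|k IH|i].
  - rewrite g0 /L (_ : (fun _ => _) = fun=> 0) ?lincomb0 ?mexp0//.
    by apply/funext => i; rewrite mxE.
  - rewrite gD mulrA IH -mulrA -cgL mulrA IH' -mulrA; congr (_ * _).
    rewrite /L -(mexp_lincombD cl nl); congr mexp; congr lincomb.
    by apply/funext => i; rewrite mxE intrD addrC.
  - have eL : mexp (L (- k)) * mexp (L k) = 1.
      rewrite -[RHS](mexp_lincombN cl nl (fun i => (k 0 i)%:~R)).
      by congr (mexp (lincomb _ _) * _); apply/funext => i; rewrite mxE intrN.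
    have eL' : mexp (L k) * mexp (L (- k)) = 1.
      by rewrite -eL; apply: comm_mexp_lincombs.
    rewrite -[e in LHS]mulr1 -eL' mulrA -IH -!mulrA -(cgL (- k)).
    by rewrite (mulrA (g k)) gN mul1r.
  - rewrite /L (_ : (fun _ => _) = fun j => (i == j)%:R).
      rewrite lincomb_delta mexp_log// mulrDr mulr1 (mulrA e) -cTe -mulrA ee.
      by rewrite (cTe i) -{2}[e]mulr1 -mulrDr addrC subrK.
    by apply/funext => j; rewrite mxE eqxx /= eq_sym; case: (_ == _).
(* The projection of the origin by [e]. It is still a point, and since [e] fixes it, [g k] moves it
   as [mexp (L k)] does. *)
pose xh : 'rV[R]_n.+1 := e0r *m e.
have xe : xh *m e = xh by rewrite -mulmxA mulmxE ee.
have xh1 : xh *m e0c = 1 by rewrite -mulmxA ke e0r_e0c.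
have xg k : xh *m g k = xh *m mexp (L k).
  by rewrite -!mulmxA !mulmxE eg.
pose B : 'M[R]_(n, n.+1) := \matrix_i (xh *m l i).
have rB : row_free B.
  rewrite -kermx_eq0; apply: contraT => /rowV0Pn[u /sub_kermxP uB u0].
  have ul : xh *m lincomb l (fun i => u 0 i) = 0.
    rewrite -uB [RHS]mulmx_sum_row /lincomb mulmx_sumr; apply: eq_bigr => i _.
    by rewrite rowK -scalemxAr.
  have /rV0Pn[i ui] := u0.
  (* By the relation [u], the exponentials of its multiples fix [xh]. The integral parts [k t] of
     these multiples are infinite in number, while [xh *m g (k t)] depends only on the fractional
     parts, which lie in the cube. *)
  pose k (t : nat) : 'rV[int]_n := \row_i Num.floor (t%:R * u 0 i).
  have [] := @unbounded_not_finite k i.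
    move=> K; have [t Kt] := floor_multiples_unbounded K ui.
    by exists t; rewrite mxE.
  (* The sign comes from writing the integral part as [t u] minus the fractional part. *)
  pose f (s : 'I_n -> R) := xh *m mexp (lincomb l (fun i => -1 * s i)).
  have pf : polymx f.
    apply: polymxM; first exact: polymx_cst.
    apply: polymx_mexp; apply: polymx_lincomb => j; first exact: polymx_cst.
    by apply: polyfunM; [exact: polyfun_cst|exact: polyfun_var].
  have f1 s : f s *m e0c = 1 by rewrite -mulmxA mexp_lincomb_ker.
  apply: sub_finite_set (g_discontinuous pf f1) => _ [t _ <-].
  exists (fun=> 0), (fun i => t%:R * u 0 i - (Num.floor (t%:R * u 0 i))%:~R); split.
  - by move=> j; rewrite lexx ler01.
  - move=> j; have := floor_itv (t%:R * u 0 j); rewrite intrD => /andP[].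
    by set z := (Num.floor _)%:~R => ? ?; apply/andP; split; lra.
  rewrite /f (_ : (fun _ => _) = fun=> 0); last by apply/funext => j; rewrite mulr0.
  rewrite lincomb0 mexp0 mulmx1 xg.
  have -> : L (k t) = t%:R *: lincomb l (fun i => u 0 i) +
     lincomb l (fun i => -1 * (t%:R * u 0 i - (Num.floor (t%:R * u 0 i))%:~R)).
    rewrite -lincombZ -lincombD; congr lincomb; apply/funext => j.
    by rewrite mxE; ring.
  set X := lincomb l _; set Y := lincomb l _.
  have -> : mexp (t%:R *: X + Y) = mexp (t%:R *: X) *m mexp Y.
    rewrite mexpD//; [|by apply: nilpotent_mxZ; exact: nilpotent_mx_lincomb|exact: nilpotent_mx_lincomb].
    by rewrite /GRing.comm -scalerAl -scalerAr comm_lincombs.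
  rewrite mulmxA; congr (_ *m _).
  rewrite mexpE mulmx_sumr big_ord_recl expr0 invr1 scale1r mulmx1 big1 ?addr0// => j _.
  rewrite -scalemxAr exprZn -scalemxAr lift0 [X ^+ _]exprS -mulmxE mulmxA ul.
  by rewrite mul0mx !scaler0.
(* Dimension count: [B] kills [e0c] and [xh] does not, so the n + 1 rows of [Q] form a basis. As [e]
   fixes each of them, it is the identity. *)
pose Q : 'M[R]_(1 + n) := col_mx xh B.
have uQ : Q \in unitmx.
  rewrite -row_free_unit -kermx_eq0; apply: contraT => /rowV0Pn[u /sub_kermxP].
  rewrite -(hsubmxK u) mul_row_col => uQ u0.
  have Bk : B *m e0c = 0.
    by apply/row_matrixP => i; rewrite row_mul rowK row0 -mulmxA kl mulmx0.
  have ul : lsubmx u = 0.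
    have := congr1 (mulmx^~ e0c) uQ.
    by rewrite mulmxDl -(mulmxA _ xh) xh1 -(mulmxA _ B) Bk mulmx0 addr0 mul0mx mulmx1.
  rewrite ul mul0mx add0r in uQ.
  have ur : rsubmx u = 0.
    by apply: (row_free_inj rB); rewrite uQ mul0mx.
  by rewrite ul ur row_mx0 eqxx in u0.
have Qe : Q *m e = Q.
  rewrite mul_col_mx xe; congr col_mx; apply/row_matrixP => i.
  by rewrite row_mul !rowK -mulmxA mulmxE cle -mulmxE mulmxA xe.
have e1 : e = 1 by rewrite -[e](mulKmx uQ) Qe mulVmx.
have nT i : nilpotent_mx (T i) by have := nTe i; rewrite e1 mulr1.
split=> //.
have BE : B = row_mx (0 : 'M[R]_(n, 1)) frame.
  apply/matrixP => i j; rewrite mxE /xh e1 mulmx1.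
  rewrite -rowE mxE /l e1 mulr1.
  rewrite [RHS]mxE; case: (@fintype.splitP 1 n j) => j' jj'.
    have -> : j = 0 by apply: val_inj; rewrite /= jj' ord1.
    have := kl i; rewrite /l e1 mulr1 -colE => /matrixP/(_ 0 0).
    by rewrite !mxE.
  have -> : j = lift 0 j' by apply: val_inj; rewrite /= jj'.
  by rewrite mxE.
rewrite -row_free_unit -kermx_eq0; apply: contraT => /rowV0Pn[u /sub_kermxP uf u0].
have uB : u *m B = 0.
  by have := mul_mx_row u (0 : 'M[R]_(n, 1)) frame; rewrite BE uf mulmx0 row_mx0.
by rewrite -(inj_eq (row_free_inj rB)) uB mul0mx eqxx in u0.
Qed.

End UnipotentFrame.

(** * Normalized logarithms and conjugation by the stabilizer *)

Lemma invmxM {R : comUnitRingType} n (b c : 'M[R]_n) :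
  b \in unitmx -> c \in unitmx -> invmx (b *m c) = invmx c *m invmx b.
Proof.
move=> ub uc; have ubc : b *m c \in unitmx by rewrite unitmx_mul ub.
rewrite -[RHS]mulmx1 -(mulmxV ubc) mulmxA -(mulmxA (invmx c)) mulKmx//.
by rewrite mulVmx// mul1mx.
Qed.

Section LinearPart.
Context {R : realType} {n : nat}.

(* Affine maps act on rows [(1, x)] from the right; [hat b] is the linear map [b]. *)
Definition hat (b : 'M[R]_n) : 'M[R]_n.+1 :=
  block_mx (1 : 'M[R]_1) 0 0 b.

Lemma hat00 b : hat b 0 0 = 1.
Proof.
have e := @block_mxEul R 1 n 1 n 1 0 0 b 0 0; rewrite [X in _ = X]mxE eqxx in e.
by apply: etrans e; congr (hat b _ _); exact: val_inj.
Qed.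

Lemma hat0l b j : hat b 0 (lift 0 j) = 0.
Proof.
have e := @block_mxEur R 1 n 1 n 1 0 0 b 0 j; rewrite [X in _ = X]mxE in e.
by apply: etrans e; congr (hat b _ _); exact: val_inj.
Qed.

Lemma hatl0 b i : hat b (lift 0 i) 0 = 0.
Proof.
have e := @block_mxEdl R 1 n 1 n 1 0 0 b i 0; rewrite [X in _ = X]mxE in e.
by apply: etrans e; congr (hat b _ _); exact: val_inj.
Qed.

Lemma hatll b i j : hat b (lift 0 i) (lift 0 j) = b i j.
Proof.
have e := @block_mxEdr R 1 n 1 n 1 0 0 b i j.
by apply: etrans e; congr (hat b _ _); exact: val_inj.
Qed.

Lemma hatM b c : hat (b *m c) = hat b * hat c.
Proof.
have := @mulmx_block R 1 n 1 n 1 n 1 0 0 b 1 0 0 c.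
by rewrite !mulmx0 !mul0mx !mulmx1 !addr0 add0r.
Qed.

Lemma hat1 : hat 1%:M = 1.
Proof. by rewrite /hat -scalar_mx_block. Qed.

Lemma hat_e0c b : hat b *m e0c = e0c.
Proof.
apply/matrixP => i j; rewrite -colE mxE [RHS]mxE (ord1 j) eqxx andbT.
by case: (unliftP 0 i) => [k|] ->; rewrite ?hatl0 ?hat00.
Qed.

Lemma e0r_hat b : e0r *m hat b = e0r.
Proof.
apply/matrixP => i j; rewrite -rowE mxE [RHS]mxE (ord1 i) eqxx /=.
by case: (unliftP 0 j) => [k|] ->; rewrite ?hat0l ?hat00.
Qed.

Lemma hat_unit b : b \in unitmx -> hat b * hat (invmx b) = 1.
Proof. by move=> ub; rewrite -hatM mulmxV// hat1. Qed.

Lemma hat_unitV b : b \in unitmx -> hat (invmx b) * hat b = 1.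
Proof. by move=> ub; rewrite -hatM mulVmx// hat1. Qed.

Definition linear_part (M : 'M[R]_n.+1) : 'M[R]_n := \matrix_(i, j) M (lift 0 i) (lift 0 j).

Lemma hat_linear_part M : M *m e0c = e0c -> e0r *m M = e0r -> hat (linear_part M) = M.
Proof.
move=> Mc Mr; apply/matrixP => i j.
have /matrixP/(_ i 0) := Mc; rewrite -colE mxE [RHS]mxE => Mi0.
have /matrixP/(_ 0 j) := Mr; rewrite -rowE mxE [RHS]mxE => M0j.
move: Mi0 M0j; case: (unliftP 0 i) => [i'|] ->; case: (unliftP 0 j) => [j'|] -> /=;
  by rewrite ?hatll ?hatl0 ?hat0l ?hat00 ?mxE // eqxx.
Qed.

End LinearPart.

Lemma polymx_hat {R : realType} I n (b : (I -> R) -> 'M[R]_n) :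
  polymx b -> polymx (fun x => hat (b x)).
Proof. by move=> pb; apply: (@polymx_block R I 1 n 1 n) => //; exact: polymx_cst. Qed.

(** * Normalized logarithms and their developing map *)

Section NormalLogs.
Context {R : realType} {n : nat}.

Definition normal_logs (l : 'I_n -> 'M[R]_n.+1) : Prop :=
  [/\ forall i j, GRing.comm (l i) (l j), forall i, nilpotent_mx (l i),
      forall i, l i *m e0c = 0 & forall i, e0r *m l i = delta_mx 0 (lift 0 i)].

Context (l : 'I_n -> 'M[R]_n.+1) (ll : normal_logs l).

Lemma e0r_lincomb s : e0r *m lincomb l s = \sum_i s i *: delta_mx 0 (lift 0 i).
Proof.
rewrite /lincomb mulmx_sumr; apply: eq_bigr => i _.
by rewrite -scalemxAr; have [_ _ _ ->] := ll.
Qed.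

Lemma lincomb0l s j : lincomb l s 0 (lift 0 j) = s j.
Proof.
have /matrixP/(_ 0 (lift 0 j)) := e0r_lincomb s; rewrite -rowE mxE => ->.
rewrite summxE (bigD1 j)//= !mxE !eqxx mulr1 big1 ?addr0// => i ij.
by rewrite !mxE (inj_eq lift_inj) eq_sym (negPf ij) mulr0.
Qed.

(** The origin is a cyclic vector: the other basis rows are [e0r *m l i], so a matrix in the
    commutant is determined by its first row. *)
Lemma normal_logs_commutant M N :
  (forall i, GRing.comm M (l i)) -> (forall i, GRing.comm N (l i)) ->
  e0r *m M = e0r *m N -> M = N.
Proof.
move=> cM cN MN; apply/row_matrixP => i; rewrite !rowE.
case: (unliftP 0 i) => [i'|] ->; last exact: MN.
have [_ _ _ /(_ i') <-] := ll.
by rewrite -!mulmxA !mulmxE -cM -cN -!mulmxE !mulmxA MN.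
Qed.

(** Both sides commute with the [l i] and have the same first row. The span of the logarithms is
    therefore closed under power series without constant term, in particular under exp - 1 and log(1
    + .). *)
Lemma normal_logs_span M :
  (forall i, GRing.comm M (l i)) -> M *m e0c = 0 ->
  M = lincomb l (fun i => M 0 (lift 0 i)).
Proof.
move=> cM Mk; have [cl _ kl _] := ll.
apply: normal_logs_commutant => //.
  by move=> i; apply/commr_sym/comm_lincomb.
apply/matrixP => i j; rewrite -!rowE !mxE.
case: (unliftP 0 j) => [j'|] ->; first by rewrite lincomb0l.
have /matrixP/(_ 0 0) := Mk; rewrite -colE mxE => ->.
by have /matrixP/(_ 0 0) := lincomb_ker kl (fun i => M 0 (lift 0 i)); rewrite -colE !mxE.
Qed.

(** The orbit map of the origin under the exponentials of the span, and its inverse. Both are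
    polynomial: [dev_lincomb] turns [dev] into exp - 1 on the span, which the logarithm inverts. *)
Definition dev (s : 'I_n -> R) (j : 'I_n) : R := mexp (lincomb l s) 0 (lift 0 j).
Definition undev (y : 'I_n -> R) (j : 'I_n) : R := mlog1p (lincomb l y) 0 (lift 0 j).

Lemma dev_lincomb s : lincomb l (dev s) = mexp (lincomb l s) - 1.
Proof.
have [cl nl kl _] := ll.
rewrite [RHS]normal_logs_span.
- congr lincomb; apply/funext => i; rewrite /dev 3!mxE.
  by rewrite subr0.
- move=> i; apply/commr_sym/commrB; last exact: commr1.
  by apply/comm_mexp/comm_lincomb.
- by rewrite mulmxBl mexp_lincomb_ker// mul1mx subrr.
Qed.

Lemma undev_lincomb y : lincomb l (undev y) = mlog1p (lincomb l y).
Proof.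
have [cl nl kl _] := ll.
rewrite [RHS]normal_logs_span//.
- move=> i; apply/commr_sym/comm_horner_mxr.
  by apply: comm_lincomb.
- exact/mlog_ker/lincomb_ker.
Qed.

Lemma devK s : undev (dev s) = s.
Proof.
have [cl nl kl _] := ll.
by apply/funext => j; rewrite /undev dev_lincomb mlog_exp ?lincomb0l//; exact: nilpotent_mx_lincomb.
Qed.

Lemma undevK y : dev (undev y) = y.
Proof.
have [cl nl kl _] := ll.
apply/funext => j; rewrite /dev undev_lincomb mexp_log; last exact: nilpotent_mx_lincomb.
by rewrite 2!mxE lincomb0l /= add0r.
Qed.

Lemma e0r_mexp s t : e0r *m mexp (lincomb l s) = e0r *m mexp (lincomb l t) -> s = t.
Proof.
move=> e; rewrite -[s]devK -[t]devK; congr undev; apply/funext => j; rewrite /dev.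
by have /matrixP/(_ 0 (lift 0 j)) := e; rewrite -!rowE !mxE.
Qed.

Lemma row_dev (y : 'rV[R]_n.+1) (s : 'I_n -> R) : y *m e0c = 1 ->
  (forall j, y 0 (lift 0 j) = dev s j) -> e0r *m mexp (lincomb l s) = y.
Proof.
have [cl nl kl _] := ll.
move=> y1 ys; apply/matrixP => i j; rewrite -rowE mxE (ord1 i).
case: (unliftP 0 j) => [j'|] ->; first by rewrite ys.
have /matrixP/(_ 0 0) := y1; rewrite -colE [LHS]mxE [RHS]mxE => ->.
have /matrixP/(_ 0 0) := mexp_lincomb_ker kl s; rewrite -colE [LHS]mxE => ->.
by rewrite mxE.
Qed.

Lemma polyfun_undev j : polyfun (undev^~ j).
Proof.
apply: (polymx_mlog (polymx_lincomb _ _)) => i; first exact: polymx_cst.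
exact: polyfun_var.
Qed.

End NormalLogs.

Lemma polyfun_univariate {R : realType} (f : (unit -> R) -> R) : polyfun f ->
  exists p : {poly R}, forall x, f x = p.[x tt].
Proof.
elim=> [c|[]|f1 f2 _ [p pf] _ [q qf]|f1 f2 _ [p pf] _ [q qf]].
- by exists c%:P => x; rewrite hornerC.
- by exists 'X => x; rewrite hornerX.
- by exists (p + q) => x; rewrite hornerD pf qf.
- by exists (p * q) => x; rewrite hornerM pf qf.
Qed.

Lemma poly_nat_roots {R : realType} (p : {poly R}) :
  (forall k : nat, p.[k%:R] = 0) -> p = 0.
Proof.
move=> pk; apply/eqP; apply: contraT => p0.
have := max_poly_roots p0 (rs := [seq k%:R | k <- iota 0 (size p)]).
rewrite size_map size_iota ltnn => -> //.
  by apply/allP => _ /mapP[k _ ->]; rewrite /root pk.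
rewrite map_inj_uniq ?iota_uniq// => x y /eqP; by rewrite eqr_nat => /eqP.
Qed.

(** * Real algebraic groups of affine matrices *)

Section AffineGroup.
Context {R : realType} {n : nat} (G : set 'M[R]_n.+1)
  (qs : seq (('I_n.+1 * 'I_n.+1 -> R) -> R)).
Hypothesis qs_poly : forall i, (i < size qs)%N -> polyfun (nth (fun=> 0) qs i).
Hypothesis G1 : G 1.
Hypothesis GM : forall M N, G M -> G N -> G (M * N).
Hypothesis GV : forall M, G M -> G (invmx M).
Hypothesis Gunit : forall M, G M -> M \in unitmx /\ M *m e0c = e0c.
Hypothesis GP : forall M, M \in unitmx -> M *m e0c = e0c ->
  G M <-> forall i, (i < size qs)%N -> nth (fun=> 0) qs i (entries M) = 0.

Definition stabilizer (h : 'M[R]_n) : Prop := G (hat h).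

Lemma stabilizer1 : stabilizer 1%:M.
Proof. by rewrite /stabilizer hat1. Qed.

Lemma stabilizerM h k : stabilizer h -> stabilizer k -> stabilizer (h *m k).
Proof. by rewrite /stabilizer hatM; exact: GM. Qed.

Lemma hat_unitmx (h : 'M[R]_n) : (hat h \in unitmx) = (h \in unitmx).
Proof. by rewrite !unitmxE /hat (det_ublock (1 : 'M[R]_1)) det1 mul1r. Qed.

Lemma hatV (h : 'M[R]_n) : h \in unitmx -> hat (invmx h) = invmx (hat h).
Proof.
move=> uh; have uhh : hat h \in unitmx by rewrite hat_unitmx.
by rewrite -[LHS]mul1mx -(mulVmx uhh) -mulmxA mulmxE hat_unit// mulr1.
Qed.

Lemma stabilizerV h : stabilizer h -> h \in unitmx /\ stabilizer (invmx h).
Proof.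
move=> Hh; have [uh _] := Gunit Hh; rewrite hat_unitmx in uh.
by split=> //; rewrite /stabilizer hatV//; exact: GV.
Qed.

Lemma stabilizerP h : h \in unitmx -> stabilizer h <->
  forall i, (i < size qs)%N -> nth (fun=> 0) qs i (entries (hat h)) = 0.
Proof. by move=> uh; apply: GP; rewrite ?hat_unitmx ?hat_e0c. Qed.

(* [(b, l)] stands for the homomorphism
   [k |-> hat b^-1 * mexp (\sum_i k_i l_i) * hat b]. *)
Definition conj_frame (b : 'M[R]_n) (M : 'M[R]_n.+1) := hat (invmx b) * M * hat b.

Definition frame_data (b : 'M[R]_n) (l : 'I_n -> 'M[R]_n.+1) : Prop :=
  [/\ b \in unitmx, normal_logs l & forall i, G (conj_frame b (mexp (l i)))].

Lemma conj_frameM b M N : b \in unitmx ->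
  conj_frame b (M * N) = conj_frame b M * conj_frame b N.
Proof.
move=> ub; rewrite /conj_frame -!mulrA; congr (_ * (_ * _)).
by rewrite [hat b * _]mulrA hat_unit// mul1r.
Qed.

Lemma conj_frame1 b : b \in unitmx -> conj_frame b 1 = 1.
Proof. by move=> ub; rewrite /conj_frame mulr1 hat_unitV. Qed.

Lemma conj_frame_comp b c M : b \in unitmx -> c \in unitmx ->
  conj_frame (b *m c) M = conj_frame c (conj_frame b M).
Proof.
move=> ub uc.
by rewrite /conj_frame invmxM// !hatM !mulrA.
Qed.

Lemma conj_frame_e0c b M : M *m e0c = e0c -> conj_frame b M *m e0c = e0c.
Proof. by move=> Me; rewrite /conj_frame -!mulmxE -!mulmxA hat_e0c Me hat_e0c. Qed.

Context (b : 'M[R]_n) (l : 'I_n -> 'M[R]_n.+1) (bl : frame_data b l).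

Lemma conj_mexp_unit s : conj_frame b (mexp (lincomb l s)) \in unitmx.
Proof.
have [ub [cl nl kl _] _] := bl.
rewrite /conj_frame -!mulmxE !unitmx_mul !hat_unitmx unitmx_inv ub /=.
by rewrite andbT; exact: (mexp_lincomb_unit cl nl s).
Qed.

Lemma conj_mexpD s t : conj_frame b (mexp (lincomb l (fun i => s i + t i))) =
  conj_frame b (mexp (lincomb l s)) * conj_frame b (mexp (lincomb l t)).
Proof.
by have [ub [cl nl kl _] _] := bl; rewrite mexp_lincombD// conj_frameM.
Qed.

Lemma conj_mexp0 : conj_frame b (mexp (lincomb l (fun=> 0))) = 1.
Proof. by have [ub _ _] := bl; rewrite lincomb0 mexp0 conj_frame1. Qed.

(* The natural numbers are Zariski dense in the line. *)
Lemma frame_data_line i (t : R) : G (conj_frame b (mexp (t *: l i))).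
Proof.
have [ub [cl nl kl nrm] Gb] := bl.
have lE (a : R) : a *: l i = lincomb l (fun j => a * (i == j)%:R).
  by rewrite lincombZ lincomb_delta.
have Gk (k : nat) : G (conj_frame b (mexp (k%:R *: l i))).
  elim: k => [|k IH]; first by rewrite scale0r mexp0 conj_frame1.
  have e : k.+1%:R *: l i = lincomb l (fun j => k%:R * (i == j)%:R + (i == j)%:R).
    by rewrite lincombD lincombZ lincomb_delta -natr1 scalerDl scale1r.
  by rewrite e conj_mexpD -lE lincomb_delta; exact: GM.
have GPt (a : R) := GP (conj_mexp_unit (fun j => a * (i == j)%:R))
   (conj_frame_e0c b (mexp_lincomb_ker kl (fun j => a * (i == j)%:R))).
rewrite lE; apply/GPt => m mlt; rewrite -lE.
have pf : polyfun (fun x : unit -> R =>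
    nth (fun=> 0) qs m (entries (conj_frame b (mexp (x tt *: l i))))).
  apply: (polyfun_comp (qs_poly mlt)
    (h := fun x => entries (conj_frame b (mexp (x tt *: l i))))) => kl'.
  apply: polymxM; last exact: polymx_cst.
  apply: polymxM; first exact: polymx_cst.
  apply: polymx_mexp; apply: polymxZ; [exact: polyfun_var|exact: polymx_cst].
have [p pE] := polyfun_univariate pf.
have p0 : p = 0.
  apply: poly_nat_roots => k; rewrite -(pE (fun=> k%:R)).
  by have := Gk k; rewrite lE => /GPt/(_ m mlt).
by rewrite (pE (fun=> t)) p0 horner0.
Qed.

Lemma frame_data_group s : G (conj_frame b (mexp (lincomb l s))).
Proof.
have [ub _ _] := bl.
have -> : s = fun i => \sum_j s j * (j == i)%:R.
  apply/funext => i; rewrite (bigD1 i)//= eqxx mulr1 big1 ?addr0// => j ji.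
  by rewrite (negPf ji) mulr0.
elim: (index_enum _) => [|j r IH].
  rewrite (_ : (fun _ => _) = fun=> 0) ?conj_mexp0//.
  by apply/funext => i; rewrite big_nil.
rewrite (_ : (fun _ => _) =
    fun i => s j * (j == i)%:R + \sum_(j <- r) s j * (j == i)%:R).
  by rewrite conj_mexpD lincombZ lincomb_delta; apply: GM => //; exact: frame_data_line.
by apply/funext => i; rewrite big_cons.
Qed.

(* [frame_data_group] makes the centralizer of the homomorphism transitive on
   the orbit of the origin, so that conjugation reduces to the stabilizer. *)
Lemma conj_stabilizer a : G a -> exists h, stabilizer h /\
  forall s, invmx a * conj_frame b (mexp (lincomb l s)) * a =
    conj_frame (b *m h) (mexp (lincomb l s)).
Proof.
move=> Ga; have [ub ll _] := bl; have [cl nl kl nrm] := ll.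
have [ua ac] := Gunit Ga; have [uai aic] := Gunit (GV Ga).
(* [y] is the image of the origin under [invmx a], read in the frame [b]. The element [u] obtained
   from it moves the origin as [invmx a] does and commutes with the homomorphism. Hence [u * a]
   fixes the origin and conjugates in the same way as [a]. *)
pose y : 'rV[R]_n.+1 := e0r *m invmx a *m hat (invmx b).
have y1 : y *m e0c = 1 by rewrite -!mulmxA hat_e0c aic e0r_e0c.
pose s0 := undev l (fun j => y 0 (lift 0 j)).
have e0 : e0r *m mexp (lincomb l s0) = y.
  by apply: (row_dev ll) => // j; rewrite undevK.
pose u := conj_frame b (mexp (lincomb l s0)).
have Gu : G u by exact: frame_data_group.
have [uu uc] := Gunit Gu.
pose h := linear_part (u * a).
have hE : hat h = u * a.
  apply: hat_linear_part; first by rewrite -mulmxE -mulmxA ac uc.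
  rewrite -mulmxE mulmxA /u /conj_frame -!mulmxE !mulmxA e0r_hat e0 /y.
  rewrite -!mulmxA (mulmxA (hat _)) mulmxE hat_unitV// -mulmxE mul1mx.
  by rewrite mulVmx// mulmx1.
have Hh : stabilizer h by rewrite /stabilizer hE; exact: GM.
have [uh _] := stabilizerV Hh.
exists h; split=> // s; rewrite conj_frame_comp// [RHS]/conj_frame hatV// hE.
set W := conj_frame b _.
have cWu : W * u = u * W.
  by rewrite /W /u -!conj_frameM//; congr conj_frame; exact: comm_mexp_lincombs.
have uua : u * a \in unitmx.
  by rewrite -mulmxE unitmx_mul uu ua.
move: W cWu {Gu uc hE} => W cWu; move: (u) uu uua cWu => v uv uva cWv.
apply: (can_inj (mulKmx uva)); rewrite -!mulmxE !mulmxA mulmxV// mul1mx.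
by rewrite mulmxK// !mulmxE -cWv.
Qed.

End AffineGroup.

(** * Homeomorphisms of orbit spaces *)

Section ContinuityEntrywise.
Context {R : realType}.

Lemma continuous_mx {X : topologicalType} m n (f : X -> 'M[R]_(m, n)) (x : X) :
  (forall i j, {for x, continuous (fun x => f x i j)}) -> {for x, continuous f}.
Proof.
move=> cf A [P fP PA].
apply: filterS (_ : nbhs x [set y | forall ij : 'I_m * 'I_n, P ij.1 ij.2 (f y ij.1 ij.2)]).
  by move=> y Py; apply: PA => i j; exact: (Py (i, j)).
by apply: filter_forall => -[i j]; apply: cf; exact: fP.
Qed.

Lemma continuous_polyfun {X : topologicalType} I (f : (I -> R) -> R) (h : X -> I -> R) (x : X) :
  polyfun f -> (forall i, {for x, continuous (h^~ i)}) ->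
  {for x, continuous (fun x => f (h x))}.
Proof.
move=> pf ch; elim: pf => [c|i|f1 f2 _ c1 _ c2|f1 f2 _ c1 _ c2].
- exact: cvg_cst.
- exact: ch.
- exact: cvgD.
- exact: cvgM.
Qed.

Lemma nbhs_mxP m n (M : 'M[R]_(m, n)) (A : set 'M[R]_(m, n)) :
  nbhs M A -> exists2 e : R, 0 < e &
    forall N : 'M[R]_(m, n), (forall i j, `|N i j - M i j| < e) -> A N.
Proof.
move=> /nbhs_ballP[e /= e0 MA]; exists e => // N NM; apply: MA.
by split=> // i j; rewrite /ball /= distrC; exact: NM.
Qed.

Lemma near_mx m n (M : 'M[R]_(m, n)) (e : R) : 0 < e ->
  nbhs M [set N : 'M[R]_(m, n) | forall i j, `|N i j - M i j| < e].
Proof.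
move=> e0; apply/nbhs_ballP; exists e => // N MN i j.
by have [_ /(_ i j)] := MN; rewrite /ball /= distrC.
Qed.

End ContinuityEntrywise.

Lemma continuous_to_initial {X Z : topologicalType} {Y : choiceType}
  (w : Y -> Z) (f : X -> initial_topology w) (x : X) :
  {for x, continuous (w \o f)} -> {for x, continuous f}.
Proof.
move=> cf U [/= _ [[W oW <-]] /= Wsfz /filterS]; apply; apply: cf.
exact: open_nbhs_nbhs.
Qed.

Lemma continuous_to_prod {X : topologicalType} {I : Type} {K : I -> topologicalType}
  (f : X -> prod_topology K) (x : X) :
  (forall i, {for x, continuous (fun x => f x i)}) -> {for x, continuous f}.
Proof.
by move=> cf; apply/cvg_sup => i; apply: (@continuous_to_initial X (K i)); exact: cf.
Qed.

Section OrbitSpaceHomeo.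
Local Open Scope quotient_scope.
Context {R : realType} {X : topologicalType} (orb : X -> set X).

Lemma pi_orbitP (x y : X) :
  (\pi_(orbit_space orb) x = \pi_(orbit_space orb) y) <-> orb x = orb y.
Proof.
split=> [/eqmodP/asboolP//|e].
by apply/eqmodP/asboolP.
Qed.

(** Open sets of the quotient are saturated open sets of [X], so the last hypothesis is exactly what
    continuity of the inverse map on the range requires. *)
Lemma orbit_space_homeo N (F : X -> 'rV[R]_N) :
  continuous F ->
  (forall x y, F x = F y <-> orb x = orb y) ->
  (forall x0 (U : set X), open U -> (forall x y, orb x = orb y -> U x -> U y) ->
    U x0 -> exists2 e : R, 0 < e &
    forall x, (forall j, `|F x 0 j - F x0 0 j| < e) -> U x) ->
  homeomorphic (orbit_space orb) (range F).
Proof.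
move=> cF Fo Fopen.
have Fr (q : orbit_space orb) : F (repr q) \in range F by rewrite inE; exists (repr q).
have rF (y : range F) : exists x, F x = val y.
  by case: y => y /= /set_mem[x _ <-]; exists x.
have /choice[h hP] := rF.
pose f (q : orbit_space orb) : range F := exist _ (F (repr q)) (Fr q).
pose g (y : range F) := \pi_(orbit_space orb) (h y).
have Frepr x : F (repr (\pi_(orbit_space orb) x)) = F x.
  by apply/Fo/pi_orbitP; rewrite reprK.
exists f, g; split.
- apply: (continuous_comp_initial (w := set_val) (f := f)).
  apply: (repr_comp_continuous (Q0 := {eq_quot (same_orbit_rel orb)})) => // a b.
  by move=> /eqP/pi_orbitP/Fo ->.
- apply/continuousP => U oU; rewrite openE => y Uy.
  have [||e e0 eU] := Fopen (h y) (\pi_(orbit_space orb) @^-1` U) oU.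
  + by move=> a b /pi_orbitP ab; rewrite /preimage /= ab.
  + exact: Uy.
  have near_y : nbhs y [set z : range F | forall i j, `|val z i j - val y i j| < e].
    exact: (@initial_continuous _ _ (set_val : range F -> _) y _ (near_mx _ e0)).
  apply: (filterS _ near_y) => z /= zy; apply: eU => j; rewrite !hP.
  exact: zy.
- move=> q; rewrite /g /f -[RHS]reprK; apply/pi_orbitP/Fo; rewrite hP//.
- by move=> y; apply: val_inj; rewrite /f /g /= Frepr hP.
Qed.

Lemma homeomorphic_hausdorff N (Y : topologicalType) (S : set 'rV[R]_N) :
  homeomorphic Y S -> hausdorff_space Y.
Proof.
move=> [f [g [cf _ fK _]]] x y xy.
apply: (can_inj fK); apply: val_inj.
apply: (@norm_hausdorff R 'rV[R]_N) => A B /= fA fB.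
have cv z : {for z, continuous (fun z => val (f z) : 'rV[R]_N)}.
  apply: continuous_comp; [exact: cf|exact: initial_continuous].
have [z [Az Bz]] := xy _ _ (cv x _ fA) (cv y _ fB).
by exists (val (f z)).
Qed.
End OrbitSpaceHomeo.

(** * Invariants of cosets *)

Section RowSpaceProjection.
Context {R : realType} {k D : nat}.
Implicit Types A B : 'M[R]_(k, D).

Lemma row_gram_eq0 (w : 'rV[R]_D) : w *m w^T = 0 -> w = 0.
Proof.
move=> /matrixP/(_ 0 0); rewrite !mxE => /eqP; rewrite psumr_eq0 => [/allP h|j _].
  apply/matrixP => i j; rewrite (ord1 i) [RHS]mxE; apply/eqP.
  by have := h j (mem_index_enum _); rewrite mxE mulf_eq0 orbb.
by rewrite mxE -expr2 sqr_ge0.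
Qed.

Lemma gram_unit A : row_free A -> A *m A^T \in unitmx.
Proof.
move=> fA; rewrite -row_free_unit -kermx_eq0; apply: contraT => /rowV0Pn[u /sub_kermxP uA u0].
have uA0 : u *m A = 0.
  by apply: row_gram_eq0; rewrite trmx_mul !mulmxA -(mulmxA u) uA mul0mx.
by rewrite -(inj_eq (row_free_inj fA)) uA0 mul0mx eqxx in u0.
Qed.

(** The orthogonal projector onto the row space when the rows are free. It replaces a matrix known
    up to a change of basis by numbers that depend only on the subspace. *)
Definition row_proj A : 'M[R]_D := A^T *m invmx (A *m A^T) *m A.

Lemma mul_row_proj A : row_free A -> A *m row_proj A = A.
Proof. by move=> fA; rewrite /row_proj !mulmxA mulmxV ?mul1mx// gram_unit. Qed.

Lemma row_proj_sub A : (row_proj A <= A)%MS.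
Proof. exact: submxMl. Qed.

(** An inclusion suffices: both spaces have dimension [k], so the matrix [T] with A = T B is
    invertible, and it cancels. *)
Lemma row_proj_eq A B : row_free A -> row_free B -> (A <= B)%MS -> row_proj A = row_proj B.
Proof.
move=> fA fB /submxP[T AE].
have uT : T \in unitmx.
  rewrite -row_free_unit -kermx_eq0; apply: contraT => /rowV0Pn[u /sub_kermxP uT u0].
  by rewrite -(inj_eq (row_free_inj fA)) AE mulmxA uT !mul0mx eqxx in u0.
rewrite /row_proj AE trmx_mul.
have -> : T *m B *m (B^T *m T^T) = T *m (B *m B^T) *m T^T by rewrite !mulmxA.
rewrite invmxM ?unitmx_mul ?unitmx_tr ?uT ?gram_unit// invmxM ?gram_unit//.
by rewrite !mulmxA mulmxK ?unitmx_tr// mulmxKV.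
Qed.

End RowSpaceProjection.

Lemma definable_eqmx {R : realType} (I : finType) m n (A B : (I -> R) -> 'M[R]_(m, n)) :
  polymx A -> polymx B -> definable (fun z => A z = B z).
Proof.
move=> pA pB; apply: (definable_ext (P := fun z => forall i j, A z i j = B z i j)).
  by move=> z; split=> [e|-> //]; exact/matrixP.
by apply: definable_forall => i; apply: definable_forall => j; exact: definable_eq.
Qed.

Lemma definable_normal_logs {R : realType} (I : finType) n
    (l : (I -> R) -> 'I_n -> 'M[R]_n.+1) :
  (forall i, polymx (l^~ i)) -> definable (fun z => normal_logs (l z)).
Proof.
move=> pl.
apply: (definable_ext (P := fun z => (forall i j, l z i *m l z j = l z j *m l z i) /\
  (forall i, l z i ^+ n.+1 = 0) /\ (forall i, l z i *m e0c = 0) /\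
  (forall i, e0r *m l z i = delta_mx 0 (lift 0 i)))).
  by move=> z; split=> [[? [? []]]|[]].
apply: definable_and.
  by apply: definable_forall => i; apply: definable_forall => j; apply: definable_eqmx; exact: polymxM.
apply: definable_and; [|apply: definable_and]; apply: definable_forall => i; apply: definable_eqmx;
  do ?[exact: polymx_cst|exact: polymxX|exact: pl|apply: polymxM].
Qed.

Section CosetInvariants.
Context {R : realType} {n : nat} (G : set 'M[R]_n.+1)
  (qs : seq (('I_n.+1 * 'I_n.+1 -> R) -> R)).
Hypothesis qs_poly : forall i, (i < size qs)%N -> polyfun (nth (fun=> 0) qs i).
Hypothesis G1 : G 1.
Hypothesis GM : forall M N, G M -> G N -> G (M * N).
Hypothesis GV : forall M, G M -> G (invmx M).
Hypothesis Gunit : forall M, G M -> M \in unitmx /\ M *m e0c = e0c.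
Hypothesis GP : forall M, M \in unitmx -> M *m e0c = e0c ->
  G M <-> forall i, (i < size qs)%N -> nth (fun=> 0) qs i (entries M) = 0.

Local Notation H := (stabilizer G).

Let HM := stabilizerM GM.
Let HV := stabilizerV GV Gunit.
Let HP := stabilizerP GP.

Lemma stabilizer_row_space : exists k D (C : 'M[R]_n -> 'M[R]_(k, D)),
  [/\ polymx (C \o @of_entries R n n),
      forall g, g \in unitmx -> row_free (C g) &
      forall g x, g \in unitmx -> x \in unitmx ->
        (C x <= C g)%MS <-> H (invmx g *m x)].
Proof.
pose s := [seq (fun y : 'I_n * 'I_n -> R => q (entries (hat (of_entries y)))) | q <- qs].
have snth i y : (i < size s)%N ->
    nth (fun=> 0) s i (entries y) = nth (fun=> 0) qs i (entries (hat y)).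
  by rewrite size_map => ilt; rewrite (nth_map (fun=> 0))// entriesK.
apply: (@coset_row_space R n s H).
- move=> i; rewrite size_map => ilt; rewrite (nth_map (fun=> 0))//.
  apply: (polyfun_comp (qs_poly ilt) (h := fun y => entries (hat (of_entries y)))) => kl.
  by apply: polymx_hat; exact: polymx_of_entries.
- exact: stabilizer1.
- exact: HM.
- exact: HV.
- move=> x ux h; apply/(HP ux) => i ilt; rewrite -snth ?size_map//.
  by apply: h; rewrite size_map.
- move=> x Hx i ilt; have [ux _] := HV Hx; rewrite snth//.
  by have /(HP ux) := Hx; apply; move: ilt; rewrite size_map.
Qed.

Definition bounded_mx (t : R) (M : 'M[R]_n) : Prop := forall i j, -t <= M i j <= t.

(** For [c] the inverse of [b], a common bound for a representative of the coset and its inverse;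
    bounding the inverse keeps limits of representatives invertible. The inverses [h'] and [c] are
    separate variables so that the conditions are polynomial. *)
Definition orbit_bound (b c : 'M[R]_n) (t : R) : Prop :=
  0 <= t /\ exists h h', [/\ h *m h' = 1%:M, H h, bounded_mx t (b *m h) &
    bounded_mx t (h' *m c)].

Definition coset_size (b c : 'M[R]_n) : R := inf (orbit_bound b c).

Lemma bounded_mx_norm t M : bounded_mx t M <-> forall i j, `|M i j| <= t.
Proof. by split=> h i j; have := h i j; rewrite ler_norml. Qed.

Lemma bounded_mxM s t M N : 0 <= s -> 0 <= t ->
  bounded_mx s M -> bounded_mx t N -> bounded_mx (n%:R * s * t) (M *m N).
Proof.
move=> s0 t0 /bounded_mx_norm hM /bounded_mx_norm hN; apply/bounded_mx_norm => i j.
rewrite mxE; apply: le_trans (ler_norm_sum _ _ _) _.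
apply: (@le_trans _ _ (\sum_(k < n) s * t)).
  by apply: ler_sum => k _; rewrite normrM ler_pM.
by rewrite sumr_const card_ord -[X in X <= _]mulr_natl mulrA.
Qed.

Lemma bounded_mxD s t M N :
  bounded_mx s M -> bounded_mx t N -> bounded_mx (s + t) (M + N).
Proof.
move=> /bounded_mx_norm hM /bounded_mx_norm hN; apply/bounded_mx_norm => i j.
by rewrite mxE; apply: le_trans (ler_normD _ _) _; exact: lerD.
Qed.

Lemma bounded_mx_ex M : exists2 t, 0 <= t & bounded_mx t M.
Proof.
exists (\sum_i \sum_j `|M i j|).
  by apply: sumr_ge0 => i _; apply: sumr_ge0.
apply/bounded_mx_norm => i j; rewrite (bigD1 i)//= (bigD1 j)//= -addrA lerDl.
by apply: addr_ge0; apply: sumr_ge0 => // k _; exact: sumr_ge0.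
Qed.

Lemma bounded_mx_le s t M : s <= t -> bounded_mx s M -> bounded_mx t M.
Proof.
by move=> st /bounded_mx_norm h; apply/bounded_mx_norm => i j; exact: le_trans (h i j) st.
Qed.

Lemma orbit_bound_nonempty b c : orbit_bound b c !=set0.
Proof.
have [s s0 hs] := bounded_mx_ex b; have [t t0 ht] := bounded_mx_ex c.
exists (s + t); split; first exact: addr_ge0.
exists 1%:M, 1%:M; rewrite mulmx1 mul1mx mulmx1; split=> //; first exact: stabilizer1.
  by apply: bounded_mx_le hs; rewrite lerDl.
by apply: bounded_mx_le ht; rewrite lerDr.
Qed.

Lemma orbit_bound_has_inf b c : has_inf (orbit_bound b c).
Proof. by split; [exact: orbit_bound_nonempty|exists 0 => t []]. Qed.

(** The infimum in first-order terms, as needed for definability. *)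
Lemma coset_sizeP b c d : d = coset_size b c <->
  (forall t, orbit_bound b c t -> d <= t) /\
  (forall e, 0 < e -> exists t, orbit_bound b c t /\ t < d + e).
Proof.
have [h1 h2] := orbit_bound_has_inf b c; split=> [->|[lb ap]].
  split=> [t bt|e e0]; first exact: ge_inf.
  by have [t bt te] := inf_adherent e0 (orbit_bound_has_inf b c); exists t.
apply/eqP; rewrite eq_le; apply/andP; split; first exact: lb_le_inf.
apply/ler_addgt0Pl => e e0; have [t [bt te]] := ap e e0.
by rewrite addrC; apply: le_trans (ltW te); exact: ge_inf.
Qed.

Lemma coset_size_ge0 b c : 0 <= coset_size b c.
Proof. by apply: lb_le_inf; [exact: orbit_bound_nonempty|move=> t []]. Qed.

Lemma coset_size_stabilizer b h : b \in unitmx -> H h ->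
  coset_size (b *m h) (invmx (b *m h)) = coset_size b (invmx b).
Proof.
move=> ub Hh; have [uh Hhi] := HV Hh; rewrite invmxM//.
congr inf; rewrite predeqE => t; split=> -[t0 [k [k' [kk Hk bk bk']]]]; split=> //.
  exists (h *m k), (k' *m invmx h); split.
  - by rewrite mulmxA -(mulmxA h) kk mulmx1 mulmxV.
  - exact: HM.
  - by rewrite mulmxA.
  - by rewrite -mulmxA.
exists (invmx h *m k), (k' *m h); split.
- by rewrite mulmxA -(mulmxA (invmx h)) kk mulmx1 mulVmx.
- exact: HM.
- by rewrite -mulmxA mulKVmx.
- by rewrite mulmxA mulmxK.
Qed.

(** The same [h] serves both frames: b' h = b h + (b' b^-1 - 1) b h, and similarly for the inverses.
    The factor n comes from bounding the entries of a product. *)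
Lemma coset_size_le b b' e : 0 <= e -> b \in unitmx -> b' \in unitmx ->
  bounded_mx e (b' *m invmx b - 1%:M) -> bounded_mx e (b *m invmx b' - 1%:M) ->
  coset_size b' (invmx b') <= (1 + n%:R * e) * coset_size b (invmx b).
Proof.
move=> e0 ub ub' h1 h2; have c0 : 0 < 1 + n%:R * e by rewrite ltr_pwDl// mulr_ge0.
rewrite mulrC -ler_pdivrMr//; apply: lb_le_inf; first exact: orbit_bound_nonempty.
move=> t [t0 [h [h' [hh Hh bh bh']]]]; rewrite ler_pdivrMr//.
apply: ge_inf; first by exists 0 => ? [].
split; first by rewrite mulr_ge0// ltW.
exists h, h'; split=> //.
  have -> : b' *m h = b *m h + (b' *m invmx b - 1%:M) *m (b *m h).
    by rewrite mulmxBl mul1mx -mulmxA mulKmx// addrC subrK.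
  have := bounded_mxD bh (bounded_mxM e0 t0 h1 bh).
  by rewrite (_ : t + _ = t * (1 + n%:R * e))//; ring.
have -> : h' *m invmx b' = h' *m invmx b + (h' *m invmx b) *m (b *m invmx b' - 1%:M).
  by rewrite mulmxBr mulmx1 mulmxA mulmxKV// addrC subrK.
have := bounded_mxD bh' (bounded_mxM t0 e0 bh' h2).
by rewrite (_ : t + _ = t * (1 + n%:R * e))//; ring.
Qed.

(** The slack 1 avoids having to know that the infimum is attained. *)
Lemma coset_size_bounded_rep b : b \in unitmx -> exists2 h, H h &
  bounded_mx (coset_size b (invmx b) + 1) (b *m h) /\
  bounded_mx (coset_size b (invmx b) + 1) (invmx (b *m h)).
Proof.
move=> ub.
have [t [t0 [h [h' [hh Hh bh bh']]]] lt] := inf_adherent ltr01 (orbit_bound_has_inf b (invmx b)).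
have [uh _] := HV Hh.
have e : h' = invmx h by rewrite -[h'](mulKmx uh) hh mulmx1.
exists h => //; rewrite invmxM// -e; split; apply: bounded_mx_le (ltW lt) _ => //.
Qed.

Lemma definable_bounded_mx (I : finType) (t : (I -> R) -> R) (M : (I -> R) -> 'M[R]_n) :
  polyfun t -> polymx M -> definable (fun z => bounded_mx (t z) (M z)).
Proof.
move=> pt pM.
apply: (definable_ext (P := fun z => forall i j, - t z <= M z i j /\ M z i j <= t z)).
  move=> z; split=> h i j; first by apply/andP; exact: h.
  by apply/andP; exact: h.
apply: definable_forall => i; apply: definable_forall => j.
by apply: definable_and; apply: definable_le => //; exact: polyfunN.
Qed.

Lemma polyfun_qs (I : Type) i (M : (I -> R) -> 'M[R]_n.+1) : (i < size qs)%N ->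
  polymx M -> polyfun (fun z => nth (fun=> 0) qs i (entries (M z))).
Proof.
move=> ilt pM; apply: (polyfun_comp (qs_poly ilt) (h := fun z => entries (M z))) => kl.
exact: pM.
Qed.

Lemma definable_qs (I : finType) (M : (I -> R) -> 'M[R]_n.+1) : polymx M ->
  definable (fun z => forall i, (i < size qs)%N -> nth (fun=> 0) qs i (entries (M z)) = 0).
Proof.
move=> pM.
apply: (definable_ext (P := fun z => forall i : 'I_(size qs),
  nth (fun=> 0) qs i (entries (M z)) = 0)).
  by move=> z; split=> [h i ilt|h i]; [exact: (h (Ordinal ilt))|exact: h].
apply: definable_forall => i.
by apply: definable_eq; [exact: polyfun_qs|exact: polyfun_cst].
Qed.

Lemma definable_orbit_bound (I : finType) (b c : (I -> R) -> 'M[R]_n) (t : (I -> R) -> R) :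
  polymx b -> polymx c -> polyfun t ->
  definable (fun z => orbit_bound (b z) (c z) (t z)).
Proof.
move=> pb pc pt.
apply: definable_and; first by apply: definable_le => //; exact: polyfun_cst.
apply: (definable_ext (P := fun z => exists h h' : 'M[R]_n,
   h *m h' = 1%:M /\
   (forall i, (i < size qs)%N -> nth (fun=> 0) qs i (entries (hat h)) = 0) /\
   bounded_mx (t z) (b z *m h) /\ bounded_mx (t z) (h' *m c z))).
  move=> z; split=> -[h [h' hyp]]; exists h, h'; move: hyp.
    case=> hh [qh [? ?]]; split=> //; apply/HP => //.
    by have /mulmx1_unit[] := hh.
  case=> hh Hh ? ?; split=> //; split=> //; apply/HP => //.
  by have [] := HV Hh.
apply: definable_existsmx; apply: definable_existsmx.
apply: definable_and.
  apply: definable_eqmx; last exact: polymx_cst.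
  by apply: polymxM; apply: polymx_mx => i j; exact: polyfun_var.
apply: definable_and.
  by apply: definable_qs; apply: polymx_hat; apply: polymx_mx => i j; exact: polyfun_var.
apply: definable_and; apply: definable_bounded_mx.
- by apply: (polyfun_comp pt (h := fun z => (z \o inl) \o inl)) => j; exact: polyfun_var.
- apply: polymxM; last by apply: polymx_mx => i j; exact: polyfun_var.
  by apply: (polymx_comp pb (h := fun z => (z \o inl) \o inl)) => j; exact: polyfun_var.
- by apply: (polyfun_comp pt (h := fun z => (z \o inl) \o inl)) => j; exact: polyfun_var.
- apply: polymxM; first by apply: polymx_mx => i j; exact: polyfun_var.
  by apply: (polymx_comp pc (h := fun z => (z \o inl) \o inl)) => j; exact: polyfun_var.
Qed.

Lemma definable_coset_size (I : finType) (b c : (I -> R) -> 'M[R]_n) (d : (I -> R) -> R) :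
  polymx b -> polymx c -> polyfun d ->
  definable (fun z => d z = coset_size (b z) (c z)).
Proof.
move=> pb pc pd; apply: (definable_ext (fun z => iff_sym (coset_sizeP (b z) (c z) (d z)))).
apply: definable_and.
  apply: definable_forallr; apply: definable_imp.
    apply: definable_orbit_bound; last exact: polyfun_var.
      by apply: (polymx_comp pb (h := fun z => z \o inl)) => j; exact: polyfun_var.
    by apply: (polymx_comp pc (h := fun z => z \o inl)) => j; exact: polyfun_var.
  apply: definable_le; last exact: polyfun_var.
  by apply: (polyfun_comp pd (h := fun z => z \o inl)) => j; exact: polyfun_var.
apply: definable_forallr; apply: definable_imp.
  by apply: definable_lt; [exact: polyfun_cst|exact: polyfun_var].
apply: definable_existsr; apply: definable_and.
  apply: definable_orbit_bound; last exact: polyfun_var.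
    by apply: (polymx_comp pb (h := fun z => (z \o inl) \o inl)) => j; exact: polyfun_var.
  by apply: (polymx_comp pc (h := fun z => (z \o inl) \o inl)) => j; exact: polyfun_var.
apply: definable_lt; first exact: polyfun_var.
apply: polyfunD; last exact: polyfun_var.
by apply: (polyfun_comp pd (h := fun z => (z \o inl) \o inl)) => j; exact: polyfun_var.
Qed.

End CosetInvariants.

(** * Continuity of inverses and passage to cluster points *)

Section ContinuousInverse.
Context {R : realType} {X : topologicalType}.

Lemma continuous_polymx (I : Type) m n (f : (I -> R) -> 'M[R]_(m, n)) (h : X -> I -> R) (x : X) i j :
  polymx f -> (forall i, {for x, continuous (h^~ i)}) ->
  {for x, continuous (fun x => f (h x) i j)}.
Proof. by move=> pf ch; apply: (continuous_polyfun (f := fun y => f y i j)). Qed.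

Lemma continuous_invmx n (M : X -> 'M[R]_n) (x : X) i j :
  (forall y, M y \in unitmx) -> (forall i j, {for x, continuous (fun x => M x i j)}) ->
  {for x, continuous (fun x => invmx (M x) i j)}.
Proof.
move=> uM cM.
rewrite (_ : (fun _ => _) = fun y => (\det (M y))^-1 * \adj (M y) i j); last first.
  by apply/funext => y; rewrite /invmx uM mxE.
have cE : forall ij : 'I_n * 'I_n, {for x, continuous (fun y => entries (M y) ij)}.
  by move=> ij; exact: cM.
apply: continuousM.
  apply: continuousV.
    by have := uM x; rewrite unitmxE unitfE.
  rewrite (_ : (fun _ => _) = fun y => \det (of_entries (entries (M y)))).
    apply: (continuous_polyfun (f := fun z => \det (of_entries z)) _ cE).
    by apply: polyfun_det; exact: polymx_of_entries.
  by apply/funext => y; rewrite entriesK.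
rewrite (_ : (fun _ => _) = fun y => \adj (of_entries (entries (M y))) i j).
  apply: (continuous_polymx (f := fun z => \adj (of_entries z)) (h := fun y => entries (M y)) _ cE).
  by apply: polymx_adj; exact: polymx_of_entries.
by apply/funext => y; rewrite entriesK.
Qed.

Lemma continuous_mulmx m n p (A : X -> 'M[R]_(m, n)) (B : X -> 'M[R]_(n, p)) (x : X) i j :
  (forall i j, {for x, continuous (fun x => A x i j)}) ->
  (forall i j, {for x, continuous (fun x => B x i j)}) ->
  {for x, continuous (fun x => (A x *m B x) i j)}.
Proof.
move=> cA cB; rewrite (_ : (fun _ => _) = fun y =>
  (fun z => of_entries (z \o inl) *m of_entries (z \o inr))
    (sumf (entries (A y)) (entries (B y))) i j).
  apply: (continuous_polymx (f := fun z => of_entries (z \o inl) *m of_entries (z \o inr))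
    (h := fun y => sumf (entries (A y)) (entries (B y)))).
    by apply: polymxM; apply: polymx_mx => k l; exact: polyfun_var.
  by case=> -[k l]; [exact: cA|exact: cB].
by apply/funext => y; rewrite (entriesK (A y)) (entriesK (B y)).
Qed.

End ContinuousInverse.

(** The sets [B e] shrink with e and [B 1] is bounded, so they generate a proper filter containing a
    compact box. The filter stands in for a sequence with e tending to 0. *)
Lemma box_cluster {R : realType} N (B : R -> set 'rV[R]_N) (r : R) :
  (forall e, 0 < e -> B e !=set0) ->
  (forall e e' v, e <= e' -> B e v -> B e' v) ->
  (forall v j, B 1 v -> `|v 0 j| <= r) ->
  exists w : 'rV[R]_N, forall A e, nbhs w A -> 0 < e -> (A `&` B e) !=set0.
Proof.
move=> B0 Bmono Br.
pose F := filter_from [set e : R | 0 < e] B.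
have FF : ProperFilter F.
  apply: filter_from_proper => [|e e0]; last exact: B0.
  apply: filter_from_filter; first by exists 1; exact: ltr01.
  move=> e e' /= e0 e'0; exists (Num.min e e'); first by rewrite /= lt_min e0 e'0.
  by move=> v Bv; split; apply: Bmono Bv; rewrite ge_min lexx ?orbT.
have cK : compact [set v : 'rV[R]_N | forall j, `[- r, r]%classic (v 0 j)].
  apply: (@rV_compact R N (fun=> `[- r, r]%classic)) => j.
  exact: segment_compact.
have [|w [_ wF]] := cK F FF.
  by exists 1; [exact: ltr01|move=> v Bv j /=; rewrite in_itv /= -ler_norml; exact: Br].
exists w => A e wA e0; rewrite setIC; apply: wF => //.
by exists e.
Qed.

(** Passage to the limit: a continuous function that tends to 0 along the sets [B e] vanishes at the
    cluster point. *)
Lemma cluster_eq0 {R : realType} N (B : R -> set 'rV[R]_N) (w : 'rV[R]_N) (f : 'rV[R]_N -> R) :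
  (forall A e, nbhs w A -> 0 < e -> (A `&` B e) !=set0) ->
  {for w, continuous f} ->
  (forall e, 0 < e -> exists2 e', 0 < e' & forall v, B e' v -> `|f v| <= e) ->
  f w = 0.
Proof.
move=> wB cf fB; apply/eqP; rewrite -normr_eq0; apply: contraT => fw.
have fw0 : 0 < `|f w| / 2 by rewrite divr_gt0// lt_neqAle eq_sym fw normr_ge0.
have [e' e'0 fe'] := fB _ fw0.
have [||v [/= vw Bv]] := wB [set v | `|f w - f v| < `|f w| / 2] e' _ _ => //.
  by move/cvgrPdist_lt : cf => /(_ _ fw0).
have := fe' v Bv.
have : `|f w| <= `|f w - f v| + `|f v| by rewrite -{1}[f w](subrK (f v)) ler_normD.
by move: vw; set a := `|f w|; set c := `|f v|; set d := `|_ - _|; lra.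
Qed.

(** * The space of orbits of framed data *)

Section FramedOrbitSpace.
Context {R : realType} {n : nat} (G : set 'M[R]_n.+1)
  (qs : seq (('I_n.+1 * 'I_n.+1 -> R) -> R)).
Hypothesis qs_poly : forall i, (i < size qs)%N -> polyfun (nth (fun=> 0) qs i).
Hypothesis G1 : G 1.
Hypothesis GM : forall M N, G M -> G N -> G (M * N).
Hypothesis GV : forall M, G M -> G (invmx M).
Hypothesis Gunit : forall M, G M -> M \in unitmx /\ M *m e0c = e0c.
Hypothesis GP : forall M, M \in unitmx -> M *m e0c = e0c ->
  G M <-> forall i, (i < size qs)%N -> nth (fun=> 0) qs i (entries M) = 0.

(** The space of homomorphisms enters only through its frames and logarithms. By [X_contb],
    [X_contl] and [X_nbhs] its topology is that of the entries of the frame, its inverse and the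
    logarithms. *)
Context {X : topologicalType} (orb : X -> set X)
  (bX : X -> 'M[R]_n) (lX : X -> 'I_n -> 'M[R]_n.+1).
Hypothesis X_data : forall x, frame_data G (bX x) (lX x).
Hypothesis X_surj : forall b l, frame_data G b l -> exists x, bX x = b /\ lX x = l.
Hypothesis X_contb : forall i j, continuous (fun x => bX x i j).
Hypothesis X_contl : forall k i j, continuous (fun x => lX x k i j).
Hypothesis X_nbhs : forall x0 (U : set X), nbhs x0 U -> exists2 e : R, 0 < e &
  forall x, (forall i j, `|bX x i j - bX x0 i j| < e) ->
    (forall i j, `|invmx (bX x) i j - invmx (bX x0) i j| < e) ->
    (forall k i j, `|lX x k i j - lX x0 k i j| < e) -> U x.
Hypothesis X_orb : forall x y, orb x = orb y <->
  exists h, [/\ stabilizer G h, bX y = bX x *m h & lX y = lX x].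

Let bX_unit x : bX x \in unitmx. Proof. by have [] := X_data x. Qed.

Lemma frame_data_stabilizer b l h :
  frame_data G b l -> stabilizer G h -> frame_data G (b *m h) l.
Proof.
move=> [ub nl Gb] Hh; have [uh Hhi] := stabilizerV GV Gunit Hh; split=> //.
  by rewrite unitmx_mul ub.
by move=> i; rewrite conj_frame_comp//; apply: (GM (GM _ _)).
Qed.

Context (k D : nat) (C : 'M[R]_n -> 'M[R]_(k, D)).
Hypothesis C_poly : polymx (C \o @of_entries R n n).
Hypothesis C_free : forall g, g \in unitmx -> row_free (C g).
Hypothesis C_coset : forall g x, g \in unitmx -> x \in unitmx ->
  (C x <= C g)%MS <-> stabilizer G (invmx g *m x).

Let size_of x := coset_size G (bX x) (invmx (bX x)).
Let proj_of x := row_proj (C (bX x)).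

Let I : finType := (('I_D * 'I_D + unit) + 'I_n * ('I_n.+1 * 'I_n.+1))%type.

Let flat (P : 'M[R]_D) (d : R) (l : 'I_n -> 'M[R]_n.+1) : I -> R :=
  sumf (sumf (entries P) (fun=> d)) (fun t => l t.1 t.2.1 t.2.2).

Definition invariants (x : X) : 'rV[R]_#|I| :=
  \row_j flat (proj_of x) (size_of x) (lX x) (enum_val j).

Lemma invariantsE x i : invariants x 0 (enum_rank i) = flat (proj_of x) (size_of x) (lX x) i.
Proof. by rewrite mxE enum_rankK. Qed.

Lemma polymx_C (T : Type) (b : (T -> R) -> 'M[R]_n) : polymx b -> polymx (fun z => C (b z)).
Proof.
move=> pb; rewrite (_ : (fun _ => _) = fun z => (C \o @of_entries R n n) (entries (b z))).
  by apply: (polymx_comp C_poly (h := fun z => entries (b z))) => ij; exact: pb.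
by apply/funext => z /=; rewrite entriesK.
Qed.

Lemma invariants_orb x y : invariants x = invariants y <-> orb x = orb y.
Proof.
split=> [e|/X_orb[h [Hh bE lE]]].
  have fe i : flat (proj_of x) (size_of x) (lX x) i = flat (proj_of y) (size_of y) (lX y) i.
    by rewrite -!invariantsE e.
  apply/X_orb.
  have lE : lX y = lX x.
    apply/funext => i; apply/matrixP => a b.
    by have := fe (inr (i, (a, b))).
  have PE : proj_of x = proj_of y.
    by apply/matrixP => a b; have := fe (inl (inl (a, b))).
  exists (invmx (bX x) *m bX y); split=> //; last by rewrite mulKVmx.
  apply/C_coset => //.
  rewrite -(mul_row_proj (C_free (bX_unit y))) -/(proj_of y) -PE.
  by apply: submx_trans (submxMl _ _) (row_proj_sub _).
have [uh _] := stabilizerV GV Gunit Hh.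
apply/matrixP => i j; rewrite (ord1 i) -[j]enum_valK !invariantsE.
congr flat; rewrite ?lE//.
  apply: row_proj_eq; rewrite ?C_free//; apply/C_coset => //.
  rewrite bE invmxM// -mulmxA mulVmx// mulmx1.
  by have [] := stabilizerV GV Gunit Hh.
by rewrite /size_of bE coset_size_stabilizer.
Qed.

Lemma continuous_proj_of i j : continuous (fun x => proj_of x i j).
Proof.
move=> x.
have cC a b : {for x, continuous (fun x => C (bX x) a b)}.
  rewrite (_ : (fun _ => _) = fun y => (C \o @of_entries R n n) (entries (bX y)) a b).
    apply: (continuous_polymx (f := C \o @of_entries R n n) (h := fun y => entries (bX y))) => //.
    by case=> a' b'; exact: X_contb.
  by apply/funext => y /=; rewrite entriesK.
have cCt a b : {for x, continuous (fun x => (C (bX x))^T a b)}.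
  rewrite (_ : (fun _ => _) = fun y => C (bX y) b a); first exact: cC.
  by apply/funext => y; rewrite mxE.
apply: (continuous_mulmx (A := fun y => (C (bX y))^T *m invmx (C (bX y) *m (C (bX y))^T)) (B := fun y => C (bX y))) => // a b; apply: continuous_mulmx => // a' b'.
apply: continuous_invmx => [y|a'' b'']; first by apply: gram_unit; exact: C_free.
exact: continuous_mulmx.
Qed.

Lemma continuous_size_of : continuous size_of.
Proof.
move=> x; apply/cvgrPdist_lt => e e0.
have s0 : 0 <= size_of x by exact: coset_size_ge0.
(* Both sizes are at most (1 + eta) times the other, hence, as eta <= 1, they differ by at most 2
   eta [size_of x]. The 1 added to the denominator keeps it positive and makes the estimate strict.
   Below, [d] absorbs the factor n of [coset_size_le]; dividing by n + 1 also covers n = 0. *)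
pose eta := Num.min 1 (e / (2 * size_of x + 1)).
have den0 : 0 < 2 * size_of x + 1 by rewrite ltr_wpDl// mulr_ge0.
have eta0 : 0 < eta by rewrite lt_min ltr01 divr_gt0.
have eta1 : eta <= 1 by rewrite ge_min lexx.
have etae : eta * (2 * size_of x + 1) <= e by rewrite -ler_pdivlMr// ge_min lexx orbT.
pose d := eta / n.+1%:R.
have d0 : 0 < d by rewrite divr_gt0.
have dn : n%:R * d <= eta.
  rewrite /d mulrCA; apply: ler_piMr; first exact: ltW.
  by rewrite ler_pdivrMr// mul1r ler_nat.
have near_x (f : X -> 'M[R]_n) : (forall i j, {for x, continuous (fun y => f y i j)}) ->
    f x = 1%:M -> \forall y \near x, bounded_mx d (f y - 1%:M).
  move=> cf fx.
  have : \forall y \near x, forall ij : 'I_n * 'I_n, `|f x ij.1 ij.2 - f y ij.1 ij.2| < d.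
    apply: filter_forall => -[i j].
    by have /cvgrPdist_lt/(_ _ d0) := cf i j.
  apply: filterS => y h; apply/bounded_mx_norm => i j.
  have := h (i, j); rewrite fx distrC /= !mxE => hij.
  by rewrite ltW.
have cinv i j : {for x, continuous (fun y => invmx (bX y) i j)}.
  by apply: continuous_invmx => // a b; exact: X_contb.
have c1 : \forall y \near x, bounded_mx d (bX y *m invmx (bX x) - 1%:M).
  apply: near_x; last by rewrite mulmxV.
  by move=> i j; apply: continuous_mulmx => a b; [exact: X_contb|exact: cst_continuous].
have c2 : \forall y \near x, bounded_mx d (bX x *m invmx (bX y) - 1%:M).
  apply: near_x; last by rewrite mulmxV.
  by move=> i j; apply: continuous_mulmx => a b; [exact: cst_continuous|exact: cinv].
near=> y.
have h1 : bounded_mx d (bX y *m invmx (bX x) - 1%:M) by near: y.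
have h2 : bounded_mx d (bX x *m invmx (bX y) - 1%:M) by near: y.
have le1 := coset_size_le G1 (ltW d0) (bX_unit x) (bX_unit y) h1 h2.
have le2 := coset_size_le G1 (ltW d0) (bX_unit y) (bX_unit x) h2 h1.
move: le1 le2; rewrite -/(size_of x) -/(size_of y) => le1 le2.
have sy0 : 0 <= size_of y by exact: coset_size_ge0.
have {}le1 : size_of y <= (1 + eta) * size_of x.
  by apply: le_trans le1 _; rewrite ler_wpM2r// lerD2l.
have {}le2 : size_of x <= (1 + eta) * size_of y.
  by apply: le_trans le2 _; rewrite ler_wpM2r// lerD2l.
have sy2 : size_of y <= 2 * size_of x.
  by apply: le_trans le1 _; rewrite ler_wpM2r//; lra.
have le3 : eta * size_of y <= 2 * (eta * size_of x).
  by rewrite mulrCA; apply: ler_wpM2l => //; exact: ltW.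
have : 0 <= eta * size_of x by rewrite mulr_ge0// ltW.
rewrite ltr_norml; nra.
Unshelve. all: by end_near.
Qed.

Lemma continuous_invariants : continuous invariants.
Proof.
move=> x; apply: continuous_mx => i j; rewrite (ord1 i).
rewrite (_ : (fun _ => _) = fun y => flat (proj_of y) (size_of y) (lX y) (enum_val j)); last by apply/funext => y; rewrite mxE.
case: (enum_val j) => [[[a b]|[]]|[a [b c]]] /=.
- exact: continuous_proj_of.
- exact: continuous_size_of.
- exact: X_contl.
Qed.

(** Otherwise points outside [U] have invariants arbitrarily close to those of [x0]. Replaced by
    bounded representatives of their orbits, they have a cluster frame, which has the projection of
    [x0] and so is [bX x0 *m h] with [h] in the stabilizer. The corresponding point [x1] lies in the
    orbit of [x0], hence in [U], and is approached by points outside [U]. *)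
Lemma invariants_open x0 (U : set X) : open U ->
  (forall x y, orb x = orb y -> U x -> U y) -> U x0 ->
  exists2 e : R, 0 < e &
    forall x, (forall j, `|invariants x 0 j - invariants x0 0 j| < e) -> U x.
Proof.
move=> oU satU Ux0; apply: contrapT => nU.
pose S0 := \sum_i \sum_j `|proj_of x0 i j|.
have S0_ge0 : 0 <= S0 by apply: sumr_ge0 => i _; exact: sumr_ge0.
have s0 : 0 <= size_of x0 by exact: coset_size_ge0.
(* One unit for the variation of the size and one for the slack of [coset_size_bounded_rep];
   [S0 + 1] bounds the entries of nearby projections. *)
pose r := size_of x0 + 2 + S0.
pose J : finType := ('I_n * 'I_n + ('I_n * 'I_n + 'I_D * 'I_D))%type.
pose vf x : J -> R :=
  sumf (entries (bX x)) (sumf (entries (invmx (bX x))) (entries (proj_of x))).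
pose v x : 'rV[R]_#|J| := \row_j vf x (enum_val j).
pose c (u : 'rV[R]_#|J|) (j : J) := u 0 (enum_rank j).
have cv x : c (v x) = vf x by apply/funext => j; rewrite /c mxE enum_rankK.
pose good e x := [/\ ~ U x, forall j, `|invariants x 0 j - invariants x0 0 j| < e &
   forall j, `|vf x j| <= r].
have good_ex e : 0 < e -> exists x, good e x.
  move=> e0; pose e' := Num.min e 1.
  have e'0 : 0 < e' by rewrite lt_min e0 ltr01.
  have e'e : e' <= e by rewrite ge_min lexx.
  have e'1 : e' <= 1 by rewrite ge_min lexx orbT.
  have [x [nUx xx0]] : exists x, ~ U x /\
      forall j, `|invariants x 0 j - invariants x0 0 j| < e'.
    apply: contrapT => H; apply: nU; exists e' => // x hx.
    by apply: contrapT => nUx; apply: H; exists x.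
  have [h Hh [bh bh']] := coset_size_bounded_rep G1 GV Gunit (bX_unit x).
  have [x' [bx' lx']] := X_surj (frame_data_stabilizer (X_data x) Hh).
  have oxx' : orb x = orb x' by apply/X_orb; exists h.
  have Fxx' : invariants x = invariants x' by apply/invariants_orb.
  exists x'; split.
  - by move=> Ux'; apply: nUx; apply: satU Ux'.
  - by move=> j; rewrite -Fxx'; apply: lt_le_trans (xx0 j) e'e.
  - have sx : size_of x <= size_of x0 + 1.
      have := xx0 (enum_rank (inl (inr tt))); rewrite !invariantsE /= => sxx0.
      have := lt_le_trans sxx0 e'1; rewrite ltr_norml => /andP[]; lra.
    case=> [[i j]|[[i j]|[i j]]] /=; rewrite /entries /=.
    + rewrite bx'; have /bounded_mx_norm/(_ i j) := bh; rewrite -/(size_of x) /r; lra.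
    + rewrite bx'; have /bounded_mx_norm/(_ i j) := bh'; rewrite -/(size_of x) /r; lra.
    + have := xx0 (enum_rank (inl (inl (i, j)))).
      rewrite Fxx' !invariantsE /= /entries /= => pp0.
      have := lt_le_trans pp0 e'1 => {}pp0.
      have : `|proj_of x0 i j| <= S0.
        rewrite /S0 (bigD1 i)//= (bigD1 j)//= -addrA lerDl.
        by apply: addr_ge0; apply: sumr_ge0 => // a _; exact: sumr_ge0.
      have : `|proj_of x' i j| <= `|proj_of x' i j - proj_of x0 i j| + `|proj_of x0 i j|.
        by rewrite -{1}[proj_of x' i j](subrK (proj_of x0 i j)) ler_normD.
      by rewrite /r; lra.
pose B e : set 'rV[R]_#|J| := [set u | exists2 x, good e x & u = v x].
have [|||w wB] := @box_cluster R #|J| B r.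
- by move=> e /good_ex[x gx]; exists (v x), x.
- move=> e e' _ ee' [x [nUx xx0 vx] ->]; exists x => //; split=> // j.
  exact: lt_le_trans (xx0 j) ee'.
- by move=> _ j [x [_ _ vx] ->]; rewrite mxE.
have c_cont f : polyfun f -> {for w, continuous (fun u => f (c u))}.
  move=> pf; apply: continuous_polyfun => // j.
  exact: coord_continuous.
have poly_eq0 f : polyfun f -> (forall x, f (vf x) = 0) -> f (c w) = 0.
  move=> pf f0; apply: (cluster_eq0 wB (c_cont f pf)) => e e0.
  by exists 1 => // _ [x _ ->]; rewrite cv f0 normr0 ltW.
pose wb : 'M[R]_n := of_entries (c w \o inl).
pose wc : 'M[R]_n := of_entries (c w \o inr \o inl).
pose wP : 'M[R]_D := of_entries (c w \o inr \o inr).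
have pb : polymx (fun z : J -> R => of_entries (z \o inl) : 'M[R]_n).
  by apply: polymx_mx => i j; exact: polyfun_var.
have pc : polymx (fun z : J -> R => of_entries (z \o inr \o inl) : 'M[R]_n).
  by apply: polymx_mx => i j; exact: polyfun_var.
have pP : polymx (fun z : J -> R => of_entries (z \o inr \o inr) : 'M[R]_D).
  by apply: polymx_mx => i j; exact: polyfun_var.
(* The inverse is part of the vector [v x], so its limit inverts the limit frame. *)
have wbc : wb *m wc = 1%:M.
  apply/eqP; rewrite -subr_eq0; apply/eqP/matrixP => i j; rewrite [RHS]mxE.
  apply: (poly_eq0 (fun z => (of_entries (z \o inl) *m of_entries (z \o inr \o inl) - 1%:M) i j)).
    by move: i j; apply: polymxB; [exact: polymxM|exact: polymx_cst].
  by move=> x; rewrite (entriesK (bX x)) (entriesK (invmx (bX x))) mulmxV// subrr mxE.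
have wP0 : wP = proj_of x0.
  apply/matrixP => i j; apply/eqP; rewrite -subr_eq0; apply/eqP.
  pose f (z : J -> R) := (of_entries (z \o inr \o inr) : 'M[R]_D) i j - proj_of x0 i j.
  have pf : polyfun f by apply: polyfunB; [exact: pP|exact: polyfun_cst].
  apply: (cluster_eq0 wB (c_cont f pf)) => e e0; exists e => // _ [x [_ xx0 _] ->].
  rewrite cv /f (entriesK (proj_of x)).
  by have := xx0 (enum_rank (inl (inl (i, j)))); rewrite !invariantsE => /ltW.
(* This polynomial identity holds for every frame. With [wP] the projection of [x0], it puts the
   rows of [C wb] in the row space of [C (bX x0)], which is the coset criterion. *)
have wCP : C wb *m wP = C wb.
  apply/eqP; rewrite -subr_eq0; apply/eqP/matrixP => i j; rewrite [RHS]mxE.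
  apply: (poly_eq0 (fun z => (C (of_entries (z \o inl)) *m of_entries (z \o inr \o inr)
      - C (of_entries (z \o inl))) i j)).
    by move: i j; apply: polymxB; [apply: polymxM => //|]; exact: polymx_C.
  move=> x; rewrite (entriesK (bX x)) (entriesK (proj_of x)).
  by rewrite mul_row_proj ?C_free// subrr mxE.
have [ub uc] := mulmx1_unit wbc.
have wcE : wc = invmx wb by rewrite -[wc](mulKmx ub) wbc mulmx1.
pose h := invmx (bX x0) *m wb.
have Hh : stabilizer G h.
  apply/C_coset => //; rewrite -wCP wP0.
  exact: submx_trans (submxMl _ _) (row_proj_sub _).
have bh : wb = bX x0 *m h by rewrite mulKVmx.
have [x1 [bx1 lx1]] := X_surj (frame_data_stabilizer (X_data x0) Hh).
have Ux1 : U x1 by apply: satU Ux0; apply/X_orb; exists h.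
have [e e0 eU] := X_nbhs (open_nbhs_nbhs (conj oU Ux1)).
have [u [/= wu [x [nUx xx0 _] uE]]] := wB _ e (near_mx w e0) e0.
apply: nUx; apply: eU => [i j|i j|a i j].
- have := wu 0 (enum_rank (inl (i, j))); rewrite uE -/(c (v x) (inl (i, j))) cv /=.
  by rewrite bx1 -bh /wb mxE.
- have := wu 0 (enum_rank (inr (inl (i, j)))); rewrite uE.
  by rewrite -/(c (v x) (inr (inl (i, j)))) cv /= bx1 -bh -wcE /wc mxE.
- have := xx0 (enum_rank (inr (a, (i, j)))); rewrite !invariantsE /=.
  by rewrite lx1.
Qed.

(** The inverse [c] of the frame and the inverse [Y] of the Gram matrix are quantified, so every
    condition but the last is polynomial; the last one is definable by [definable_coset_size]. *)
Definition invariant_locus (z : I -> R) : Prop :=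
  exists b c : 'M[R]_n, exists Y : 'M[R]_k,
  let P := of_entries (fun t => z (inl (inl t))) in
  let d := z (inl (inr tt)) in
  let l i := of_entries (fun t => z (inr (i, t))) in
  b *m c = 1%:M /\ normal_logs l /\
  (forall i j, (j < size qs)%N ->
     nth (fun=> 0) qs j (entries (hat c *m mexp (l i) *m hat b)) = 0) /\
  C b *m (C b)^T *m Y = 1%:M /\ P = (C b)^T *m Y *m C b /\
  d = coset_size G b c.

Lemma range_invariants : range invariants =
  [set y : 'rV[R]_#|I| | invariant_locus (fun i => y 0 (enum_rank i))].
Proof.
rewrite predeqE => y; split.
  case=> x _ <- /=; exists (bX x), (invmx (bX x)), (invmx (C (bX x) *m (C (bX x))^T)).
  have zE : (fun i => invariants x 0 (enum_rank i)) =
      flat (proj_of x) (size_of x) (lX x).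
    by apply/funext => i; rewrite invariantsE.
  have lE i : of_entries (fun t => invariants x 0 (enum_rank (inr (i, t)))) = lX x i.
    by apply/matrixP => a b; rewrite mxE invariantsE.
  have PE : of_entries (fun t => invariants x 0 (enum_rank (inl (inl t)))) = proj_of x.
    by apply/matrixP => a b; rewrite mxE invariantsE.
  have [ub nl Gb] := X_data x.
  rewrite /= PE invariantsE /=.
  have -> : (fun i => of_entries (fun t => invariants x 0 (enum_rank (inr (i, t))))) = lX x.
    by apply/funext => i; exact: lE.
  split; first by rewrite mulmxV.
  split=> //; split.
    move=> i j jlt; rewrite lE.
    have Gi := Gb i; have [ui ki] := Gunit Gi.
    by have /GP := Gi; apply.
  by split=> //; rewrite mulmxV// gram_unit// C_free.
case=> b [c [Y]] /= [bc [nl [ql [CY [PE dE]]]]].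
have [ub uc] := mulmx1_unit bc.
have cE : c = invmx b by rewrite -[c](mulKmx ub) bc mulmx1.
set l := (fun i => of_entries _) in nl ql.
have bl : frame_data G b l.
  have [cl nnl kl _] := nl.
  split=> // i; apply/GP.
  - rewrite /conj_frame -!mulmxE !unitmx_mul !hat_unitmx unitmx_inv ub andbT /=.
    by have := mexp_lincomb_unit cl nnl (fun j => (i == j)%:R); rewrite lincomb_delta.
  - by apply: conj_frame_e0c; exact: mexp_ker.
  - by move=> j jlt; have := ql i j jlt; rewrite cE.
have [x [bx lx]] := X_surj bl.
have YE : Y = invmx (C b *m (C b)^T).
  by rewrite -[Y](mulKmx (gram_unit (C_free ub))) CY mulmx1.
exists x => //; apply/matrixP => i j; rewrite (ord1 i) -[j]enum_valK invariantsE.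
case: (enum_val j) => [[[a a']|[]]|[a [a' a'']]] /=.
- by rewrite /proj_of bx /row_proj -YE -PE /entries mxE.
- by rewrite /size_of bx -cE -dE.
- by rewrite lx /l mxE.
Qed.

Lemma definable_invariant_locus : definable invariant_locus.
Proof.
apply: definable_existsmx; apply: definable_existsmx; apply: definable_existsmx.
set J := ((_ + _) + _ + _)%type.
pose b (z : J -> R) : 'M[R]_n := \matrix_(i, j) (z \o inl \o inl) (inr (i, j)).
pose c (z : J -> R) : 'M[R]_n := \matrix_(i, j) (z \o inl) (inr (i, j)).
pose Y (z : J -> R) : 'M[R]_k := \matrix_(i, j) z (inr (i, j)).
pose P (z : J -> R) : 'M[R]_D := of_entries (fun t => z (inl (inl (inl (inl (inl t)))))).
pose d (z : J -> R) := z (inl (inl (inl (inl (inr tt))))).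
pose l (z : J -> R) i : 'M[R]_n.+1 := of_entries (fun t => z (inl (inl (inl (inr (i, t)))))).
have pb : polymx b by apply: polymx_mx => i j; exact: polyfun_var.
have pc : polymx c by apply: polymx_mx => i j; exact: polyfun_var.
have pY : polymx Y by apply: polymx_mx => i j; exact: polyfun_var.
have pP : polymx P by apply: polymx_mx => i j; exact: polyfun_var.
have pl i : polymx (l^~ i) by apply: polymx_mx => a a'; exact: polyfun_var.
have pC := polymx_C pb.
apply: (definable_and (P := fun z => b z *m c z = 1%:M)).
  by apply: definable_eqmx; [exact: polymxM|exact: polymx_cst].
apply: (definable_and (P := fun z => normal_logs (l z))); first exact: definable_normal_logs.
apply: definable_and.
  apply: definable_forall => i.
  apply: (@definable_qs R n qs qs_poly _ (fun z => hat (c z) *m mexp (l z i) *m hat (b z))).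
  by apply: polymxM; [apply: polymxM; [exact: polymx_hat|exact: polymx_mexp]|exact: polymx_hat].
apply: (definable_and (P := fun z => C (b z) *m (C (b z))^T *m Y z = 1%:M)).
  by apply: definable_eqmx; [apply: polymxM => //; apply: polymxM => //; exact: polymx_tr|exact: polymx_cst].
apply: (definable_and (P := fun z => P z = (C (b z))^T *m Y z *m C (b z))).
  by apply: definable_eqmx => //; apply: polymxM => //; apply: polymxM => //; exact: polymx_tr.
apply: (definable_coset_size qs_poly G1 GV Gunit GP pb pc).
exact: (polyfun_var (inl (inl (inl (inl (inr tt)))))).
Qed.

Lemma framed_orbit_space_semi_algebraic : exists (N : nat) (S : set 'rV[R]_N),
  semi_algebraic S /\ homeomorphic (orbit_space orb) S.
Proof.
exists #|I|, (range invariants); split.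
  rewrite range_invariants; exact: definable_semi_algebraic definable_invariant_locus.
apply: orbit_space_homeo.
- exact: continuous_invariants.
- exact: invariants_orb.
- exact: invariants_open.
Qed.

End FramedOrbitSpace.

(** * Affine maps as matrices *)

Section AffineMapMatrix.
Context {R : realType} {V : vectType R}.
Local Notation n := (\dim {:V}).
Local Notation e := (vbasis {:V}).
Let eb : basis_of {:V} e := vbasisP _.

(** Coordinates are rows and linear maps act on them from the right, so [amx] reverses products. *)
Definition amx (g : affine_map V) : 'M[R]_n.+1 :=
  block_mx (1 : 'M[R]_1) (coordinates g.1) 0 (mxof e e g.2).

Definition translation_part (M : 'M[R]_n.+1) : 'rV[R]_n := \row_j M 0 (lift 0 j).

Definition ofamx (M : 'M[R]_n.+1) : affine_map V :=
  (vecof e (translation_part M), hommx e e (linear_part M)).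

Lemma amx00 g : amx g 0 0 = 1.
Proof.
have h := @block_mxEul R 1 n 1 n 1 (coordinates g.1) 0 (mxof e e g.2) 0 0.
rewrite [X in _ = X]mxE eqxx in h.
by apply: etrans h; congr (amx g _ _); exact: val_inj.
Qed.

Lemma amx0l g j : amx g 0 (lift 0 j) = coordinates g.1 0 j.
Proof.
have h := @block_mxEur R 1 n 1 n 1 (coordinates g.1) 0 (mxof e e g.2) 0 j.
by apply: etrans h; congr (amx g _ _); exact: val_inj.
Qed.

Lemma amxl0 g i : amx g (lift 0 i) 0 = 0.
Proof.
have h := @block_mxEdl R 1 n 1 n 1 (coordinates g.1) 0 (mxof e e g.2) i 0.
rewrite [X in _ = X]mxE in h.
by apply: etrans h; congr (amx g _ _); exact: val_inj.
Qed.

Lemma amxll g i j : amx g (lift 0 i) (lift 0 j) = mxof e e g.2 i j.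
Proof.
have h := @block_mxEdr R 1 n 1 n 1 (coordinates g.1) 0 (mxof e e g.2) i j.
by apply: etrans h; congr (amx g _ _); exact: val_inj.
Qed.

Lemma amx_e0c g : amx g *m e0c = e0c.
Proof.
apply/matrixP => i j; rewrite -colE mxE [RHS]mxE (ord1 j) eqxx andbT.
by case: (unliftP 0 i) => [k|] ->; rewrite ?amxl0 ?amx00.
Qed.

Lemma amxK : cancel amx ofamx.
Proof.
move=> [b L]; rewrite /ofamx; congr pair.
  rewrite -[RHS](rVofK eb); congr vecof; apply/rowP => j.
  by rewrite mxE amx0l.
rewrite -[RHS](mxofK eb eb); congr hommx; apply/matrixP => i j.
by rewrite mxE amxll.
Qed.

Lemma ofamxK M : M *m e0c = e0c -> amx (ofamx M) = M.
Proof.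
move=> Mc; apply/matrixP => i j.
have Mi0 k : M k 0 = (k == 0)%:R.
  by have /matrixP/(_ k 0) := Mc; rewrite -colE mxE [RHS]mxE eqxx andbT.
case: (unliftP 0 i) => [i'|] ->; case: (unliftP 0 j) => [j'|] ->.
- by rewrite amxll /= hommxK// mxE.
- by rewrite amxl0 Mi0.
- by rewrite amx0l /coordinates /= vecofK// mxE.
- by rewrite amx00 Mi0 eqxx.
Qed.

Lemma amxM g h : amx (aff_mul g h) = amx h * amx g.
Proof.
have := @mulmx_block R 1 n 1 n 1 n 1 (coordinates h.1) 0 (mxof e e h.2)
  1 (coordinates g.1) 0 (mxof e e g.2).
rewrite !mulmx0 !mul0mx !mul1mx !addr0 !add0r => H.
rewrite -[RHS]/(_ *m _) /amx H /aff_mul /=.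
rewrite (mxof_comp _ _ eb).
suff -> : coordinates (g.2 h.1 + g.1) = coordinates g.1 + coordinates h.1 *m mxof e e g.2 by [].
by rewrite /coordinates linearD /= (rVof_app _ eb)// addrC.
Qed.

Lemma amx1 : amx (aff_one V) = 1.
Proof.
rewrite /amx /aff_one /= mxof1 ?(basis_free eb)// /coordinates linear0.
by rewrite -scalar_mx_block.
Qed.

Definition point_row (x : V) : 'rV[R]_n.+1 := row_mx (1 : 'M[R]_1) (coordinates x).
Definition row_point (r : 'rV[R]_n.+1) : V := vecof e (\row_j r 0 (lift 0 j)).

Lemma point_row0 x : point_row x 0 0 = 1.
Proof.
have h := @row_mxEl R 1 1 n 1 (coordinates x) 0 0.
rewrite [X in _ = X]mxE eqxx in h.
by apply: etrans h; congr (point_row x _ _); exact: val_inj.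
Qed.

Lemma point_rowl x j : point_row x 0 (lift 0 j) = coordinates x 0 j.
Proof.
have h := @row_mxEr R 1 1 n 1 (coordinates x) 0 j.
by apply: etrans h; congr (point_row x _ _); exact: val_inj.
Qed.

Lemma point_row_e0c x : point_row x *m e0c = 1.
Proof. by apply/matrixP => i j; rewrite -colE !ord1 mxE point_row0 mxE. Qed.

Lemma point_rowK : cancel point_row row_point.
Proof.
move=> x; rewrite /row_point -[RHS](rVofK eb); congr vecof; apply/rowP => j.
by rewrite mxE point_rowl.
Qed.

Lemma row_pointK r : r *m e0c = 1 -> point_row (row_point r) = r.
Proof.
move=> /matrixP/(_ 0 0); rewrite -colE mxE [RHS]mxE => r0.
apply/matrixP => i j; rewrite (ord1 i).
case: (unliftP 0 j) => [j'|] ->; last by rewrite point_row0 r0.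
by rewrite point_rowl /coordinates vecofK// mxE.
Qed.

Lemma point_row_act g x : point_row (aff_act g x) = point_row x *m amx g.
Proof.
have := @mul_row_block R 1 1 n 1 n 1 (coordinates x) 1 (coordinates g.1) 0 (mxof e e g.2).
rewrite mulmx1 mulmx0 mul1mx addr0 => H.
rewrite /point_row /amx H.
suff -> : coordinates (aff_act g x) = coordinates g.1 + coordinates x *m mxof e e g.2 by [].
by rewrite /aff_act /coordinates linearD /= (rVof_app _ eb)// addrC.
Qed.

Lemma amx_inj : injective amx.
Proof. exact: can_inj amxK. Qed.

Lemma aff_mulV g : Aff g -> aff_mul g (aff_inv g) = aff_one V.
Proof.
move=> /lker0_compfV gV; rewrite /aff_mul /aff_inv /aff_one /= gV linearN /=.
congr pair; rewrite -[g.2 _](comp_lfunE g.2 (g.2^-1)%VF g.1) gV id_lfunE.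
by rewrite addrC subrr.
Qed.

Lemma amx_unit g : Aff g -> amx g \in unitmx /\ amx (aff_inv g) = invmx (amx g).
Proof.
move=> gA; have h : amx (aff_inv g) *m amx g = 1.
  by rewrite mulmxE -amxM aff_mulV// amx1.
have [u1 u2] := mulmx1_unit h; split=> //.
by rewrite -[LHS](mulmxK u2) h mul1mx.
Qed.

Lemma unit_Aff M : M \in unitmx -> M *m e0c = e0c -> Aff (ofamx M).
Proof.
move=> uM Mc; rewrite /Aff /=; apply/eqP/vspaceP => u.
rewrite memv_ker memv0; apply/eqP/eqP => [Mu|->]; last by rewrite linear0.
suff : point_row u = point_row 0.
  by move=> /(can_inj point_rowK).
have uA : amx (ofamx M) \in unitmx by rewrite ofamxK.
apply: (can_inj (mulmxK uA)); rewrite -!point_row_act /aff_act /=.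
by rewrite Mu linear0.
Qed.

Lemma additive_scalable_polyfun (m p : nat) (L : 'M[R]_(m, p) -> R) :
  (forall a A B, L (a *: A + B) = a * L A + L B) ->
  polyfun (L \o @of_entries R m p).
Proof.
move=> lin.
have L0 : L 0 = 0.
  have := lin 0 0 0; rewrite scaler0 mul0r !add0r => //.
  by move=> _; have := lin (-1) 0 0; rewrite scaler0 addr0 mulN1r addNr.
have Ls (T : Type) (r : seq T) (F : T -> 'M[R]_(m, p)) :
    L (\sum_(i <- r) F i) = \sum_(i <- r) L (F i).
  elim: r => [|i r IH]; first by rewrite !big_nil.
  by rewrite !big_cons -{1}[F i]scale1r lin mul1r IH.
rewrite (_ : _ \o _ = fun y => \sum_i \sum_j y (i, j) * L (delta_mx i j)).
  by apply: polyfun_sum => i; apply: polyfun_sum => j; apply: polyfunM;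
    [exact: polyfun_var|exact: polyfun_cst].
apply/funext => y /=; rewrite {1}[of_entries y]matrix_sum_delta Ls.
apply: eq_bigr => i _; rewrite Ls; apply: eq_bigr => j _.
by rewrite -[_ *: _]addr0 lin L0 addr0 mxE.
Qed.

Lemma polyfun_coordinates_ofamx j :
  polyfun ((fun M => coordinates (ofamx M) 0 j) \o @of_entries R n.+1 n.+1).
Proof.
apply: additive_scalable_polyfun => a A B.
have -> : ofamx (a *: A + B) = a *: ofamx A + ofamx B.
  have tP : translation_part (a *: A + B) = a *: translation_part A + translation_part B.
    by apply/rowP => i; rewrite !mxE.
  have lP : linear_part (a *: A + B) = a *: linear_part A + linear_part B.
    by apply/matrixP => i k; rewrite !mxE.
  by rewrite /ofamx tP lP !linearP.
by rewrite /coordinates linearP !mxE.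
Qed.

(** The constant corner entry makes [amx] affine and not linear; [amx 0] is subtracted to make it
    linear. *)
Lemma amx_linear i j a (g h : affine_map V) :
  amx (a *: g + h) i j - amx 0 i j =
  a * (amx g i j - amx 0 i j) + (amx h i j - amx 0 i j).
Proof.
have mx0 i' j' : mxof e e (0 : 'End(V)) i' j' = 0 by rewrite linear0 mxE.
have c0 i' : coordinates (0 : V) 0 i' = 0 by rewrite /coordinates linear0 mxE.
have mxP i' j' : mxof e e (a *: g.2 + h.2) i' j' = a * mxof e e g.2 i' j' + mxof e e h.2 i' j'.
  by rewrite linearP mxE mxE.
have cP i' : coordinates (a *: g.1 + h.1) 0 i' = a * coordinates g.1 0 i' + coordinates h.1 0 i'.
  by rewrite /coordinates linearP mxE mxE.
case: (unliftP 0 i) => [i'|] ->; case: (unliftP 0 j) => [j'|] ->.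
- rewrite !amxll -[(a *: g + h).2]/(a *: g.2 + h.2) mxP.
  by rewrite -[(0 : affine_map V).2]/(0 : 'End(V)) mx0 !subr0.
- by rewrite !amxl0 subr0 mulr0 addr0.
- rewrite !amx0l -[(a *: g + h).1]/(a *: g.1 + h.1) cP.
  by rewrite -[(0 : affine_map V).1]/(0 : V) c0 !subr0.
- by rewrite !amx00 subrr mulr0 addr0.
Qed.

Lemma polyfun_amx i j :
  exists2 f : ('I_(\dim {:affine_map V}) -> R) -> R, polyfun f &
    forall g, amx g i j = f (coordinates g 0).
Proof.
pose E := vbasis {: affine_map V}.
have Eb : basis_of {: affine_map V} E := vbasisP _.
pose L (r : 'rV[R]_(\dim {: affine_map V})) := amx (vecof E r) i j - amx 0 i j.
have linL a A B : L (a *: A + B) = a * L A + L B.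
  by rewrite /L -amx_linear; congr (amx _ i j - _); exact: linearP.
have pL := additive_scalable_polyfun linL.
exists (fun r => amx 0 i j + L (\row_k r k)).
  apply: polyfunD; first exact: polyfun_cst.
  rewrite (_ : (fun _ => _) = (L \o @of_entries R 1 _) \o (fun r (ij : 'I_1 * _) => r ij.2)).
    by apply: polyfun_comp pL _ => ij; exact: polyfun_var.
  by apply/funext => r /=; congr L; apply/rowP => k; rewrite !mxE.
move=> g; rewrite /L addrC subrK; congr (amx _ i j).
rewrite -[LHS](rVofK Eb); congr vecof.
by apply/rowP => k; rewrite [RHS]mxE.
Qed.

End AffineMapMatrix.

(** * Framed data of a homomorphism *)

Section FrameOfHomomorphism.
Context {R : realType} {n : nat}.
Implicit Types (b : 'M[R]_n) (M N : 'M[R]_n.+1) (l : 'I_n -> 'M[R]_n.+1)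
  (g : 'rV[int]_n -> 'M[R]_n.+1).

Lemma conj_frameD b M N : conj_frame b (M + N) = conj_frame b M + conj_frame b N.
Proof. by rewrite /conj_frame mulrDr mulrDl. Qed.

Lemma conj_frameZ b a M : conj_frame b (a *: M) = a *: conj_frame b M.
Proof. by rewrite /conj_frame -scalerAr -scalerAl. Qed.

Lemma conj_frame0 b : conj_frame b 0 = 0.
Proof. by rewrite /conj_frame mulr0 mul0r. Qed.

Lemma conj_frame_horner b M (p : {poly R}) : b \in unitmx ->
  horner_mx (conj_frame b M) p = conj_frame b (horner_mx M p).
Proof.
move=> ub; elim/poly_ind: p => [|p c IH]; first by rewrite !rmorph0 conj_frame0.
rewrite !rmorphD !rmorphM /= !horner_mx_X !horner_mx_C IH conj_frameD conj_frameM//.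
by congr (_ + _); rewrite -scalemx1 conj_frameZ conj_frame1.
Qed.

Lemma conj_frame_mexp b M : b \in unitmx -> mexp (conj_frame b M) = conj_frame b (mexp M).
Proof. exact: conj_frame_horner. Qed.

Lemma conj_frame_mlog b M : b \in unitmx -> mlog1p (conj_frame b M) = conj_frame b (mlog1p M).
Proof. exact: conj_frame_horner. Qed.

Lemma conj_frame_nilp b M : b \in unitmx -> nilpotent_mx M -> nilpotent_mx (conj_frame b M).
Proof.
move=> ub nM; have := conj_frame_horner M 'X^(n.+1) ub.
by rewrite !rmorphXn /= !horner_mx_X nM conj_frame0.
Qed.

Lemma conj_frameK b M : b \in unitmx -> conj_frame (invmx b) (conj_frame b M) = M.
Proof.
move=> ub; rewrite -conj_frame_comp ?unitmx_inv// mulmxV//.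
by rewrite /conj_frame invmx1 hat1 mul1r mulr1.
Qed.

Lemma conj_frameVK b M : b \in unitmx -> conj_frame b (conj_frame (invmx b) M) = M.
Proof.
move=> ub; rewrite -conj_frame_comp ?unitmx_inv// mulVmx//.
by rewrite /conj_frame invmx1 hat1 mul1r mulr1.
Qed.

Definition intr_row (k : 'rV[int]_n) (i : 'I_n) : R := (k 0 i)%:~R.

Lemma intr_rowD k k' : intr_row (k + k') = fun i => intr_row k i + intr_row k' i.
Proof. by apply/funext => i; rewrite /intr_row mxE intrD. Qed.

Lemma intr_row0 : intr_row 0 = fun=> 0.
Proof. by apply/funext => i; rewrite /intr_row mxE. Qed.

Lemma intr_row_delta i : intr_row (delta_mx 0 i) = fun j => (i == j)%:R.
Proof. by apply/funext => j; rewrite /intr_row mxE eqxx /= eq_sym; case: (_ == _). Qed.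

Lemma intr_row_inj : injective intr_row.
Proof.
move=> k k' e; apply/rowP => i; apply/eqP; rewrite -(eqr_int R); apply/eqP.
exact: (congr1 (fun f => f i) e).
Qed.

Definition normal_log g (i : 'I_n) : 'M[R]_n.+1 :=
  conj_frame (invmx (frame g)) (generator_log g i).

Section Representation.
Context g (b : 'M[R]_n) (l : 'I_n -> 'M[R]_n.+1).
Hypothesis ub : b \in unitmx.
Hypothesis nl : normal_logs l.
Hypothesis gE : forall k, g k = conj_frame b (mexp (lincomb l (intr_row k))).

Lemma generator_logE i : generator_log g i = conj_frame b (l i).
Proof.
have [_ nnl _ _] := nl.
rewrite /generator_log gE intr_row_delta lincomb_delta.
have -> : conj_frame b (mexp (l i)) - 1 = conj_frame b (mexp (l i) - 1).
  by rewrite -scaleN1r conj_frameD conj_frameZ conj_frame1// scaleN1r.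
by rewrite conj_frame_mlog// mlog_exp.
Qed.

(** [hat (invmx b)] fixes the origin and [l i] sends it to the i-th standard row, which [hat b]
    sends to row i of [b]. The framed data are thus determined by the homomorphism. *)
Lemma frameE : frame g = b.
Proof.
have [_ _ _ nrm] := nl.
apply/matrixP => i j; rewrite mxE generator_logE.
have -> : conj_frame b (l i) 0 (lift 0 j) = (e0r *m conj_frame b (l i)) 0 (lift 0 j).
  by rewrite -rowE [RHS]mxE.
by rewrite /conj_frame -!mulmxE !mulmxA e0r_hat nrm -rowE mxE hatll.
Qed.

Lemma normal_logE : normal_log g = l.
Proof. by apply/funext => i; rewrite /normal_log frameE generator_logE conj_frameK. Qed.

End Representation.

Section Unipotent.
Context g.
Hypothesis gD : forall k k', g (k + k') = g k * g k'.
Hypothesis g0 : g 0 = 1.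
Hypothesis gk : forall k, g k *m e0c = e0c.
Hypothesis gu : forall i, nilpotent_mx (g (delta_mx 0 i) - 1).
Hypothesis fu : frame g \in unitmx.

Lemma normal_log_normal : normal_logs (normal_log g).
Proof.
have cT i j : GRing.comm (g (delta_mx 0 i) - 1) (g (delta_mx 0 j) - 1).
  apply/commr_sym/commrB; last exact: commr1.
  apply/commr_sym/commrB; last exact: commr1.
  by rewrite /GRing.comm -!gD addrC.
have kg i : generator_log g i *m e0c = 0.
  by apply: mlog_ker; rewrite mulmxBl gk mul1mx subrr.
split=> [i j|i|i|i].
- rewrite /GRing.comm /normal_log -!conj_frameM ?unitmx_inv//; congr conj_frame.
  by apply: comm_horner_mxr; apply/commr_sym/comm_horner_mxr.
- by apply: conj_frame_nilp; rewrite ?unitmx_inv//; exact: nilpotent_mx_log.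
- by rewrite /normal_log /conj_frame -!mulmxE -!mulmxA hat_e0c kg mulmx0.
- rewrite /normal_log /conj_frame invmxK -!mulmxE !mulmxA e0r_hat.
  (* The logarithm at the origin is row i of the frame, so the conjugation makes it the i-th
     standard row. *)
  have -> : e0r *m generator_log g i = delta_mx 0 (lift 0 i) *m hat (frame g).
    apply/rowP => j; rewrite -!rowE [LHS]mxE [RHS]mxE.
    case: (unliftP 0 j) => [j'|] ->; first by rewrite hatll mxE.
    rewrite hatl0; have /matrixP/(_ 0 0) := kg i.
    by rewrite -colE [LHS]mxE [RHS]mxE.
  by rewrite -mulmxA mulmxE hat_unit// mulmx1.
Qed.

Lemma normal_log_repr k :
  g k = conj_frame (frame g) (mexp (lincomb (normal_log g) (intr_row k))).
Proof.
have [cl nl kl _] := normal_log_normal.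
have rD s t := mexp_lincombD cl nl s t.
elim/int_row_ind: k => [|k k' IH IH'|k IH|i].
- by rewrite g0 intr_row0 lincomb0 mexp0 conj_frame1.
- by rewrite gD IH IH' intr_rowD rD conj_frameM.
- have h1 : g (- k) * g k = 1 by rewrite -gD addNr.
  have h2 : g k * conj_frame (frame g) (mexp (lincomb (normal_log g) (intr_row (- k)))) = 1.
    rewrite IH -conj_frameM// -rD -[X in lincomb _ X]intr_rowD subrr.
    by rewrite intr_row0 lincomb0 mexp0 conj_frame1.
  by rewrite -[LHS]mulr1 -h2 mulrA h1 mul1r.
- rewrite intr_row_delta lincomb_delta -conj_frame_mexp// conj_frameVK//.
  by rewrite mexp_log// addrC subrK.
Qed.

End Unipotent.
End FrameOfHomomorphism.

(** * The deformation space *)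

Section CrystallographicHoms.
Context {R : realType} {V : vectType R} (A : set (affine_map V)).
Hypothesis subA : aff_subgroup A.
Hypothesis closedA : zariski_closed A.
Local Notation n := (\dim {:V}).
Local Notation e := (vbasis {:V}).
Local Notation Zn := 'rV[int]_n.
Local Notation X := (@crystallographic_homs R V Zn A).
Local Notation maps := (@affine_maps_pow R V Zn).

Lemma finite_bounded_int_rows m (N : nat) :
  finite_set [set k : 'rV[int]_m | forall i, (`|k 0%R i| <= N)%N].
Proof.
pose phi (f : {ffun 'I_m -> 'I_(N + N).+1}) : 'rV[int]_m :=
  \row_i ((f i : nat)%:Z - N%:Z).
apply: sub_finite_set (finite_image phi (@finite_finset _ [set: _])) => k kN.
exists [ffun i => inord (absz (k 0 i + N%:Z)%R)] => //.
apply/rowP => i; rewrite mxE ffunE inordK; have := kN i; lia.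
Qed.

Definition matrix_group (M : 'M[R]_n.+1) : Prop := M *m e0c = e0c /\ A (ofamx M).

Lemma matrix_group_amx g : A g -> matrix_group (amx g).
Proof. by move=> Ag; split; [exact: amx_e0c|rewrite amxK]. Qed.

Lemma matrix_group1 : matrix_group 1.
Proof. by rewrite -(@amx1 R V); apply: matrix_group_amx; case: subA. Qed.

Lemma matrix_groupM M N : matrix_group M -> matrix_group N -> matrix_group (M * N).
Proof.
move=> [Mc AM] [Nc AN]; have [_ _ mulA _] := subA.
by rewrite -(ofamxK Mc) -(ofamxK Nc) -amxM; apply: matrix_group_amx; exact: mulA.
Qed.

Lemma matrix_group_unit M : matrix_group M -> M \in unitmx /\ M *m e0c = e0c.
Proof.
move=> [Mc AM]; split=> //; have [sA _ _ _] := subA.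
by have [] := amx_unit (sA _ AM); rewrite ofamxK.
Qed.

Lemma matrix_groupV M : matrix_group M -> matrix_group (invmx M).
Proof.
move=> [Mc AM]; have [sA _ _ invA] := subA.
have [_] := amx_unit (sA _ AM); rewrite ofamxK// => <-.
by apply: matrix_group_amx; exact: invA.
Qed.

(** Equations in the coordinates of [affine_map V] are pulled back along [ofamx], which is linear.
    [A] is closed only inside [Aff], whence the assumption that [M] is invertible. *)
Lemma matrix_group_equations : exists qs : seq (('I_n.+1 * 'I_n.+1 -> R) -> R),
  (forall i, (i < size qs)%N -> polyfun (nth (fun=> 0) qs i)) /\
  forall M, M \in unitmx -> M *m e0c = e0c ->
    matrix_group M <-> forall i, (i < size qs)%N -> nth (fun=> 0) qs i (entries M) = 0.
Proof.
have [I AE] := closedA.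
have [s sP] := Noetherian.finite_zero_locus I.
pose q (p : mpoly.mpoly (\dim {:affine_map V}) R) (y : 'I_n.+1 * 'I_n.+1 -> R) :=
  mpoly.meval (coordinates (ofamx (of_entries y)) 0) p.
exists (map q s); split=> [i|M uM Mc]; rewrite size_map.
  move=> ilt; rewrite (nth_map 0)//.
  by apply: polyfun_meval => j; exact: polyfun_coordinates_ofamx.
have qE i : (i < size s)%N -> nth (fun=> 0) (map q s) i (entries M) =
    mpoly.meval (coordinates (ofamx M) 0) (nth 0 s i).
  by move=> ilt; rewrite (nth_map 0)// /q entriesK.
split=> [[_]|h].
  rewrite AE => -[_ /= zM] i ilt; rewrite qE//.
  by apply: (sP (coordinates (ofamx M) 0)).1; rewrite ?mem_nth.
split=> //; rewrite AE; split; first exact: unit_Aff.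
apply: (sP (coordinates (ofamx M) 0)).2 => p /(nthP 0)[i ilt <-].
by rewrite -qE// h.
Qed.

Definition matrix_hom (rho : maps) (k : Zn) : 'M[R]_n.+1 := amx (rho k : affine_map V).

Section Homs.
Context (rho : maps).
Hypothesis rhoA : homs A rho.
Local Notation g := (matrix_hom rho).

(** [amx] reverses the product, and commutativity of Z^n restores the order. *)
Lemma matrix_homD k k' : g (k + k') = g k * g k'.
Proof. by rewrite addrC /matrix_hom (proj2 rhoA) amxM. Qed.

Lemma matrix_hom_group k : matrix_group (g k).
Proof. by apply: matrix_group_amx; exact: (proj1 rhoA). Qed.

Lemma matrix_hom0 : g 0 = 1.
Proof.
have [u _] := matrix_group_unit (matrix_hom_group 0).
apply: (can_inj (mulKmx u)); rewrite mulmxE -matrix_homD addr0.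
by rewrite -mulmxE mulmx1.
Qed.

Lemma matrix_hom_e0c k : g k *m e0c = e0c.
Proof. exact: amx_e0c. Qed.

End Homs.

Lemma euclidean_compact_image m (K : set 'rV[R]_m) (f : 'rV[R]_m -> V) :
  compact K -> (forall j, continuous (fun u => coordinates (f u) 0 j)) ->
  compact [set (f u : euclidean V) | u in K].
Proof.
move=> cK cf; apply: (@continuous_compact _ (euclidean V) f K) => //.
apply: continuous_subspaceT => u; apply: continuous_to_initial.
by apply: continuous_mx => i j; rewrite (ord1 i); exact: cf.
Qed.

Lemma crystallographic_unipotent (rho : maps) :
  crystallographic_homs A rho ->
  (forall i, nilpotent_mx (matrix_hom rho (delta_mx 0 i) - 1)) /\
  frame (matrix_hom rho) \in unitmx.
Proof.
move=> [rhoA inj_rho [_ pd _]].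
apply: unipotent_frame; [exact: matrix_homD|exact: matrix_hom0|exact: matrix_hom_e0c|].
move=> f pf f1.
pose fv (u : 'rV[R]_n) : V := row_point (f (fun j => u 0 j)).
pose cubeset : set 'rV[R]_n := [set u | forall j, `[0, 1]%classic (u 0 j)].
have ccube : compact cubeset.
  by apply: (@rV_compact R n (fun=> `[0, 1]%classic)) => j; exact: segment_compact.
have cK : compact [set (fv u : euclidean V) | u in cubeset].
  apply: euclidean_compact_image => // j u.
  rewrite (_ : (fun _ => _) = fun u : 'rV[R]_n => f (fun j => u 0 j) 0 (lift 0 j)).
    apply: (continuous_polymx (f := f) (h := fun u : 'rV[R]_n => fun j => u 0 j)) => // i.
    exact: coord_continuous.
  by apply/funext => u'; rewrite /fv -point_rowl row_pointK.
(* Proper discontinuity gives finitely many elements of the image; injectivity of [rho] gives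
   finitely many [k]. *)
have := finite_preimage (f := rho : Zn -> affine_map V) (in2W inj_rho) (pd _ cK).
apply: sub_finite_set => k [s [s' [cs cs' fk]]].
split; first by exists k.
have in_cube t : cube t -> cubeset (\row_j t j).
  by move=> ct j /=; rewrite mxE in_itv; exact: ct.
have fvE t : fv (\row_j t j) = row_point (f t).
  by rewrite /fv; congr (row_point (f _)); apply/funext => j; rewrite mxE.
exists (row_point (f s')); split.
  exists (row_point (f s)); first by exists (\row_j s j); [exact: in_cube|exact: fvE].
  apply: (can_inj (@point_rowK R V)).
  by rewrite point_row_act !row_pointK.
by exists (\row_j s' j); [exact: in_cube|exact: fvE].
Qed.

Definition frame_of (x : X) : 'M[R]_n := frame (matrix_hom (set_val x)).
Definition logs_of (x : X) : 'I_n -> 'M[R]_n.+1 := normal_log (matrix_hom (set_val x)).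

Lemma crystallographicP (x : X) : crystallographic_homs A (set_val x).
Proof. by case: x => rho rhoA; exact: set_mem. Qed.

Lemma crystallographic_repr (x : X) :
  [/\ frame_of x \in unitmx, normal_logs (logs_of x) &
    forall k, matrix_hom (set_val x) k =
      conj_frame (frame_of x) (mexp (lincomb (logs_of x) (intr_row k)))].
Proof.
have cx := crystallographicP x; have [hx _ _] := cx.
have [nx ux] := crystallographic_unipotent cx.
have gD := matrix_homD hx; have g0 := matrix_hom0 hx.
have gk := matrix_hom_e0c (set_val x).
split=> //; first exact: normal_log_normal.
by move=> k; exact: normal_log_repr.
Qed.

Lemma crystallographic_data (x : X) : frame_data matrix_group (frame_of x) (logs_of x).
Proof.
have [ux nx xE] := crystallographic_repr x; split=> // i.
have := matrix_hom_group (let: And3 h _ _ := crystallographicP x in h) (delta_mx 0 i).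
by rewrite xE intr_row_delta lincomb_delta.
Qed.

(** * From framed data back to a crystallographic homomorphism *)

Section Converse.
Context (b : 'M[R]_n) (l : 'I_n -> 'M[R]_n.+1).
Hypothesis bl : frame_data matrix_group b l.

Definition data_hom : maps :=
  fun k => ofamx (conj_frame b (mexp (lincomb l (intr_row k)))).

Lemma data_homE k : matrix_hom data_hom k = conj_frame b (mexp (lincomb l (intr_row k))).
Proof.
have [_ [_ _ kl _] _] := bl.
by rewrite /matrix_hom ofamxK//; apply: conj_frame_e0c; exact: mexp_lincomb_ker.
Qed.

Lemma data_hom_homs : homs A data_hom.
Proof.
have [qs [qs_poly qsP]] := matrix_group_equations.
split=> [k|k k'].
  have := frame_data_group qs_poly matrix_group1 matrix_groupM qsP bl (intr_row k).
  by case.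
apply: (@amx_inj R V); rewrite amxM -!/(matrix_hom data_hom _) !data_homE.
by rewrite addrC intr_rowD (conj_mexpD bl).
Qed.

Lemma data_hom_inj : injective data_hom.
Proof.
have [ub nl _] := bl.
move=> k k' kk'; apply: (@intr_row_inj R); apply: (e0r_mexp nl).
have := data_homE k; rewrite {1}/matrix_hom kk' -/(matrix_hom data_hom k') data_homE.
move=> /(congr1 (conj_frame (invmx b))); rewrite !conj_frameK//.
by move=> ->.
Qed.

(* the diffeomorphism of R^n onto V conjugating the translations by integral
   vectors to the action of [data_hom] *)
Definition dev_point (s : 'I_n -> R) : V :=
  row_point (e0r *m mexp (lincomb l s) *m hat b).

Definition undev_point (x : V) : 'I_n -> R :=
  undev l (fun j => (point_row x *m hat (invmx b)) 0 (lift 0 j)).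

Lemma point_row_dev s : point_row (dev_point s) = e0r *m mexp (lincomb l s) *m hat b.
Proof.
have [_ [_ _ kl _] _] := bl.
by rewrite row_pointK// -!mulmxA hat_e0c mexp_lincomb_ker// e0r_e0c.
Qed.

Lemma dev_pointK s : undev_point (dev_point s) = s.
Proof.
have [ub nl _] := bl.
rewrite /undev_point point_row_dev -!mulmxA mulmxE hat_unit// mulr1.
rewrite -[RHS](devK nl); congr undev; apply/funext => j.
by rewrite -rowE [LHS]mxE.
Qed.

Lemma undev_pointK x : dev_point (undev_point x) = x.
Proof.
have [ub nl _] := bl.
apply: (can_inj (@point_rowK R V)); rewrite point_row_dev.
rewrite (@row_dev _ _ _ nl (point_row x *m hat (invmx b))).
- by rewrite -mulmxA mulmxE hat_unitV// mulmx1.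
- by rewrite -mulmxA hat_e0c point_row_e0c.
- by move=> j; rewrite undevK.
Qed.

Lemma data_hom_act k s :
  aff_act (data_hom k) (dev_point s) = dev_point (fun i => s i + intr_row k i).
Proof.
have [ub [cl nnl kl nrm] _] := bl.
apply: (can_inj (@point_rowK R V)); rewrite point_row_act -/(matrix_hom data_hom k) data_homE.
rewrite !point_row_dev mexp_lincombD// /conj_frame -!mulmxE !mulmxA.
by rewrite -(mulmxA _ (hat b)) mulmxE hat_unit// mulmx1.
Qed.

Lemma dev_point_continuous m (h : 'rV[R]_m -> 'I_n -> R) j :
  (forall i, continuous (h^~ i)) ->
  continuous (fun u => coordinates (dev_point (h u)) 0 j).
Proof.
move=> ch u; rewrite (_ : (fun _ => _) =
  fun u => (e0r *m mexp (lincomb l (h u)) *m hat b) 0 (lift 0 j)).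
  apply: (continuous_polymx (f := fun s => e0r *m mexp (lincomb l s) *m hat b)) => [|i].
    apply: polymxM; last exact: polymx_cst.
    apply: polymxM; first exact: polymx_cst.
    by apply: polymx_mexp; apply: polymx_lincomb => i; [exact: polymx_cst|exact: polyfun_var].
  exact: ch.
by apply/funext => u'; rewrite -point_rowl point_row_dev.
Qed.

Lemma undev_point_continuous j : continuous (fun x : euclidean V => undev_point x j).
Proof.
move=> x.
pose h (x : euclidean V) (i : 'I_n) : R := coordinates (x : V) 0 i.
have ch i : {for x, continuous (h^~ i)}.
  apply: (@continuous_comp _ _ _ (fun x : euclidean V => coordinates (x : V)) (fun u : 'rV[R]_n => u 0 i)).
    exact: initial_continuous.
  exact: coord_continuous.
pose f (z : 'I_n -> R) : R := undev l (fun j =>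
  (row_mx (1 : 'M[R]_1) (\row_i z i) *m (hat (invmx b) : 'M[R]_(1 + n)) : 'rV[R]_n.+1) 0 (lift 0 j)) j.
rewrite (_ : (fun _ => _) = fun y => f (h y)).
  apply: continuous_polyfun ch.
  apply: (polyfun_comp (polyfun_undev l j)) => i.
  apply: polymxM; last exact: polymx_cst.
  move=> a c; rewrite -(fintype.splitK c); case: (fintype.split c) => c' /=.
    by under eq_fun do rewrite row_mxEl; exact: polyfun_cst.
  by under eq_fun do rewrite row_mxEr mxE; exact: polyfun_var.
apply/funext => y; rewrite /f /h /undev_point /point_row.
suff -> : \row_i coordinates (y : V) 0 i = coordinates (y : V) by [].
by apply/rowP => i; rewrite mxE.
Qed.

Lemma aff_act_mul (g h : affine_map V) x : aff_act (aff_mul g h) x = aff_act g (aff_act h x).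
Proof.
by apply: (can_inj (@point_rowK R V)); rewrite !point_row_act amxM mulmxA.
Qed.

Lemma aff_orbit_act k x :
  aff_orbit (range data_hom) (aff_act (data_hom k) x) = aff_orbit (range data_hom) x.
Proof.
have [_ hD] := data_hom_homs.
rewrite predeqE => y; split=> -[_ [k' _ <-] <-].
  by exists (data_hom (k' + k)); [exists (k' + k)|rewrite hD aff_act_mul].
exists (data_hom (k' - k)); first by exists (k' - k).
by rewrite -aff_act_mul -hD subrK.
Qed.

(** Through [dev_point] the action becomes that of Z^n on R^n by integral translations: the
    coordinates of a compact set are bounded, and the unit cube meets every orbit. *)
Lemma data_hom_crystallographic : crystallographic_homs A data_hom.
Proof.
have hh := data_hom_homs; have [sA A1 mulA invA] := subA.
have hom0 : data_hom 0 = aff_one V.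
  by apply: (@amx_inj R V); rewrite amx1; exact: (matrix_hom0 hh).
split=> //; first exact: data_hom_inj.
split.
- split.
  + by move=> _ [k _ <-]; apply: sA; exact: (proj1 hh).
  + by exists 0.
  + by move=> _ _ [k _ <-] [k' _ <-]; exists (k + k') => //; exact: (proj2 hh).
  + move=> _ [k _ <-]; exists (- k) => //.
    apply: (@amx_inj R V); have [u ->] := amx_unit (sA _ (proj1 hh k)).
    have e1 : matrix_hom data_hom (- k) *m amx (data_hom k) = 1.
      by rewrite mulmxE -(matrix_homD hh (- k) k) addNr (matrix_hom0 hh).
    by rewrite -[LHS](mulmxK u) [_ *m amx _]e1 mul1mx.
- move=> K cK.
  have bK j : exists r : R, forall x, K x -> `|undev_point x j| <= r.
    have : compact [set (undev_point (x : V) j : R) | x in K].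
      apply: (@continuous_compact (euclidean V) R (fun x => undev_point x j)) => //.
      by apply: continuous_subspaceT; exact: undev_point_continuous.
    move=> /compact_bounded[M [_ MP]]; exists (M + 1) => x Kx.
    by apply: (MP (M + 1)); [rewrite ltrDl|exists x].
  have [r rP] := choice bK.
  (* A coordinate and its translate by [k i] are both bounded by [r i], so the translation is at
     most twice that. *)
  pose N := \max_i Num.truncn (2 * `|r i|).
  pose F := [set k : Zn | forall i, (`|k 0%R i| <= N)%N].
  have finF : finite_set F by exact: finite_bounded_int_rows.
  apply: sub_finite_set (finite_image data_hom finF) => _ [[k _ <-] [y [[x Kx <-] Kkx]]].
  exists k => // i.
  have h1 := rP i x Kx; have h2 := rP i _ Kkx.
  rewrite -(undev_pointK x) data_hom_act dev_pointK in h2.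
  have h3 : `|intr_row k i : R| <= 2 * `|r i|.
    have := ler_norm (r i).
    rewrite (_ : intr_row k i = (undev_point x i + intr_row k i) - undev_point x i).
      by have := ler_normB (undev_point x i + intr_row k i) (undev_point x i); lra.
    by rewrite addrC addKr.
  apply: leq_trans (leq_bigmax i); rewrite -ltnS -(ltr_nat R).
  apply: le_lt_trans (truncnS_gt _).
  by rewrite natr_absz intr_norm.
- pose cubeset : set 'rV[R]_n := [set u | forall j, `[0, 1]%classic (u 0 j)].
  have ccube : compact cubeset.
    by apply: (@rV_compact R n (fun=> `[0, 1]%classic)) => j; exact: segment_compact.
  have cK : compact [set (dev_point (fun j => u 0 j) : euclidean V) | u in cubeset].
    apply: euclidean_compact_image => // j; apply: dev_point_continuous => i u.
    exact: coord_continuous.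
  pose piV := \pi_(orbit_space (aff_orbit (range data_hom)))%qT.
  have : compact (piV @` [set (dev_point (fun j => u 0 j) : euclidean V) | u in cubeset]).
    apply: continuous_compact cK; apply: continuous_subspaceT; exact: pi_continuous.
  congr compact; rewrite predeqE => q; split=> // _.
  pose x : V := repr q; pose s := undev_point x.
  (* Subtracting the integral parts brings [s] into the unit cube. *)
  pose k : Zn := \row_i - Num.floor (s i).
  have skE i : s i + intr_row k i = s i - (Num.floor (s i))%:~R.
    by rewrite /intr_row mxE intrN.
  exists (dev_point (fun i => s i + intr_row k i)).
    exists (\row_i (s i + intr_row k i)); last first.
      by congr dev_point; apply/funext => j; rewrite mxE.
    move=> j /=; rewrite mxE skE in_itv /=.
    by have /andP[h1 h2] := floor_itv (s j); rewrite intrD in h2; apply/andP; split; lra.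
  rewrite -data_hom_act undev_pointK -[RHS]reprK; apply/pi_orbitP.
  exact: aff_orbit_act.
Qed.

End Converse.

Lemma continuous_matrix_hom k i j : continuous (fun x : X => matrix_hom (set_val x) k i j).
Proof.
move=> x; have [f pf fE] := @polyfun_amx R V i j.
rewrite (_ : (fun _ => _) = fun x : X => f (coordinates (set_val x k : affine_map V) 0)).
  apply: (continuous_polyfun (h := fun x : X => coordinates (set_val x k : affine_map V) 0)) => // m.
  apply: (@continuous_comp X 'rV[R]_(\dim {: affine_map V}) R
    (fun x : X => coordinates (set_val x k : affine_map V)) (fun u => u 0 m)); last exact: coord_continuous.
  apply: (@continuous_comp X (euclidean (affine_map V)) _ (fun x : X => set_val x k)
    (fun w : euclidean (affine_map V) => coordinates (w : affine_map V))); last exact: initial_continuous.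
  apply: (@continuous_comp X maps _ (fun x : X => set_val x) (fun rho : maps => rho k)).
    exact: initial_continuous.
  exact: (@proj_continuous Zn (fun=> euclidean (affine_map V)) k).
by apply/funext => x'; rewrite /matrix_hom fE.
Qed.

Lemma continuous_generator_log (x : X) i a b :
  {for x, continuous (fun x : X => generator_log (matrix_hom (set_val x)) i a b)}.
Proof.
pose h (x : X) := entries (matrix_hom (set_val x) (delta_mx 0 i)).
rewrite (_ : (fun _ => _) = fun x => mlog1p (of_entries (h x) - 1) a b).
  apply: (continuous_polymx (f := fun z => mlog1p (of_entries z - 1))) => [|ij].
    by apply: polymx_mlog; apply: polymxB; [exact: polymx_of_entries|exact: polymx_cst].
  exact: continuous_matrix_hom.
by apply/funext => y; rewrite entriesK.
Qed.

Lemma continuous_frame_of i j : continuous (fun x : X => frame_of x i j).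
Proof.
move=> x; rewrite (_ : (fun _ => _) =
  fun x : X => generator_log (matrix_hom (set_val x)) i 0 (lift 0 j)).
  exact: continuous_generator_log.
by apply/funext => y; rewrite mxE.
Qed.

Lemma continuous_inv_frame_of i j : continuous (fun x : X => invmx (frame_of x) i j).
Proof.
move=> x; apply: continuous_invmx => [y|a b]; last exact: continuous_frame_of.
by have [] := crystallographic_repr y.
Qed.

Lemma continuous_hat (Y : topologicalType) (M : Y -> 'M[R]_n) (y : Y) i j :
  (forall a b, {for y, continuous (fun y => M y a b)}) ->
  {for y, continuous (fun y => hat (M y) i j)}.
Proof.
move=> cM; rewrite (_ : (fun _ => _) = fun y => hat (of_entries (entries (M y))) i j).
  apply: (continuous_polymx (f := fun z => hat (of_entries z)) (h := fun y => entries (M y))) => [|ij].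
    by apply: polymx_hat; exact: polymx_of_entries.
  exact: cM.
by apply/funext => z; rewrite entriesK.
Qed.

Lemma continuous_logs_of k i j : continuous (fun x : X => logs_of x k i j).
Proof.
move=> x; rewrite (_ : (fun _ => _) = fun x : X =>
  ((hat (frame_of x) *m generator_log (matrix_hom (set_val x)) k) *m
   hat (invmx (frame_of x))) i j).
  apply: (continuous_mulmx
    (A := fun x : X => hat (frame_of x) *m generator_log (matrix_hom (set_val x)) k)
    (B := fun x : X => hat (invmx (frame_of x)))) => a b.
    apply: continuous_mulmx => a' b'; last exact: continuous_generator_log.
    by apply: continuous_hat => c d; exact: continuous_frame_of.
  by apply: continuous_hat => c d; exact: continuous_inv_frame_of.
by apply/funext => y; rewrite /logs_of /normal_log /conj_frame invmxK.
Qed.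

(** Each value of a homomorphism is a fixed polynomial in the frame, its inverse and the logarithms.
    [Psi] evaluates these polynomials at arbitrary vectors, with values in all maps from Z^n, so its
    continuity for the product topology needs no condition on the vector. *)
Lemma crystallographic_nbhs (x0 : X) (U : set X) : nbhs x0 U ->
  exists2 e : R, 0 < e & forall x : X,
    (forall i j, `|frame_of x i j - frame_of x0 i j| < e) ->
    (forall i j, `|invmx (frame_of x) i j - invmx (frame_of x0) i j| < e) ->
    (forall k i j, `|logs_of x k i j - logs_of x0 k i j| < e) -> U x.
Proof.
pose J : finType := ('I_n * 'I_n + ('I_n * 'I_n + 'I_n * ('I_n.+1 * 'I_n.+1)))%type.
pose vf (x : X) : J -> R := sumf (entries (frame_of x))
  (sumf (entries (invmx (frame_of x))) (fun t => logs_of x t.1 t.2.1 t.2.2)).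
pose v x : 'rV[R]_#|J| := \row_j vf x (enum_val j).
pose c (u : 'rV[R]_#|J|) (j : J) := u 0 (enum_rank j).
have cv x : c (v x) = vf x by apply/funext => j; rewrite /c mxE enum_rankK.
pose mx (z : J -> R) (k : Zn) : 'M[R]_n.+1 :=
  hat (of_entries (z \o inr \o inl)) *m
  mexp (lincomb (fun i => of_entries (fun t => z (inr (inr (i, t))))) (intr_row k)) *m
  hat (of_entries (z \o inl)).
have pmx k : polymx (mx^~ k).
  apply: polymxM; last by apply: polymx_hat; apply: polymx_mx => i j; exact: polyfun_var.
  apply: polymxM; first by apply: polymx_hat; apply: polymx_mx => i j; exact: polyfun_var.
  apply: polymx_mexp; apply: polymx_lincomb => i; last exact: polyfun_cst.
  by apply: polymx_mx => a b; exact: polyfun_var.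
pose Psi (u : 'rV[R]_#|J|) : maps := fun k => ofamx (mx (c u) k).
have PsiE x : Psi (v x) = set_val x.
  apply/funext => k; rewrite -[RHS](@amxK R V) /Psi; congr ofamx.
  have [_ _ xE] := crystallographic_repr x.
  rewrite -[RHS]/(matrix_hom (set_val x) k) xE cv /mx /conj_frame.
  rewrite (entriesK (frame_of x)) (entriesK (invmx (frame_of x))).
  suff -> : (fun i => of_entries (fun t => vf x (inr (inr (i, t))))) = logs_of x by [].
  by apply/funext => i; apply/matrixP => a b; rewrite mxE.
have cPsi : continuous Psi.
  move=> u; apply: continuous_to_prod => k; apply: continuous_to_initial.
  apply: continuous_mx => i j; rewrite (ord1 i).
  pose f (z : 'I_n.+1 * 'I_n.+1 -> R) := coordinates (ofamx (of_entries z)) 0 j.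
  rewrite (_ : (fun _ => _) = fun u => f (entries (mx (c u) k))).
    apply: (continuous_polyfun (f := fun z => f (entries (mx z k))) (h := c)) => [|t].
      apply: (polyfun_comp (f := f) (h := fun z => entries (mx z k))) => [|ij].
        exact: polyfun_coordinates_ofamx.
      exact: pmx.
    exact: coord_continuous.
  by apply/funext => w; rewrite /f entriesK.
move=> [/= _ [[W oW <-]] /= Wx0 WU].
have : nbhs (v x0) (Psi @^-1` W).
  by apply: cPsi; rewrite PsiE; exact: open_nbhs_nbhs.
move=> /nbhs_mxP[e e0 eW]; exists e => // x hb hc hl.
apply: WU => /=; rewrite -PsiE; apply: eW => i j; rewrite !mxE.
by case: (enum_val j) => [[a b]|[[a b]|[a [a' b]]]]; [exact: hb|exact: hc|exact: hl].
Qed.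

Lemma conj_orbitP (x y : X) : conj_orbit x y <-> exists a, matrix_group a /\
  forall k, matrix_hom (set_val y) k = invmx a * matrix_hom (set_val x) k * a.
Proof.
have [sA _ _ _] := subA.
have amxc a k : A a -> amx (aff_mul (aff_mul a (set_val x k)) (aff_inv a)) =
    invmx (amx a) * matrix_hom (set_val x) k * amx a.
  by move=> Aa; rewrite !amxM (amx_unit (sA _ Aa)).2 mulrA.
split=> [[a Aa aE]|[M [[Mc AM] ME]]].
  exists (amx a); split; first exact: matrix_group_amx.
  by move=> k; rewrite /matrix_hom aE amxc.
exists (ofamx M) => // k; apply: (@amx_inj R V).
by rewrite amxc// ofamxK// -ME.
Qed.

Lemma conj_orbit_eq (x y : X) : conj_orbit x = conj_orbit y <-> conj_orbit x y.
Proof.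
have refl (z : X) : conj_orbit z z.
  apply/conj_orbitP; exists 1; split=> [|k]; first exact: matrix_group1.
  by rewrite invmx1 mul1r mulr1.
have trans (z1 z2 z3 : X) : conj_orbit z1 z2 -> conj_orbit z2 z3 -> conj_orbit z1 z3.
  move=> /conj_orbitP[a [Ga aE]] /conj_orbitP[b [Gb bE]]; apply/conj_orbitP.
  exists (a * b); split=> [|k]; first exact: matrix_groupM.
  have [[ua _] [ub _]] := (matrix_group_unit Ga, matrix_group_unit Gb).
  have ab : invmx (a * b) = invmx b * invmx a by exact: invmxM.
  by rewrite bE aE ab !mulrA.
have sym (z1 z2 : X) : conj_orbit z1 z2 -> conj_orbit z2 z1.
  move=> /conj_orbitP[a [Ga aE]]; apply/conj_orbitP.
  exists (invmx a); split=> [|k]; first exact: matrix_groupV.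
  have [ua _] := matrix_group_unit Ga.
  have aV : a * invmx a = 1 by exact: mulmxV.
  by rewrite aE invmxK !mulrA aV mul1r -mulrA aV mulr1.
split=> [e|xy]; first by rewrite e.
rewrite predeqE => z; split=> h; [exact: trans (sym _ _ xy) h|exact: trans xy h].
Qed.

(** [conj_stabilizer] presents [y] by the frame [frame_of x *m h] and the logarithms of [x];
    uniqueness of the framed data identifies them with those of [y]. Conversely [hat h] itself
    conjugates [x] to [y]. *)
Lemma conj_orbit_frame (x y : X) : conj_orbit x = conj_orbit y <->
  exists h, [/\ stabilizer matrix_group h, frame_of y = frame_of x *m h &
    logs_of y = logs_of x].
Proof.
have [qs [qs_poly qsP]] := matrix_group_equations.
have [ux nx xE] := crystallographic_repr x.
have [uy ny yE] := crystallographic_repr y.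
split=> [/conj_orbit_eq/conj_orbitP[a [Ga aE]]|[h [Hh bE lE]]].
  have [h [Hh hE]] := conj_stabilizer qs_poly matrix_group1 matrix_groupM matrix_groupV
    matrix_group_unit qsP (crystallographic_data x) Ga.
  have [uh _] := stabilizerV matrix_groupV matrix_group_unit Hh.
  have yE' k : matrix_hom (set_val y) k =
      conj_frame (frame_of x *m h) (mexp (lincomb (logs_of x) (intr_row k))).
    by rewrite aE xE hE.
  have uxh : frame_of x *m h \in unitmx by rewrite unitmx_mul ux.
  exists h; split=> //; first exact: (frameE uxh nx yE').
  exact: (normal_logE uxh nx yE').
have [uh _] := stabilizerV matrix_groupV matrix_group_unit Hh.
apply/conj_orbit_eq/conj_orbitP; exists (hat h); split=> // k.
by rewrite yE xE bE lE conj_frame_comp// [LHS]/conj_frame hatV.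
Qed.

Lemma crystallographic_surj b l : frame_data matrix_group b l ->
  exists x : X, frame_of x = b /\ logs_of x = l.
Proof.
move=> bl; have [ub nl _] := bl.
have dX : data_hom b l \in (X : set maps) by rewrite inE; exact: data_hom_crystallographic.
exists (exist (fun rho : maps => rho \in (X : set maps)) (data_hom b l) dX); split.
  exact: (frameE ub nl (data_homE bl)).
exact: (normal_logE ub nl (data_homE bl)).
Qed.

Lemma deformation_space_semi_algebraic : exists (N : nat) (S : set 'rV[R]_N),
  semi_algebraic S /\ homeomorphic (deformation_space Zn A) S.
Proof.
have [qs [qs_poly qsP]] := matrix_group_equations.
have [k [D [C [pC fC cC]]]] := stabilizer_row_space qs_poly matrix_group1 matrix_groupM
  matrix_groupV matrix_group_unit qsP.
apply: (framed_orbit_space_semi_algebraic qs_poly matrix_group1 matrix_groupM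
  matrix_groupV matrix_group_unit qsP crystallographic_data crystallographic_surj
  continuous_frame_of continuous_logs_of crystallographic_nbhs conj_orbit_frame pC fC cC).
Qed.

End CrystallographicHoms.

Theorem theorem2p4 (R : realType) (n : nat) (V : vectType R)
    (dimV : \dim {:V} = n) (A : set (affine_map V))
    (subA : aff_subgroup A) (closedA : zariski_closed A)
    (transA : acts_transitively A) :
  (exists (N : nat) (S : set 'rV[R]_N),
     semi_algebraic S /\
     homeomorphic (deformation_space 'rV[int]_n A) S) /\
  hausdorff_space (deformation_space 'rV[int]_n A).
Proof.
have [N [S [sS hS]]] : exists (N : nat) (S : set 'rV[R]_N),
    semi_algebraic S /\ homeomorphic (deformation_space 'rV[int]_n A) S.
  by rewrite -dimV; exact: deformation_space_semi_algebraic.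
by split; [exists N, S|exact: homeomorphic_hausdorff hS].
Qed.
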